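(* Let $1<p<\infty$. There is a constant $C(n,p)$ depending only on $n$ and $p$ such that for all weights $\mu,\lambda\in A_p^{\mathcal{D}}$ on $\mathbb{R}^n$, with $\nu:=\mu^{1/p}\lambda^{-1/p}$, and all $b\in BMO^{\mathcal{D}}(\nu)$, $$\|\Pi_b:L^p(\mu)\to L^p(\lambda)\|\le C(n,p)\,\|b\|_{BMO^{\mathcal{D}}(\nu)}\,[\mu]_{A_p}^{\frac1{p-1}}[\lambda]_{A_p}.$$ The same holds for the other paraproducts $\Pi_b^*$ and $\Gamma_b$.
   Context: $\mathcal{D}$ is a fixed dyadic grid on $\mathbb{R}^n$: a collection of cubes with side lengths $2^k$, $k\in\mathbb{Z}$, such that for each fixed $k$ the cubes of side length $2^k$ partition $\mathbb{R}^n$, and $P\cap Q\in\{P,Q,\emptyset\}$ for all $P,Q\in\mathcal{D}$. Haar functions: for an interval $I$, $h_I^0=|I|^{-1/2}(\mathbf{1}_{I_+}-\mathbf{1}_{I_-})$ ($I_\pm$ the right/left halves) and $h_I^1=|I|^{-1/2}\mathbf{1}_I$; for $Q=I_1\times\dots\times I_n\in\mathcal{D}$ and $\epsilon\in\{0,1\}^n$, $h_Q^\epsilon(x)=\prod_kh_{I_k}^{\epsilon_k}(x_k)$, cancellative when $\epsilon\not\equiv1$. For signatures $\epsilon,\eta$, $\epsilon+\eta$ denotes the signature with $k$-th entry $1$ if $\epsilon_k=\eta_k$ and $0$ otherwise, so that $h_Q^\epsilon h_Q^\eta=|Q|^{-1/2}h_Q^{\epsilon+\eta}$. A weight is a locally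 integrable, a.e. positive function; $w(Q)=\int_Qw\,dx$, $\langle f\rangle_Q=\frac1{|Q|}\int_Qf\,dx$, $(f,g)=\int fg\,dx$; $L^p(w)$ is $L^p$ of the measure $w\,dx$. With $1/p+1/p'=1$, $w'=w^{1-p'}$, $w\in A_p^{\mathcal{D}}$ means $[w]_{A_p}:=\sup_{Q\in\mathcal{D}}\langle w\rangle_Q\langle w'\rangle_Q^{p-1}<\infty$. $\|b\|_{BMO^{\mathcal{D}}(w)}=\sup_{Q\in\mathcal{D}}\frac1{w(Q)}\int_Q|b-\langle b\rangle_Q|\,dx$. Paraproducts: $\Pi_bf=\sum_{Q\in\mathcal{D}}\sum_{\epsilon\not\equiv1}(b,h_Q^\epsilon)\langle f\rangle_Qh_Q^\epsilon$; $\Pi_b^*f=\sum_{Q\in\mathcal{D}}\sum_{\epsilon\not\equiv1}(b,h_Q^\epsilon)(f,h_Q^\epsilon)\frac{\mathbf{1}_Q}{|Q|}$; $\Gamma_bf=\sum_{Q\in\mathcal{D}}\sum_{\epsilon,\eta\not\equiv1,\,\epsilon\ne\eta}(b,h_Q^\epsilon)(f,h_Q^\eta)\frac1{\sqrt{|Q|}}h_Q^{\epsilon+\eta}$. $\|T:X\to Y\|$ is the operator norm. *)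

(* Defs.v *)
From HB Require Import structures.
From mathcomp Require Import all_boot all_order all_algebra.
From mathcomp Require Import all_classical all_reals all_analysis.
From mathcomp Require Import measurable_realfun.

Set Implicit Arguments.
Unset Strict Implicit.
Unset Printing Implicit Defensive.
Import Order.TTheory GRing.Theory Num.Theory.
Import numFieldNormedType.Exports.

Local Open Scope classical_set_scope.
Local Open Scope ring_scope.

(** R^n with its Borel (= product) sigma-algebra. *)
Notation Rn R n := (n.-tuple (measurableTypeR R)).

Definition rn_cons (R : realType) n (z : Rn R n * measurableTypeR R) :
    Rn R n.+1 :=
  [tuple of z.2 :: z.1].

(** Lebesgue measure on R^n, as an iterated product of one-dimensional
    Lebesgue measures. *)
Fixpoint leb (R : realType) (n : nat) : set (Rn R n) -> \bar R :=
  match n with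
  | 0 => \d_([tuple] : Rn R 0)
  | n'.+1 => pushforward (@leb R n' \x (@lebesgue_measure R))%E (@rn_cons R n')
  end.

Lemma measurable_rn_cons (R : realType) n :
  measurable_fun [set: Rn R n * measurableTypeR R] (@rn_cons R n).
Proof. exact: measurable_cons measurable_snd measurable_fst. Qed.

Lemma leb_is_measure R n :
  exists m : {measure set (Rn R n) -> \bar R}, @leb R n = m.
Proof.
elim: n => [|n [m mE]]; first by exists (dirac ([tuple] : Rn R 0)).
by exists (measure_function_pushforward__canonical__measure_function_Measure
  (m \x (@lebesgue_measure R))%E (@measurable_rn_cons R n)); rewrite /= mE.
Qed.

Section leb_instance.
Context (R : realType) (n : nat).
Local Open Scope ereal_scope.

Let leb0 : @leb R n set0 = 0.
Proof. by have [m ->] := leb_is_measure R n; exact: measure0. Qed.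

Let leb_ge0 A : 0 <= @leb R n A.
Proof. by have [m ->] := leb_is_measure R n; exact: measure_ge0. Qed.

Let leb_sigma_additive : semi_sigma_additive (@leb R n).
Proof.
have [m ->] := leb_is_measure R n; exact: measure_semi_sigma_additive.
Qed.

HB.instance Definition _ := isMeasure.Build _ _ _ (@leb R n)
  leb0 leb_ge0 leb_sigma_additive.

End leb_instance.

(** Closed bounded boxes [-M, M]^n are compact, and every compact subset of
    R^n is contained in one of them. *)
Definition locally_integrableRn (R : realType) n (f : Rn R n -> R) : Prop :=
  measurable_fun [set: Rn R n] f /\
  forall M : R, (@leb R n).-integrable
    [set x : Rn R n | forall i, `|tnth x i| <= M] (fun x => (f x)%:E).

Record weight (R : realType) n := Weight {
  weight_fun :> Rn R n -> R ;
  weight_loc : locally_integrableRn weight_fun ;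
  weight_pos : {ae @leb R n, forall x, 0 < weight_fun x} }.

Section weighted_measure.
Context (R : realType) (n : nat).
Local Open Scope ereal_scope.

(** The measure w dx. *)
Definition wmeasure (w : weight R n) (A : set (Rn R n)) : \bar R :=
  \int[@leb R n]_(x in A) (w x)%:E.

Variable w : weight R n.

Let wmeasure0 : wmeasure w set0 = 0.
Proof. by rewrite /wmeasure integral_set0. Qed.

Let we (x : Rn R n) : \bar R := (w x)%:E.

Let mwe : measurable_fun setT we.
Proof. by apply/measurable_EFinP; have [] := weight_loc w. Qed.

Let int_funeneg (A : set (Rn R n)) : \int[@leb R n]_(x in A) we^\- x = 0.
Proof.
have intT : \int[@leb R n]_x we^\- x = 0.
  rewrite (@ae_eq_integral _ _ _ _ setT (cst 0))//; last 2 first.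
  - exact: measurable_funeneg.
  - apply: filterS (weight_pos w) => x wx0 _ /=.
    by rewrite funenegE; apply/max_idPr; rewrite oppe_le0 lee_fin ltW.
  by rewrite integral0.
apply/eqP; rewrite eq_le integral_ge0// andbT -intT.
rewrite ge0_integralE// [leRHS]ge0_integralE// !patch_setT.
apply: ge_ereal_sup => _ [h /= hA <-]; apply: ereal_sup_ubound => /=.
exists h => //= x; apply: le_trans (hA x) _; rewrite patchE.
by case: ifP => // _; exact: funeneg_ge0.
Qed.

Let wmeasureE A : wmeasure w A = \int[@leb R n]_(x in A) we^\+ x.
Proof. by rewrite /wmeasure integralE int_funeneg sube0. Qed.

Let wmeasure_ge0 A : 0 <= wmeasure w A.
Proof. by rewrite wmeasureE integral_ge0. Qed.

Let wmeasure_sigma_additive : semi_sigma_additive (wmeasure w).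
Proof.
move=> F mF tF mUF.
under eq_fun do under eq_bigr do rewrite wmeasureE.
rewrite wmeasureE ge0_integral_bigcup//; last first.
  by apply: measurable_funTS; exact: measurable_funepos.
by apply: is_cvg_nneseries => k _ _; exact: integral_ge0.
Qed.

HB.instance Definition _ := isMeasure.Build _ _ _ (wmeasure w)
  wmeasure0 wmeasure_ge0 wmeasure_sigma_additive.

End weighted_measure.

Section dyadic_paraproducts.
Context (R : realType) (n : nat).
Implicit Types (f g b w : Rn R n -> R).

(** A cube is given by its lower corner a and the exponent k of its side
    length 2^k; the underlying set is the half-open product of the intervals
    [a_i, a_i + 2^k[. *)
Notation cube := (Rn R n * int)%type.

Definition side (Q : cube) : R := 2 ^ Q.2.

Definition cset (Q : cube) : set (Rn R n) :=
  [set x | forall i, tnth Q.1 i <= tnth x i < tnth Q.1 i + side Q].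

Definition dyadic_grid (D : set cube) : Prop :=
  (forall k : int,
     partition [set Q | D Q /\ Q.2 = k] cset [set: Rn R n]) /\
  (forall P Q, D P -> D Q ->
     [\/ cset P `&` cset Q = cset P, cset P `&` cset Q = cset Q |
         cset P `&` cset Q = set0]).

Definition vol (Q : cube) : R := fine (@leb R n (cset Q)).

Definition eavg f (Q : cube) : \bar R :=
  ((@leb R n (cset Q))^-1 * \int[@leb R n]_(x in cset Q) (f x)%:E)%E.

Definition avg f (Q : cube) : R := fine (eavg f Q).

Definition inner f g : R := \int[@leb R n]_x (f x * g x).

(** Haar functions of the interval [a, a + l[. *)
Definition haar1 (a l : R) (e : bool) (t : R) : R :=
  (Num.sqrt l)^-1 *
  (if e then \1_(`[a, a + l[) t
   else \1_(`[a + l / 2, a + l[) t - \1_(`[a, a + l / 2[) t).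

Notation signature := {ffun 'I_n -> bool}.

Definition haar (Q : cube) (e : signature) (x : Rn R n) : R :=
  \prod_(i < n) haar1 (tnth Q.1 i) (side Q) (e i) (tnth x i).

Definition cancellative (e : signature) : bool := e != [ffun => true].

Definition sig_add (e h : signature) : signature := [ffun i => e i == h i].

Definition conj_exp (p : R) : R := (1 - p^-1)^-1.

Definition dual_weight (p : R) w (x : Rn R n) : R := w x `^ (1 - conj_exp p).

Definition Ap_char (D : set cube) (p : R) w : \bar R :=
  ereal_sup [set (eavg w Q * (eavg (dual_weight p w) Q) `^ (p - 1)%R)%E | Q in D].

Definition Ap (D : set cube) (p : R) (w : weight R n) : Prop :=
  (Ap_char D p w < +oo)%E.

Definition bmo_norm (D : set cube) w b : \bar R :=
  ereal_sup [set ((\int[@leb R n]_(x in cset Q) (w x)%:E)^-1 *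
    \int[@leb R n]_(x in cset Q) (`|b x - avg b Q|)%R%:E)%E | Q in D].

Definition BMO (D : set cube) w b : Prop :=
  locally_integrableRn b /\ (bmo_norm D w b < +oo)%E.

Definition bloom_weight (p : R) (mu lambda : weight R n) (x : Rn R n) : R :=
  mu x `^ p^-1 * lambda x `^ (- p^-1).

(** The summand associated with the cube Q in each paraproduct. *)
Definition Pi_term b f (Q : cube) (x : Rn R n) : R :=
  \sum_(e : signature | cancellative e)
    inner b (haar Q e) * avg f Q * haar Q e x.

Definition Pi_star_term b f (Q : cube) (x : Rn R n) : R :=
  \sum_(e : signature | cancellative e)
    inner b (haar Q e) * inner f (haar Q e) * (\1_(cset Q) x / vol Q).

Definition Gamma_term b f (Q : cube) (x : Rn R n) : R :=
  \sum_(e : signature | cancellative e)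
   \sum_(h : signature | cancellative h && (e != h))
    inner b (haar Q e) * inner f (haar Q h) * (Num.sqrt (vol Q))^-1 *
      haar Q (sig_add e h) x.

(** The (unordered) series of the functions u Q, Q in D, converges
    unconditionally to g in L^p(m). *)
Definition Lp_sum (m : {measure set (Rn R n) -> \bar R}) (p : R)
    (D : set cube) (u : cube -> Rn R n -> R) (g : Rn R n -> R) : Prop :=
  forall eps : R, 0 < eps ->
  exists F0 : set cube, [/\ finite_set F0, F0 `<=` D &
    forall F : set cube, finite_set F -> F0 `<=` F -> F `<=` D ->
      ('N[m]_(p%:E)[(fun x => (g x - \sum_(Q \in F) u Q x)%R%:E)] <= eps%:E)%E].

(** Norm of the operator f |-> \sum_(Q in D) term f Q from L^p(m1) to L^p(m2):
    the least admissible constant; it is +oo (infimum of the empty set) if the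
    operator is unbounded or if the series of some f in L^p(m1) fails to
    converge in L^p(m2). *)
Definition opnorm (m1 m2 : {measure set (Rn R n) -> \bar R}) (p : R)
    (D : set cube) (term : (Rn R n -> R) -> cube -> Rn R n -> R) : \bar R :=
  ereal_inf [set K%:E | K in [set K : R | 0 <= K /\
    forall f, f \in Lfun m1 p%:E -> exists g,
      [/\ g \in Lfun m2 p%:E, Lp_sum m2 p D (term f) g &
         ('N[m2]_(p%:E)[(fun x => (g x)%:E)] <=
            K%:E * 'N[m1]_(p%:E)[(fun x => (f x)%:E)])%E]]].

End dyadic_paraproducts.

(* Main.v *)
Require Import Defs.
From mathcomp Require Import all_boot all_order all_algebra.
From mathcomp Require Import all_classical all_reals all_analysis.
From mathcomp Require Import measurable_realfun.
From mathcomp Require Import ring lra zify.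
Set Implicit Arguments.
Unset Strict Implicit.
Unset Printing Implicit Defensive.
Import Order.TTheory GRing.Theory Num.Theory.
Import numFieldNormedType.Exports.
Local Open Scope classical_set_scope.
Local Open Scope ring_scope.

(** The three paraproducts are treated together. Paired with a function g, the
    term of the cube Q is bounded, up to a factor that depends on n, by
      osc_Q(b) (osc_Q(f) G_Q + osc_Q(g) F_Q) / |Q|^2,
    where F_Q and G_Q are the integrals of |f| and |g| over Q and osc_Q(b) is
    the sum over the dyadic children Q' of Q of |int_Q' b - 2^-n int_Q b|
    ([pair_Pi], [pair_Pi_star], [pair_Gamma]). Each product has two factors that
    oscillate: one belongs to b and the other to f or g.

    The sum of this form over a grid is estimated by a stopping-time argument
    ([treesum_bloom]). Start from a cube S and stop at the maximal subcubes on
    which the mean of |f|, of |g| or of |b - <b>_S| exceeds six times its value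
    on S. They cover at most half of S. On the cubes that are not stopped, the
    corona of S, Cauchy-Schwarz and the orthogonality of martingale differences
    bound the sum by a multiple of
      <|f|>_S <|g|>_S int_S |b - <b>_S| <= ||b|| <|f|>_S <|g|>_S nu(S),
    see [corona_form]. With sigma = mu^(1-p') and the A_p conditions for mu and
    lambda, this is at most ||b|| [mu]^(1/p) [lambda]^(1/p) times
      tau F_S^p / sigma(S)^(p-1) + tau^(-p'/p) G_S^p' / lambda(S)^(p'-1)
    for each tau > 0 ([testing_le]). The sum over all S of these two quantities
    is a Carleson embedding. Since the unstopped half of S carries a
    fraction of sigma(S) and of lambda(S) that the A_p conditions bound from
    below, the potential 2^(p-1) int_S |f|^p mu - F_S^p / sigma(S)^(p-1) and its
    analogue for g drop, from S to its stopping cubes, by at least a multiple of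
    the contribution of S ([carleson_gain]); so induction on the generation
    proves the bound.

    For the operator norm let h be a finite partial sum of the series of a
    paraproduct, with arbitrary coefficients in [-1, 1], and let g be its norming
    function |h|^(p-2) h lambda. Then X = int |h|^p lambda is the pairing of h
    with g and int |g|^p' lambda^(1-p') = X, so the estimate bounds X by a sum of
    a term in ||f||^p and a term in X; a suitable tau absorbs the latter
    ([absorb]), which gives the norm bound with the powers 1/(p-1) of [mu] and 1
    of [lambda]. As the bound is uniform in the coefficients, the series converges
    unconditionally in L^p(lambda): by Khintchine's inequality disjoint blocks of
    terms cannot all be large ([block_count]), so the partial sums satisfy the
    Cauchy criterion, and L^p is complete ([unconditional_sum]). *)

(** * Inequalities between real powers *)

Section real_inequalities.
Context {R : realType}.
Implicit Types a b x y z s t : R.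

Lemma powRVM a x : a != 0 -> 0 <= x -> (x `^ a) `^ a^-1 = x.
Proof. by move=> a0 x0; rewrite -powRrM mulfV// powRr1. Qed.

Lemma powRMV a x : a != 0 -> 0 <= x -> (x `^ a^-1) `^ a = x.
Proof. by move=> a0 x0; rewrite -powRrM mulVf// powRr1. Qed.

Lemma le_powR2 a x y : 0 <= a -> 0 <= x -> x <= y -> x `^ a <= y `^ a.
Proof.
move=> a0 x0 xy; apply: ge0_ler_powR => //; rewrite nnegrE //.
exact: le_trans xy.
Qed.

Lemma hoelder_add a b x1 x2 y1 y2 : 0 < a -> 0 < b -> a + b = 1 ->
  0 <= x1 -> 0 <= x2 -> 0 <= y1 -> 0 <= y2 ->
  x1 `^ a * y1 `^ b + x2 `^ a * y2 `^ b <= (x1 + x2) `^ a * (y1 + y2) `^ b.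
Proof.
move=> a0 b0 ab x10 x20 y10 y20.
have := @hoelder2 R (x1 `^ a) (x2 `^ a) (y1 `^ b) (y2 `^ b) a^-1 b^-1.
rewrite !powRVM ?gt_eqF// !invrK; apply; rewrite ?powR_ge0 ?invr_gt0//.
Qed.

Lemma hoelder_sum (I : Type) (r : seq I) (P : pred I) a b (x y : I -> R) :
  0 < a -> 0 < b -> a + b = 1 ->
  (forall i, 0 <= x i) -> (forall i, 0 <= y i) ->
  \sum_(i <- r | P i) x i `^ a * y i `^ b <=
  (\sum_(i <- r | P i) x i) `^ a * (\sum_(i <- r | P i) y i) `^ b.
Proof.
move=> a0 b0 ab x0 y0; elim: r => [|i r IH].
  by rewrite !big_nil mulr_ge0// powR_ge0.
rewrite !big_cons; case: ifP => // _.
apply: le_trans (hoelder_add a0 b0 ab _ _ _ _) => //; last 2 first.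
  exact: sumr_ge0.
  exact: sumr_ge0.
by rewrite lerD2l.
Qed.

(** Young's inequality, without its sharp constants, for the rescaled variables
    s x and s^(-a/b) y, whose geometric mean is that of x and y. *)
Lemma young_scaled a b x y s : 0 < a -> 0 < b -> a + b = 1 ->
  0 <= x -> 0 <= y -> 0 < s ->
  x `^ a * y `^ b <= s * x + s `^ (- (a / b)) * y.
Proof.
move=> a0 b0 ab x0 y0 s0.
have -> : x `^ a * y `^ b = (s * x) `^ a * (s `^ (- (a / b)) * y) `^ b.
  rewrite !powRM ?powR_ge0 ?(ltW s0)// mulrACA -powRrM mulNr divfK ?gt_eqF//.
  by rewrite -powRD ?subrr ?powRr0 ?mul1r// eqxx gt_eqF.
have X0 : 0 <= s * x by rewrite mulr_ge0// ltW.
have Y0 : 0 <= s `^ (- (a / b)) * y by rewrite mulr_ge0// powR_ge0.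
move: (s * x) (s `^ _ * y) X0 Y0 => X Y X0 Y0.
have a1 : a <= 1 by rewrite -ab lerDl ltW.
have b1 : b <= 1 by rewrite -ab lerDr ltW.
have XY : 0 <= X + Y by rewrite addr_ge0.
apply: (@le_trans _ _ ((X + Y) `^ a * (X + Y) `^ b)).
  by apply: ler_pM; rewrite ?powR_ge0//; apply: le_powR2 => //;
    rewrite ?lerDl ?lerDr// ltW.
rewrite -powRD; first by rewrite ab powRr1.
by rewrite ab oner_eq0.
Qed.

Lemma bernoulli_powR k r : 0 <= k < 1 -> 0 <= r ->
  1 + r * k <= (1 - k) `^ (- r) :> R.
Proof.
move=> /andP[k0 k1] r0; have k1' : 0 < 1 - k by rewrite subr_gt0.
rewrite /powR gt_eqF//; apply: le_trans (expR_ge1Dx _).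
rewrite lerD2l mulNr -mulrN ler_wpM2l// lerNr -[leRHS]opprK.
have := le_ln1Dx; move/(_ _ (- k)); rewrite opprK; apply.
by rewrite ltrN2.
Qed.

(** The right-hand side is smallest at t = Q / P; if P or Q vanishes, its infimum
    is 0, and a limit replaces the minimum. *)
Lemma le_geom_mean x P Q : 0 <= P -> 0 <= Q ->
  (forall t, 0 < t -> x <= t * P ^+ 2 + t^-1 * Q ^+ 2) -> x <= 2 * (P * Q).
Proof.
move=> P0 Q0 H; case: (eqVneq P 0) => [P00|Pn].
  rewrite P00 mul0r mulr0; apply/ler_addgt0Pr => e e0; rewrite add0r.
  have t0 : 0 < (Q ^+ 2 + 1) / e by rewrite divr_gt0// ltr_pwDr// sqr_ge0.
  apply: le_trans (H _ t0) _; rewrite P00 expr0n mulr0 add0r invf_div.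
  rewrite mulrAC ler_pdivrMr ?ltr_pwDr ?sqr_ge0//.
  by rewrite ler_wpM2l ?(ltW e0)// lerDl.
case: (eqVneq Q 0) => [Q00|Qn].
  rewrite Q00 !mulr0; apply/ler_addgt0Pr => e e0; rewrite add0r.
  have t0 : 0 < e / (P ^+ 2 + 1) by rewrite divr_gt0// ltr_pwDr// sqr_ge0.
  apply: le_trans (H _ t0) _; rewrite Q00 expr0n mulr0 addr0.
  rewrite mulrAC ler_pdivrMr ?ltr_pwDr ?sqr_ge0//.
  by rewrite ler_wpM2l ?(ltW e0)// lerDl.
have t0 : 0 < Q / P by rewrite divr_gt0// lt_neqAle eq_sym ?Pn ?Qn ?P0 ?Q0.
apply: le_trans (H _ t0) _; rewrite invf_div le_eqVlt; apply/orP; left.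
by apply/eqP; field; rewrite Pn Qn.
Qed.

Lemma le_scaled_geom_mean c x P Q : 0 <= c -> 0 <= P -> 0 <= Q ->
  (forall t, 0 < t -> x <= c * (t * P ^+ 2 + t^-1 * Q ^+ 2)) ->
  x <= 2 * c * (P * Q).
Proof.
rewrite le_eqVlt => /predU1P[<- _ _ /(_ 1 ltr01)|c0 P0 Q0 H].
  by rewrite !mul0r mulr0 mul0r.
rewrite -mulrA mulrCA -ler_pdivrMl// mulrC; apply: le_geom_mean => // t t0.
by rewrite ler_pdivrMr// mulrC H.
Qed.

End real_inequalities.

(** * Stopping decompositions of a tree *)

Section tree.
Context {R : realType} {T : Type} {I : finType} (ch : T -> I -> T).
Implicit Types (X Y phi : T -> R) (W : nat -> T -> R) (k : nat) (Q S : T).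

(** In a tree of cubes, the model of an additive X is the integral of a fixed
    function. *)
Definition tree_additive X := forall Q, X Q = \sum_i X (ch Q i).

Fixpoint treesum phi k Q : R :=
  if k is k'.+1 then phi Q + \sum_i treesum phi k' (ch Q i) else 0.

(** The bad nodes below Q cut its k generations of descendants into the corona
    of Q, reached without meeting a bad node, the leaves, which are the members
    of the corona in generation k, and the stopping nodes, which are the first
    bad ones. *)
Section stopping.
Variable bad : pred T.

Fixpoint corona_sum phi k Q : R :=
  if k is k'.+1 then
    phi Q + \sum_i (if bad (ch Q i) then 0 else corona_sum phi k' (ch Q i))
  else 0.

Fixpoint leaf_sum X k Q : R :=
  if k is k'.+1 then
    \sum_i (if bad (ch Q i) then 0 else leaf_sum X k' (ch Q i))
  else X Q.

(** W receives the number of generations left below the stopping node, so that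
    it can be a truncated tree sum. *)
Fixpoint stop_sum W k Q : R :=
  if k is k'.+1 then
    \sum_i (if bad (ch Q i) then W k' (ch Q i) else stop_sum W k' (ch Q i))
  else 0.

Lemma treesum_split phi k Q :
  treesum phi k Q = corona_sum phi k Q + stop_sum (treesum phi) k Q.
Proof.
elim: k Q => [|k IH] Q /=; first by rewrite addr0.
rewrite -addrA -big_split/=; congr (_ + _); apply: eq_bigr => i _.
by case: ifP => _; rewrite ?add0r.
Qed.

Lemma additive_split X k Q : tree_additive X ->
  X Q = leaf_sum X k Q + stop_sum (fun=> X) k Q.
Proof.
move=> aX; elim: k Q => [|k IH] Q /=; first by rewrite addr0.
rewrite -big_split/= aX; apply: eq_bigr => i _.
by case: ifP => _; rewrite ?add0r.
Qed.

Lemma leaf_sum_ge0 X k Q : (forall Q, 0 <= X Q) -> 0 <= leaf_sum X k Q.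
Proof.
move=> X0; elim: k Q => [//|k IH] Q /=.
by apply: sumr_ge0 => i _; case: ifP.
Qed.

Lemma stop_sum_le W W' k Q : (forall j Q, (j < k)%N -> W j Q <= W' j Q) ->
  stop_sum W k Q <= stop_sum W' k Q.
Proof.
elim: k Q => [//|k IH] Q H /=; apply: ler_sum => i _.
case: ifP => _; first exact: H.
by apply: IH => j Q' jk; apply: H; rewrite ltnW.
Qed.

Lemma stop_sum_ge0 W k Q : (forall j Q, 0 <= W j Q) -> 0 <= stop_sum W k Q.
Proof.
move=> X0; elim: k Q => [//|k IH] Q /=.
by apply: sumr_ge0 => i _; case: ifP.
Qed.

Lemma stop_sum_lin c1 c2 W1 W2 k Q :
  stop_sum (fun j Q => c1 * W1 j Q + c2 * W2 j Q) k Q =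
  c1 * stop_sum W1 k Q + c2 * stop_sum W2 k Q.
Proof.
elim: k Q => [|k IH] Q /=; first by rewrite !mulr0 addr0.
rewrite !mulr_sumr -big_split; apply: eq_bigr => i _ /=.
by case: ifP.
Qed.

Lemma corona_sum_le (good : pred T) phi psi k Q :
  (forall Q, good Q -> phi Q <= psi Q) -> (forall Q, ~~ bad Q -> good Q) ->
  good Q -> corona_sum phi k Q <= corona_sum psi k Q.
Proof.
move=> H bg; elim: k Q => [//|k IH] Q gQ /=; apply: lerD; first exact: H.
by apply: ler_sum => i _; case: ifP => // /negbT /bg /IH.
Qed.

Lemma corona_sum_lin c1 c2 phi1 phi2 k Q :
  corona_sum (fun Q => c1 * phi1 Q + c2 * phi2 Q) k Q =
  c1 * corona_sum phi1 k Q + c2 * corona_sum phi2 k Q.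
Proof.
elim: k Q => [|k IH] Q /=; first by rewrite !mulr0 addr0.
rewrite !mulrDr addrACA; congr (_ + _).
rewrite !mulr_sumr -big_split; apply: eq_bigr => i _ /=.
by case: ifP; rewrite // !mulr0 addr0.
Qed.

(** X is distributed over the leaves and the stopping nodes; on the latter its
    geometric mean bound may use another pair YW, ZW, which lets carleson_gain
    shift weight between the two factors there. *)
Lemma stopping_hoelder a b X Y Z (YW ZW : T -> R) k Q :
  0 < a -> 0 < b -> a + b = 1 -> tree_additive X ->
  (forall Q, 0 <= Y Q) -> (forall Q, 0 <= Z Q) ->
  (forall Q, 0 <= YW Q) -> (forall Q, 0 <= ZW Q) ->
  (forall Q, X Q <= Y Q `^ a * Z Q `^ b) ->
  (forall Q, bad Q -> X Q <= YW Q `^ a * ZW Q `^ b) ->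
  X Q <= (leaf_sum Y k Q + stop_sum (fun=> YW) k Q) `^ a *
         (leaf_sum Z k Q + stop_sum (fun=> ZW) k Q) `^ b.
Proof.
move=> a0 b0 ab aX Y0 Z0 YW0 ZW0 H HW; elim: k Q => [|k IH] Q /=.
  by rewrite !addr0.
rewrite -!big_split aX /=.
apply: le_trans (hoelder_sum _ _ a0 b0 ab _ _) => [|i|i]; last 2 first.
- by case: ifP => _; rewrite ?add0r ?addr_ge0 ?leaf_sum_ge0 ?stop_sum_ge0.
- by case: ifP => _; rewrite ?add0r ?addr_ge0 ?leaf_sum_ge0 ?stop_sum_ge0.
by apply: ler_sum => i _; case: ifP => bi; rewrite ?add0r//; exact: HW.
Qed.

Lemma leaf_sum_hoelder a b X Y Z k Q :
  0 < a -> 0 < b -> a + b = 1 ->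
  (forall Q, 0 <= Y Q) -> (forall Q, 0 <= Z Q) ->
  (forall Q, X Q <= Y Q `^ a * Z Q `^ b) ->
  leaf_sum X k Q <= leaf_sum Y k Q `^ a * leaf_sum Z k Q `^ b.
Proof.
move=> a0 b0 ab Y0 Z0 H; elim: k Q => [//|k IH] Q /=.
apply: le_trans (hoelder_sum _ _ a0 b0 ab _ _) => [|i|i]; last 2 first.
- by case: ifP => // _; rewrite leaf_sum_ge0.
- by case: ifP => // _; rewrite leaf_sum_ge0.
by apply: ler_sum => i _; case: ifP.
Qed.

End stopping.
End tree.

(** * The estimate within one corona *)

Section corona.
Context {R : realType} {T : Type} {I : finType} (ch : T -> I -> T).
Variable v : T -> R.
Hypothesis v_gt0 : forall Q, 0 < v Q.
Let m : R := #|I|%:R.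
Hypothesis v_ch : forall Q i, v (ch Q i) = v Q / m.
Implicit Types (X g b F G : T -> R) (k : nat) (Q S : T).

Let m_gt0 : forall Q : T, I -> 0 < m.
Proof.
by move=> Q i; rewrite ltr0n; apply/card_gt0P; exists i.
Qed.

(** This controls every cancellative Haar coefficient of g on Q. *)
Definition oscillation g Q := \sum_i `|g (ch Q i) - g Q / m|.

(** The squared L^2-norm of the martingale difference of g on Q, when g Q and
    v Q are the integral of a function and the volume of Q. *)
Definition energy g Q := m / v Q * \sum_i (g (ch Q i) - g Q / m) ^+ 2.

Lemma oscillation_ge0 g Q : 0 <= oscillation g Q.
Proof. exact: sumr_ge0. Qed.

Lemma sum_sqr_dev (J : finType) (x : J -> R) : (0 < #|J|)%N ->
  \sum_i (x i - (\sum_i x i) / #|J|%:R) ^+ 2 =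
  \sum_i x i ^+ 2 - (\sum_i x i) ^+ 2 / #|J|%:R.
Proof.
move=> J0; set s := \sum_i x i; set c := s / _.
under eq_bigr do rewrite sqrrB.
rewrite big_split/= sumrB sumr_const -addrA; congr (_ + _).
under eq_bigr do rewrite -mulrnAr.
rewrite -mulr_suml -/s /c -mulr_natl.
by field; rewrite pnatr_eq0 -lt0n.
Qed.

Lemma sqr_sum_le (J : finType) (x : J -> R) :
  (\sum_i x i) ^+ 2 <= #|J|%:R * \sum_i x i ^+ 2.
Proof.
have [J0|J0] := posnP #|J|.
  rewrite J0 mul0r big_pred0 ?expr0n// => i.
  by have := card0_eq J0 i; rewrite inE.
have := sum_sqr_dev x J0.
have : 0 <= \sum_i (x i - (\sum_i x i) / #|J|%:R) ^+ 2.
  by apply: sumr_ge0 => i _; exact: sqr_ge0.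
move=> /[swap] ->; rewrite subr_ge0 ler_pdivrMr ?ltr0n//.
by rewrite mulrC.
Qed.

Lemma sqr_oscillation g Q : oscillation g Q ^+ 2 <= v Q * energy g Q.
Proof.
rewrite /energy mulrA mulrCA divff ?gt_eqF// mulr1.
apply: le_trans (sqr_sum_le _) _.
by under eq_bigr do rewrite real_normK ?num_real//.
Qed.

Lemma energyE g Q : tree_additive ch g ->
  energy g Q = \sum_i g (ch Q i) ^+ 2 / v (ch Q i) - g Q ^+ 2 / v Q.
Proof.
move=> ag; rewrite /energy.
have [I0|I0] := posnP #|I|.
  have E (F : I -> R) : \sum_i F i = 0.
    by rewrite big_pred0// => i; have := card0_eq I0 i; rewrite inE.
  by rewrite ag !E expr0n !mul0r mulr0 subr0.
have m0 : m != 0 by rewrite pnatr_eq0 -lt0n.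
have -> : \sum_i g (ch Q i) ^+ 2 / v (ch Q i) =
    m / v Q * \sum_i g (ch Q i) ^+ 2.
  rewrite mulr_sumr; apply: eq_bigr => i _; rewrite v_ch.
  by field; rewrite m0 gt_eqF.
rewrite [in LHS]ag sum_sqr_dev// -ag -/m.
by field; rewrite m0 gt_eqF.
Qed.

(** Orthogonality of martingale differences: by energyE the energies telescope to
    the sum of g^2 / v over the leaves and the stopping nodes, minus
    g(Q)^2 / v(Q). On a leaf |g| / v is at most alpha; a stopping node has lost a
    factor m in volume to a parent where the bound still held. *)
Lemma corona_energy (bad : pred T) g G alpha k Q : tree_additive ch g ->
  tree_additive ch G -> (forall Q, `|g Q| <= G Q) ->
  (forall Q, ~~ bad Q -> G Q <= alpha * v Q) -> G Q <= alpha * v Q ->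
  0 <= alpha ->
  corona_sum ch bad (energy g) k Q <= m * alpha * G Q - g Q ^+ 2 / v Q.
Proof.
move=> ag aG gG gd + al0; elim: k Q => [|k IH] Q GQ /=.
  rewrite subr_ge0 ler_pdivrMr//.
  have m1 : 1 <= m \/ G Q = 0.
    have [I0|I0] := posnP #|I|; last by left; rewrite ler1n.
    right; rewrite aG big_pred0// => i.
    by have := card0_eq I0 i; rewrite inE.
  have G0 : 0 <= G Q by apply: le_trans (gG Q).
  have gG2 : g Q ^+ 2 <= G Q ^+ 2.
    by rewrite -real_normK ?num_real// ler_sqr ?nnegrE.
  apply: le_trans gG2 _; case: m1 => [m1|->]; last by rewrite expr0n !mulr0 mul0r.
  apply: (@le_trans _ _ (alpha * v Q * G Q)).
    by rewrite expr2 ler_wpM2r.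
  rewrite mulrAC ler_wpM2r ?(ltW (v_gt0 Q))// ler_wpM2r//.
  by rewrite ler_peMl.
rewrite energyE// addrAC lerD2r -big_split/= [G Q]aG mulr_sumr.
apply: ler_sum => i _; have m0 := m_gt0 Q i; case: ifPn => bi.
  rewrite addr0 v_ch invf_div mulrA ler_pdivrMr// mulrC -!mulrA ler_pM2l//.
  have gi : g (ch Q i) ^+ 2 <= G (ch Q i) ^+ 2.
    by rewrite -real_normK ?num_real// ler_sqr ?nnegrE// (le_trans _ (gG _)).
  have Gi : G (ch Q i) <= G Q.
    rewrite [leRHS]aG (bigD1 i)//= lerDl; apply: sumr_ge0 => j _.
    exact: le_trans (gG _).
  apply: le_trans gi _; rewrite expr2 [leRHS]mulrCA ler_wpM2l//.
    exact: le_trans (gG _).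
  exact: le_trans Gi _.
by rewrite addrC -lerBrDr; apply: IH => //; exact: gd.
Qed.

Section stopping_rule.
Context {J : finType} (A : R) (X : J -> T -> R) (S : T).
Hypothesis A_gt0 : 0 < A.
Hypothesis X_ge0 : forall j Q, 0 <= X j Q.
Hypothesis aX : forall j, tree_additive ch (X j).

Definition stops Q := [exists j, A * X j S * v Q < X j Q * v S].

Lemma stopsN Q j : ~~ stops Q -> X j Q <= A * X j S / v S * v Q.
Proof.
move/existsPn => /(_ j); rewrite -leNgt => H.
by rewrite mulrAC ler_pdivlMr.
Qed.

Lemma additive_ch_le (Y : T -> R) Q i : (forall Q, 0 <= Y Q) -> tree_additive ch Y ->
  Y (ch Q i) <= Y Q.
Proof.
by move=> Y0 aY; rewrite [leRHS]aY (bigD1 i)//= lerDl sumr_ge0.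
Qed.

(** A stopping node occupies less than v S / (A * X j S) times its share of some
    X j, and the shares of each X j add up to at most X j S. *)
Lemma stop_sum_volume k :
  stop_sum ch stops (fun=> v) k S <= #|J|%:R / A * v S.
Proof.
suff H : forall Q, (forall j, X j Q <= X j S) ->
    stop_sum ch stops (fun=> v) k Q <= \sum_j v S / (A * X j S) * X j Q.
  apply: le_trans (H S _) _ => //.
  rewrite mulrAC -mulrA mulr_natl -sumr_const; apply: ler_sum => j _.
  have [->|X0] := eqVneq (X j S) 0; last by rewrite invfM mulrA divfK.
  by rewrite mulr0 divr_ge0// ltW.
elim: k => [|k IH] Q XQ /=.
  apply: sumr_ge0 => j _; rewrite mulr_ge0// divr_ge0//; first exact: ltW.
  by rewrite mulr_ge0// ltW.
under [leRHS]eq_bigr do rewrite [X in _ * X]aX mulr_sumr.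
rewrite exchange_big/=; apply: ler_sum => i _.
have XiQ j : X j (ch Q i) <= X j S.
  by apply: le_trans (XQ j); exact: additive_ch_le.
case: ifPn => [/existsP[j Hj]|_]; last exact: IH.
have Xj0 : 0 < X j S.
  rewrite lt_neqAle X_ge0 andbT eq_sym; apply/eqP => XjS.
  have := XiQ j; rewrite XjS => H; move: Hj.
  rewrite XjS mulr0 mul0r => Hj; have := lt_le_trans Hj _.
  move/(_ 0); rewrite ltxx => H0; suff: false by [].
  by apply: H0; rewrite mulr_le0_ge0// ltW.
rewrite (bigD1 j)//= -[leLHS]addr0 lerD//.
  rewrite mulrAC ler_pdivlMr ?mulr_gt0// mulrC [leRHS]mulrC; exact: ltW.
apply: sumr_ge0 => j' _; rewrite mulr_ge0// divr_ge0//; first exact: ltW.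
by rewrite mulr_ge0// ltW.
Qed.

End stopping_rule.

Hypothesis I_gt0 : (0 < #|I|)%N.

Let m_gt0' : 0 < m. Proof. by rewrite ltr0n. Qed.

Lemma additive_volume : tree_additive ch v.
Proof.
move=> Q; under eq_bigr do rewrite v_ch.
rewrite sumr_const -[RHS]mulr_natr -/m divfK//.
by rewrite gt_eqF.
Qed.

(** Here F / v is at most A * F S / v S, and Cauchy-Schwarz bounds the sum of
    the products of oscillations by the energies of b - <b>_S and of g.
    Subtracting the mean <b>_S leaves the energies of b unchanged and makes
    beta S, the integral of |b - <b>_S|, appear in corona_energy. *)
Lemma corona_form (bad : pred T) (A : R) F G g b beta k S : 1 <= A ->
  tree_additive ch G -> tree_additive ch beta -> tree_additive ch g -> tree_additive ch b ->
  (forall Q, 0 <= F Q) -> (forall Q, `|g Q| <= G Q) ->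
  (forall Q, `|b Q - b S / v S * v Q| <= beta Q) ->
  (forall Q, ~~ bad Q -> F Q <= A * F S / v S * v Q) ->
  (forall Q, ~~ bad Q -> G Q <= A * G S / v S * v Q) ->
  (forall Q, ~~ bad Q -> beta Q <= A * beta S / v S * v Q) ->
  corona_sum ch bad (fun Q => oscillation b Q * oscillation g Q * F Q / v Q ^+ 2)
    k S <= 2 * A ^+ 2 * m * (F S * G S * beta S / v S ^+ 2).
Proof.
move=> A1 aG abeta ag ab F0 gG bbeta badF badG badB.
have A0 : 0 <= A by exact: le_trans A1.
have G0 Q : 0 <= G Q by exact: le_trans (gG Q).
have B0 Q : 0 <= beta Q by exact: le_trans (bbeta Q).
have v0 Q := ltW (v_gt0 Q).
have goodS X : 0 <= X S -> X S <= A * X S / v S * v S.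
  by move=> X0; rewrite divfK ?gt_eqF// ler_peMl.
pose b' Q := b Q - b S / v S * v Q.
have ab' : tree_additive ch b'.
  by move=> Q; rewrite /b' ab [v Q]additive_volume mulr_sumr -sumrB.
have energy_b' : energy b' = energy b.
  apply/funext => Q; rewrite /energy; congr (_ * _); apply: eq_bigr => i _.
  rewrite /b' v_ch; congr (_ ^+ 2).
  by field; rewrite !gt_eqF.
have Eb : corona_sum ch bad (energy b) k S <= m * A / v S * beta S ^+ 2.
  rewrite -energy_b'; apply: (@le_trans _ _ (m * (A * beta S / v S) * beta S)).
    apply: le_trans (corona_energy _ ab' abeta bbeta badB (goodS _ _) _) _ => //.
      by rewrite divr_ge0// mulr_ge0.
    by rewrite lerBlDr lerDl divr_ge0// sqr_ge0.
  by rewrite le_eqVlt; apply/orP; left; apply/eqP; field; rewrite gt_eqF.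
have Eg : corona_sum ch bad (energy g) k S <= m * A / v S * G S ^+ 2.
  apply: (@le_trans _ _ (m * (A * G S / v S) * G S)).
    apply: le_trans (corona_energy _ ag aG gG badG (goodS _ _) _) _ => //.
      by rewrite divr_ge0// mulr_ge0.
    by rewrite lerBlDr lerDl divr_ge0// sqr_ge0.
  by rewrite le_eqVlt; apply/orP; left; apply/eqP; field; rewrite gt_eqF.
set alpha := A * F S / v S in badF *.
have al0 : 0 <= alpha by rewrite divr_ge0// mulr_ge0.
have -> : 2 * A ^+ 2 * m * (F S * G S * beta S / v S ^+ 2) =
    2 * (alpha * (m * A / v S)) * (beta S * G S).
  by rewrite /alpha; field; rewrite gt_eqF.
have FS : F S <= alpha * v S := goodS _ (F0 S).
move: alpha badF al0 FS => alpha badF al0 FS.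
(* Cauchy-Schwarz, as a family of arithmetic means with a free parameter t *)
apply: le_scaled_geom_mean => //.
  by rewrite mulr_ge0// divr_ge0// mulr_ge0// ltW.
move=> t t0.
apply: (@le_trans _ _ (corona_sum ch bad
    (fun Q => (alpha * t) * energy b Q + (alpha * t^-1) * energy g Q) k S)).
  apply: (@corona_sum_le _ _ _ _ _ (fun Q => F Q <= alpha * v Q)).
  - move=> Q FQ; rewrite -!mulrA -mulrDr.
    have ob := oscillation_ge0 b Q; have og := oscillation_ge0 g Q.
    have -> : oscillation b Q * (oscillation g Q * (F Q / v Q ^+ 2)) =
        F Q / v Q * (oscillation b Q * oscillation g Q / v Q).
      by field; rewrite gt_eqF.
    apply: ler_pM.
    + by rewrite divr_ge0.
    + by rewrite divr_ge0// mulr_ge0.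
    + by rewrite ler_pdivrMr.
    move: (energy b Q) (energy g Q) (sqr_oscillation b Q) (sqr_oscillation g Q).
    move=> eb eg heb heg.
    rewrite ler_pdivrMr// mulrDl -!mulrA (mulrC eb) (mulrC eg).
    apply: (@le_trans _ _ (t * oscillation b Q ^+ 2 + t^-1 * oscillation g Q ^+ 2)).
      have t1 : 0 <= t * (oscillation b Q - t^-1 * oscillation g Q) ^+ 2.
        by rewrite mulr_ge0 ?sqr_ge0// ltW.
      have t2 : t * (oscillation b Q - t^-1 * oscillation g Q) ^+ 2 =
          t * oscillation b Q ^+ 2 + t^-1 * oscillation g Q ^+ 2 -
          2 * (oscillation b Q * oscillation g Q).
        by field; rewrite gt_eqF.
      have : 0 <= oscillation b Q * oscillation g Q by rewrite mulr_ge0.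
      by lra.
    by apply: lerD; rewrite ler_pM2l ?invr_gt0.
  - by move=> Q /badF.
  - exact: FS.
rewrite corona_sum_lin.
apply: (@le_trans _ _ (alpha * t * (m * A / v S * beta S ^+ 2) +
                       alpha * t^-1 * (m * A / v S * G S ^+ 2))).
  by apply: lerD; rewrite ler_wpM2l// mulr_ge0// ?invr_ge0 ltW.
by rewrite le_eqVlt; apply/orP; left; apply/eqP; field; rewrite !gt_eqF.
Qed.

(** * Carleson embedding *)

Section weighted.
Variables (r s : R).
Hypotheses (r_gt0 : 0 < r) (s_gt0 : 0 < s) (rs1 : r + s = 1).

(** With p = 1/r this is F^p / w^(p-1) = (F / w)^p w, the contribution of Q to
    the Carleson sum of a function with w-means F / w. *)
Definition carleson_term (F w : T -> R) Q := F Q `^ r^-1 * w Q `^ (- (s / r)).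

Lemma powR_prod (x y : R) : 0 <= x -> 0 <= y ->
  (x `^ r * y `^ s) `^ r^-1 = x * y `^ (s / r).
Proof.
by move=> x0 y0; rewrite powRM ?powR_ge0// powRVM ?gt_eqF// -powRrM.
Qed.

(** Carleson embedding by a Bellman function. Hoelder with w doubled on the
    stopping nodes, compensated by the factor 2^-(p-1) on the other side, bounds
    F(S)^p, p = 1/r, by the right-hand side times
    (w(leaves) + 2 w(stops))^(p-1) / 2^(p-1). The leaves carry the fraction
    kappa of w(S) and are not doubled, so that this factor is at most
    ((1 - kappa/2) w(S))^(p-1), and Bernoulli's inequality turns the power of
    1 - kappa/2 into the gain. *)
Lemma carleson_gain (bad : pred T) (F w Phi : T -> R) (kappa : R) k S :
  tree_additive ch F -> tree_additive ch w -> (forall Q, 0 < w Q) ->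
  (forall Q, 0 <= F Q) -> (forall Q, 0 <= Phi Q) ->
  (forall Q, F Q <= Phi Q `^ r * w Q `^ s) ->
  0 <= kappa -> kappa * w S <= leaf_sum ch bad w k S ->
  (1 + s / r * (kappa / 2)) * carleson_term F w S <=
  2 `^ (s / r) * leaf_sum ch bad Phi k S +
  stop_sum ch bad (fun=> carleson_term F w) k S.
Proof.
move=> aF aw w0 F0 Phi0 FPhi k0 kw.
have w0' Q : 0 <= w Q := ltW (w0 Q).
have Y0 Q : 0 <= carleson_term F w Q by rewrite mulr_ge0// powR_ge0.
have sr0 : 0 <= s / r by rewrite divr_ge0// ltW.
have k1 : kappa <= 1.
  have : leaf_sum ch bad w k S <= w S.
    by rewrite [leRHS](additive_split bad k S aw) lerDl stop_sum_ge0.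
  by move=> /(le_trans kw); rewrite ger_pMl.
(* w is doubled on the stopping nodes and Phi replaced by 2^-(p-1) F^p / w^(p-1) *)
have H := @stopping_hoelder _ _ _ ch bad r s F Phi w
  (fun Q => 2 `^ (- (s / r)) * carleson_term F w Q) (fun Q => 2 * w Q) k S
  r_gt0 s_gt0 rs1 aF Phi0 w0'.
have {}H := H _ _ FPhi _.
have {H} : F S `^ r^-1 <= ((leaf_sum ch bad Phi k S + stop_sum ch bad
    (fun=> fun Q => 2 `^ (- (s / r)) * carleson_term F w Q) k S) `^ r *
   (leaf_sum ch bad w k S + stop_sum ch bad (fun=> fun Q => 2 * w Q) k S) `^ s)
     `^ r^-1.
  apply: le_powR2 => //; first by rewrite invr_ge0 ltW.
  apply: H => [Q|Q|Q _].
  - by rewrite mulr_ge0 ?powR_ge0.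
  - by rewrite mulr_ge0.
  - rewrite !powRM ?powR_ge0 ?mulr_ge0 ?powR_ge0// -!powRrM.
    rewrite mulVf ?gt_eqF// powRr1// !mulNr divfK ?gt_eqF//.
    rewrite mulrACA [2 `^ _ * _]mulrC !powRN.
    rewrite le_eqVlt; apply/orP; left; apply/eqP.
    by field; rewrite !gt_eqF// powR_gt0.
rewrite powR_prod; last 2 first.
- by rewrite addr_ge0 ?leaf_sum_ge0 ?stop_sum_ge0// => ? ?; rewrite mulr_ge0 ?powR_ge0.
- by rewrite addr_ge0 ?leaf_sum_ge0 ?stop_sum_ge0// => ? ?; rewrite mulr_ge0.
have lin c (X : T -> R) : stop_sum ch bad (fun=> fun Q => c * X Q) k S =
    c * stop_sum ch bad (fun=> X) k S.
  have := stop_sum_lin ch bad c 0 (fun=> X) (fun=> X) k S.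
  rewrite mul0r addr0 => <-; congr (stop_sum _ _ _ _ _).
  by apply/funext => j; apply/funext => Q; rewrite mul0r addr0.
rewrite !lin.
have E : leaf_sum ch bad w k S + 2 * stop_sum ch bad (fun=> w) k S <=
    (1 - kappa / 2) * (2 * w S).
  have := additive_split bad k S aw; lra.
set st := stop_sum ch bad (fun=> carleson_term F w) k S.
set lf := leaf_sum ch bad Phi k S.
have st0 : 0 <= st by apply: stop_sum_ge0.
have lf0 : 0 <= lf by apply: leaf_sum_ge0.
move=> H.
have k2 : 0 < 1 - kappa / 2 by lra.
have {H E} : F S `^ r^-1 <= (lf + 2 `^ (- (s / r)) * st) *
    ((1 - kappa / 2) `^ (s / r) * (2 `^ (s / r) * w S `^ (s / r))).
  apply: le_trans H _; rewrite ler_wpM2l//.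
    by rewrite addr_ge0// mulr_ge0// powR_ge0.
  rewrite -(powRM _ _ (w0' S))// -powRM ?mulr_ge0//; last exact: ltW.
  apply: le_powR2 => //.
  by rewrite addr_ge0 ?leaf_sum_ge0// mulr_ge0 ?stop_sum_ge0.
have Bn := @bernoulli_powR R (kappa / 2) (s / r) _ sr0.
have {}Bn : 1 + s / r * (kappa / 2) <= (1 - kappa / 2) `^ (- (s / r)).
  by apply: Bn; lra.
move=> H; apply: (@le_trans _ _ ((1 - kappa / 2) `^ (- (s / r)) * carleson_term F w S)).
  by rewrite ler_wpM2r.
rewrite /carleson_term !powRN in H *.
have wp := powR_gt0 (s / r) (w0 S).
have kp := powR_gt0 (s / r) k2.
have tp := @powR_gt0 R 2 (s / r) ltac:(lra).
rewrite mulrCA [X in _ * X]mulrC -invfM ler_pdivrMr ?mulr_gt0//.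
apply: le_trans H _; rewrite le_eqVlt; apply/orP; left; apply/eqP.
by field; rewrite gt_eqF.
Qed.

(** The leaves fill at least half of S, so by Hoelder
    v(S)/2 <= u(S)^r w(leaves)^s, while u(S)^r w(S)^s <= N v(S) by the A_p
    condition. *)
Lemma leaf_sum_weight (bad : pred T) (u w : T -> R) (N : R) k S :
  tree_additive ch w -> tree_additive ch u -> (forall Q, 0 < u Q) -> (forall Q, 0 < w Q) ->
  (forall Q, v Q <= u Q `^ r * w Q `^ s) ->
  (forall Q, u Q `^ r * w Q `^ s <= N * v Q) ->
  v S / 2 <= leaf_sum ch bad v k S ->
  (2 * N) `^ (- s^-1) * w S <= leaf_sum ch bad w k S.
Proof.
move=> aw au u0 w0 vuw uwN vS.
have u0' Q : 0 <= u Q := ltW (u0 Q).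
have w0' Q : 0 <= w Q := ltW (w0 Q).
have N0 : 0 < N.
  have := lt_le_trans (v_gt0 S) (le_trans (vuw S) (uwN S)).
  by rewrite pmulr_lgt0.
have L0 : 0 <= leaf_sum ch bad w k S by rewrite leaf_sum_ge0.
have vL : v S / 2 <= u S `^ r * leaf_sum ch bad w k S `^ s.
  apply: le_trans vS _.
  apply: le_trans (leaf_sum_hoelder ch bad k S r_gt0 s_gt0 rs1 u0' w0' vuw) _.
  rewrite ler_wpM2r ?powR_ge0//; apply: le_powR2; first exact: ltW.
    by rewrite leaf_sum_ge0.
  by rewrite [leRHS](additive_split bad k S au) lerDl stop_sum_ge0.
have : w S `^ s <= 2 * N * leaf_sum ch bad w k S `^ s.
  have uS := powR_gt0 r (u0 S).
  rewrite -(ler_pM2l uS); apply: le_trans (uwN S) _.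
  rewrite mulrCA -mulrA [leRHS]mulrCA ler_pM2l//.
  by have := vL; lra.
move=> /(@le_powR2 _ s^-1) H.
have {H} : w S <= (2 * N * leaf_sum ch bad w k S `^ s) `^ s^-1.
  by rewrite -{1}(@powRVM _ s (w S)) ?gt_eqF// H ?invr_ge0 ?powR_ge0 ?ltW.
rewrite powRM ?powR_ge0 ?mulr_ge0//; last exact: ltW.
rewrite powRVM ?gt_eqF// powRN => H.
by rewrite ler_pdivrMl ?powR_gt0 ?mulr_gt0.
Qed.

End weighted.

(** * The two-weight estimate on a tree *)

Section two_weights.
Variables (r s : R).
Hypotheses (r_gt0 : 0 < r) (s_gt0 : 0 < s) (rs1 : r + s = 1).
Variables (mu sigma lam dlam nu Phi Gam : T -> R) (Nm Nl B : R).
Hypotheses (amu : tree_additive ch mu) (asigma : tree_additive ch sigma).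
Hypotheses (alam : tree_additive ch lam) (adlam : tree_additive ch dlam).
Hypotheses (mu_gt0 : forall Q, 0 < mu Q) (sigma_gt0 : forall Q, 0 < sigma Q).
Hypotheses (lam_gt0 : forall Q, 0 < lam Q) (dlam_gt0 : forall Q, 0 < dlam Q).
Hypotheses (vmu : forall Q, v Q <= mu Q `^ r * sigma Q `^ s)
           (muv : forall Q, mu Q `^ r * sigma Q `^ s <= Nm * v Q).
Hypotheses (vlam : forall Q, v Q <= dlam Q `^ s * lam Q `^ r)
           (lamv : forall Q, dlam Q `^ s * lam Q `^ r <= Nl * v Q).
Hypothesis nu_le : forall Q, nu Q <= mu Q `^ r * dlam Q `^ s.
Hypotheses (aPhi : tree_additive ch Phi) (aGam : tree_additive ch Gam).
Hypotheses (Phi_ge0 : forall Q, 0 <= Phi Q) (Gam_ge0 : forall Q, 0 <= Gam Q).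
Variables (f F g G b : T -> R) (beta : T -> T -> R).
Hypotheses (af : tree_additive ch f) (aF : tree_additive ch F).
Hypotheses (ag : tree_additive ch g) (aG : tree_additive ch G) (ab : tree_additive ch b).
Hypotheses (fF : forall Q, `|f Q| <= F Q) (gG : forall Q, `|g Q| <= G Q).
Hypothesis abeta : forall S, tree_additive ch (beta S).
Hypothesis bbeta : forall S Q, `|b Q - b S / v S * v Q| <= beta S Q.
Hypotheses (B_ge0 : 0 <= B) (betaB : forall S, beta S S <= B * nu S).
Hypothesis FPhi : forall Q, F Q <= Phi Q `^ r * sigma Q `^ s.
Hypothesis GGam : forall Q, G Q <= Gam Q `^ s * lam Q `^ r.

(** The form that dominates all three paraproducts, paired with g. *)
Definition bloom_form Q :=
  oscillation b Q * (oscillation f Q * G Q + oscillation g Q * F Q) / v Q ^+ 2.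

(** The fraction of the weight that leaf_sum_weight finds on the leaves. *)
Definition kappa_const (N e : R) := (2 * N) `^ (- e^-1).

Let F_ge0 Q : 0 <= F Q. Proof. exact: le_trans (fF Q). Qed.
Let G_ge0 Q : 0 <= G Q. Proof. exact: le_trans (gG Q). Qed.
Let beta_ge0 S Q : 0 <= beta S Q. Proof. exact: le_trans (bbeta S Q). Qed.
Let sr1 : s + r = 1. Proof. by rewrite addrC. Qed.
Let Nm_gt0 (Q : T) : 0 < Nm.
Proof.
have := lt_le_trans (v_gt0 Q) (le_trans (vmu Q) (muv Q)).
by rewrite pmulr_lgt0.
Qed.
Let Nl_gt0 (Q : T) : 0 < Nl.
Proof.
have := lt_le_trans (v_gt0 Q) (le_trans (vlam Q) (lamv Q)).
by rewrite pmulr_lgt0.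
Qed.

Lemma carleson_termK (r' s' : R) (X w : T -> R) Q : 0 < r' -> 0 < w Q ->
  0 <= X Q -> X Q = carleson_term r' s' X w Q `^ r' * w Q `^ s'.
Proof.
move=> r'0 w0 X0; rewrite powRM ?powR_ge0// -!powRrM mulVf ?gt_eqF// powRr1//.
by rewrite mulNr divfK ?gt_eqF// powRN mulfVK// gt_eqF// powR_gt0.
Qed.

(** F is Y^r sigma^s and G is Z^s lam^r, where Y and Z are the two Carleson
    terms, and nu is at most mu^r dlam^s: the weights combine into the two
    A_p products, and Young's inequality separates Y and Z. *)
Lemma testing_le tau S : 0 < tau ->
  F S * G S * beta S S / v S ^+ 2 <= B * Nm * Nl *
  (tau * carleson_term r s F sigma S +
   tau `^ (- (r / s)) * carleson_term s r G lam S).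
Proof.
move=> tau0.
have Y0 := mulr_ge0 (powR_ge0 (F S) r^-1) (powR_ge0 (sigma S) (- (s / r))).
have Z0 := mulr_ge0 (powR_ge0 (G S) s^-1) (powR_ge0 (lam S) (- (r / s))).
have Fe := carleson_termK s r_gt0 (sigma_gt0 S) (F_ge0 S).
have Ge := carleson_termK r s_gt0 (lam_gt0 S) (G_ge0 S).
have Nm0 := Nm_gt0 S; have Nl0 := Nl_gt0 S; have vS := v_gt0 S.
have := young_scaled r_gt0 s_gt0 rs1 Y0 Z0 tau0.
rewrite -/(carleson_term r s F sigma S) -/(carleson_term s r G lam S).
set Y := carleson_term r s F sigma S in Fe *.
set Z := carleson_term s r G lam S in Ge *.
move=> YZ; apply: (@le_trans _ _ (B * Nm * Nl * (Y `^ r * Z `^ s))); last first.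
  by rewrite ler_wpM2l// !mulr_ge0// ltW.
rewrite ler_pdivrMr ?exprn_gt0//.
have H1 : beta S S <= B * (mu S `^ r * dlam S `^ s).
  by apply: le_trans (betaB S) _; rewrite ler_wpM2l.
apply: (@le_trans _ _ (F S * G S * (B * (mu S `^ r * dlam S `^ s)))).
  by rewrite ler_wpM2l// mulr_ge0.
rewrite Fe Ge.
have -> : Y `^ r * sigma S `^ s * (Z `^ s * lam S `^ r) *
    (B * (mu S `^ r * dlam S `^ s)) =
  B * (Y `^ r * Z `^ s) * ((mu S `^ r * sigma S `^ s) * (dlam S `^ s * lam S `^ r)).
  move: (Y `^ r) (sigma S `^ s) (Z `^ s) (lam S `^ r) (mu S `^ r) (dlam S `^ s).
  by move=> y1 y2 y3 y4 y5 y6; ring.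
have -> : B * Nm * Nl * (Y `^ r * Z `^ s) * v S ^+ 2 =
    B * (Y `^ r * Z `^ s) * (Nm * v S * (Nl * v S)).
  by move: (Y `^ r) (Z `^ s) => y1 y2; ring.
apply: ler_wpM2l; first by rewrite !mulr_ge0// powR_ge0.
by apply: ler_pM; rewrite // mulr_ge0// powR_ge0.
Qed.

(** The threshold six is twice the number of functions in the stopping rule, so
    that by stop_sum_volume half of the volume of S is left to the leaves. *)
Definition triple S (j : 'I_3) : T -> R := nth F [:: F; G; beta S] j.

Definition principal_stop S := stops 6 (triple S) S.

Let triple_ge0 S j Q : 0 <= triple S j Q.
Proof. by rewrite /triple; case: j => -[|[|[|//]]] h /=. Qed.

Let atriple S j : tree_additive ch (triple S j).
Proof. by rewrite /triple; case: j => -[|[|[|//]]] h /=. Qed.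

Lemma principal_leaves k S :
  v S / 2 <= leaf_sum ch (principal_stop S) v k S.
Proof.
have := @stop_sum_volume _ 6 (triple S) S _ (triple_ge0 S) (atriple S) k.
have H6 : (0 : R) < 6 by lra.
move=> /(_ H6); rewrite card_ord.
have := additive_split (principal_stop S) k S additive_volume.
by rewrite /principal_stop; lra.
Qed.

Lemma corona_bloom k S :
  corona_sum ch (principal_stop S) bloom_form k S <=
  144 * m * (F S * G S * beta S S / v S ^+ 2).
Proof.
have stF Q : ~~ principal_stop S Q -> F Q <= 6 * F S / v S * v Q.
  by move=> /(@stopsN _ 6 (triple S) S _ (@Ordinal 3 0 isT)).
have stG Q : ~~ principal_stop S Q -> G Q <= 6 * G S / v S * v Q.
  by move=> /(@stopsN _ 6 (triple S) S _ (@Ordinal 3 1 isT)).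
have stB Q : ~~ principal_stop S Q -> beta S Q <= 6 * beta S S / v S * v Q.
  by move=> /(@stopsN _ 6 (triple S) S _ (@Ordinal 3 2 isT)).
have A1 : (1 : R) <= 6 by lra.
have H1 := corona_form k A1 aG (abeta S) ag ab F_ge0 gG (bbeta S) stF stG stB.
have H2 := corona_form k A1 aF (abeta S) af ab G_ge0 fF (bbeta S) stG stF stB.
have -> : bloom_form = (fun Q =>
    1 * (oscillation b Q * oscillation f Q * G Q / v Q ^+ 2) +
    1 * (oscillation b Q * oscillation g Q * F Q / v Q ^+ 2)).
  by apply/funext => Q; rewrite /bloom_form; field; rewrite gt_eqF.
rewrite corona_sum_lin !mul1r.
apply: le_trans (lerD H2 H1) _.
by rewrite [G S * F S]mulrC le_eqVlt; apply/orP; left; apply/eqP; ring.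
Qed.

(** From S to its stopping nodes, the potential 2^(p-1) Phi - F^p / sigma^(p-1)
    and its analogue for g drop by a multiple of the Carleson terms of S, which
    by corona_bloom and testing_le dominate the corona of S. *)
Theorem treesum_bloom tau k S : 0 < tau ->
  treesum ch bloom_form k S <= 144 * m * (B * Nm * Nl) *
  (tau * (2 `^ (s / r) / (s / r * (kappa_const Nm s / 2))) * Phi S +
   tau `^ (- (r / s)) * (2 `^ (r / s) / (r / s * (kappa_const Nl r / 2))) * Gam S).
Proof.
move=> tau0.
set tau' := tau `^ _; have tau'0 : 0 < tau' by exact: powR_gt0.
set c1 := s / r * _; set c2 := r / s * _.
have c10 : 0 < c1.
  by rewrite mulr_gt0 ?divr_gt0// powR_gt0 ?mulr_gt0// Nm_gt0.
have c20 : 0 < c2.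
  by rewrite mulr_gt0 ?divr_gt0// powR_gt0 ?mulr_gt0// Nl_gt0.
set K0 := 144 * m * (B * Nm * Nl).
have K00 : 0 <= K0.
  by rewrite !mulr_ge0// ltW// ?Nm_gt0 ?Nl_gt0.
set e1 := 2 `^ (s / r); set e2 := 2 `^ (r / s).
pose Y := carleson_term r s F sigma; pose Z := carleson_term s r G lam.
have e11 : 1 <= e1 by rewrite -(powRr0 2) ler_powR ?divr_ge0 ?ltW//; lra.
have e21 : 1 <= e2 by rewrite -(powRr0 2) ler_powR ?divr_ge0 ?ltW//; lra.
pose W1 := K0 * (tau / c1); pose W2 := K0 * (tau' / c2).
have W10 : 0 <= W1 by rewrite mulr_ge0// divr_ge0// ltW.
have W20 : 0 <= W2 by rewrite mulr_ge0// divr_ge0// ltW.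
have Y0 Q : 0 <= Y Q by rewrite mulr_ge0 ?powR_ge0.
have Z0 Q : 0 <= Z Q by rewrite mulr_ge0 ?powR_ge0.
suff main j Q : treesum ch bloom_form j Q <=
    W1 * (e1 * Phi Q - Y Q) + W2 * (e2 * Gam Q - Z Q).
  apply: le_trans (main _ _) _.
  have H1 : W1 * (e1 * Phi S - Y S) <= W1 * (e1 * Phi S).
    by rewrite ler_wpM2l// gerBl.
  have H2 : W2 * (e2 * Gam S - Z S) <= W2 * (e2 * Gam S).
    by rewrite ler_wpM2l// gerBl.
  apply: le_trans (lerD H1 H2) _.
  rewrite /W1 /W2 le_eqVlt; apply/orP; left; apply/eqP; field.
  by rewrite !gt_eqF.
(* strong induction: a stopping node of Q may lie in any later generation *)
have [n] := ubnP j; elim: n j Q => // n IH j Q; rewrite ltnS => jn.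
rewrite (treesum_split _ (principal_stop Q)).
set bad := principal_stop Q.
have cor := corona_bloom j Q.
have test := testing_le Q tau0.
have LQ := principal_leaves j Q.
have gY := carleson_gain r_gt0 s_gt0 rs1 aF asigma sigma_gt0 F_ge0 Phi_ge0 FPhi
  (powR_ge0 _ _) (leaf_sum_weight r_gt0 s_gt0 rs1 asigma amu mu_gt0 sigma_gt0
    vmu muv LQ).
have gZ := carleson_gain s_gt0 r_gt0 sr1 aG alam lam_gt0 G_ge0 Gam_ge0 GGam
  (powR_ge0 _ _) (leaf_sum_weight s_gt0 r_gt0 sr1 alam adlam dlam_gt0 lam_gt0
    vlam lamv LQ).
rewrite -/(kappa_const _ _) -/c1 -/(Y Q) -/e1 -/bad in gY.
rewrite -/(kappa_const _ _) -/c2 -/(Z Q) -/e2 -/bad in gZ.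
have st : stop_sum ch bad (treesum ch bloom_form) j Q <=
   stop_sum ch bad (fun _ Q => W1 * (e1 * Phi Q + (-1) * Y Q)
      + W2 * (e2 * Gam Q + (-1) * Z Q)) j Q.
  apply: stop_sum_le => i Q' ij; rewrite !mulN1r.
  by apply: IH; exact: leq_trans jn.
rewrite (stop_sum_lin ch bad W1 W2 (fun _ Q => e1 * Phi Q + (-1) * Y Q)
  (fun _ Q => e2 * Gam Q + (-1) * Z Q)) in st.
rewrite (stop_sum_lin ch bad e1 (-1) (fun=> Phi) (fun=> Y)) in st.
rewrite (stop_sum_lin ch bad e2 (-1) (fun=> Gam) (fun=> Z)) in st.
have pP := additive_split bad j Q aPhi.
have pG := additive_split bad j Q aGam.
rewrite -/bad in cor.
(* the claim is linear in the sums, which become variables *)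
move: cor test st gY gZ pP pG.
rewrite -/(Y Q) -/(Z Q) -/Y -/Z -/tau'.
move: (corona_sum _ _ _ _ _) (stop_sum _ _ (treesum _ _) _ _).
move: (stop_sum _ _ (fun=> Y) _ _) (stop_sum _ _ (fun=> Z) _ _).
move: (stop_sum _ _ (fun=> Phi) _ _) (stop_sum _ _ (fun=> Gam) _ _).
move: (leaf_sum _ _ Phi _ _) (leaf_sum _ _ Gam _ _).
move=> lP lG sP sG sY sZ co sT H1 H2 H3 H4 H5 -> ->.
have H6 : co <= K0 * (tau * Y Q + tau' * Z Q).
  by apply: le_trans H1 _; rewrite /K0 -(mulrA (144 * m)) ler_wpM2l// mulr_ge0// ltW.
have H7 := ler_wpM2l W10 H4; have H8 := ler_wpM2l W20 H5.
have E1 : W1 * ((1 + c1) * Y Q) = W1 * Y Q + K0 * (tau * Y Q).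
  by rewrite /W1; field; rewrite gt_eqF.
have E2 : W2 * ((1 + c2) * Z Q) = W2 * Z Q + K0 * (tau' * Z Q).
  by rewrite /W2; field; rewrite gt_eqF.
rewrite E1 in H7; rewrite E2 in H8.
lra.
Qed.

End two_weights.
End corona.

(** * Cubes, their halves and Haar functions *)

Section cubes.
Context {R : realType} {n : nat}.
Local Notation cube := (Rn R n * int)%type.
Local Notation signature := {ffun 'I_n -> bool}.
Implicit Types (P Q : cube) (e s : signature) (x : Rn R n).

Lemma side_gt0 Q : 0 < side Q.
Proof. by rewrite exprz_gt0. Qed.

Lemma side_half Q : (2 : R) ^ (Q.2 - 1) = side Q / 2.
Proof. by rewrite expfzDr// expN1r. Qed.

Definition box (a : Rn R n) (l : R) : set (Rn R n) :=
  [set x | forall i, tnth a i <= tnth x i < tnth a i + l].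

Lemma measurable_box a l : measurable (box a l).
Proof.
have -> : box a l = \bigcap_(i in [set: 'I_n])
    ((fun x : Rn R n => tnth x i) @^-1` `[tnth a i, tnth a i + l[).
  apply/seteqP; split => x H i; first by move=> _ /=; rewrite in_itv/= H.
  by have := H i I; rewrite /= in_itv.
apply: fin_bigcap_measurable => // i _; rewrite -[X in measurable X]setTI.
by apply: measurable_tnth => //; exact: measurable_itv.
Qed.

Lemma measurable_cset Q : measurable (cset Q).
Proof. exact: measurable_box. Qed.

End cubes.

Lemma leb_box (R : realType) n (a : Rn R n) (l : R) : 0 < l ->
  @leb R n (box a l) = (l ^+ n)%:E.
Proof.
move=> l0; elim: n a => [|n IH] a.
  rewrite /= diracE mem_set// => i; by case: i.
case/tupleP: a => a0 a.
rewrite /= /pushforward.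
have -> : @rn_cons R n @^-1` box [tuple of a0 :: a] l =
    box a l `*` `[a0, a0 + l[.
  apply/seteqP; split => [[x x0] H|[x x0] [H1 H2] i] /=.
    split => /=; last by have := H ord0; rewrite !tnth0 in_itv.
    by move=> i; have := H (lift ord0 i); rewrite !tnthS.
  case: (unliftP ord0 i) => [j ->|->]; first by rewrite !tnthS; exact: H1.
  by rewrite !tnth0; move: H2 => /=; rewrite in_itv.
rewrite product_measure1E//; last exact: measurable_box.
transitivity (@leb R n (box a l) * @lebesgue_measure R `[a0 : R, (a0 + l)%R[%classic)%E.
  by [].
rewrite IH lebesgue_measure_itv/= lte_fin ltrDl l0.
by rewrite -EFinD -EFinM addrAC subrr add0r exprSr.
Qed.

Section halves.
Context {R : realType} {n : nat}.
Local Notation cube := (Rn R n * int)%type.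
Local Notation signature := {ffun 'I_n -> bool}.
Implicit Types (P Q : cube) (e s : signature) (x : Rn R n).

Lemma leb_cset Q : @leb R n (cset Q) = (side Q ^+ n)%:E.
Proof. exact: leb_box (side_gt0 Q). Qed.

Lemma volE Q : vol Q = side Q ^+ n.
Proof. by rewrite /vol leb_cset. Qed.

Lemma leb_cset_vol Q : @leb R n (cset Q) = (vol Q)%:E.
Proof. by rewrite volE leb_cset. Qed.

Lemma vol_gt0 Q : 0 < vol Q.
Proof. by rewrite volE exprn_gt0// side_gt0. Qed.

Definition child Q s : cube :=
  ([tuple tnth Q.1 i + (if s i then side Q / 2 else 0) | i < n], Q.2 - 1).

Definition half_of Q x : signature :=
  [ffun i => tnth Q.1 i + side Q / 2 <= tnth x i].

Lemma side_child Q s : side (child Q s) = side Q / 2.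
Proof. exact: side_half. Qed.

Lemma cset_child Q s x : cset (child Q s) x <-> cset Q x /\ half_of Q x = s.
Proof.
have l0 := side_gt0 Q; split=> [H|[H <-] i]; last first.
  rewrite side_child /= tnth_mktuple ffunE; move: (H i) => /andP[H1 H2].
  by case: (leP (tnth Q.1 i + side Q / 2) (tnth x i)) => H3; apply/andP; split; lra.
have {}H i := H i; rewrite side_child /= in H.
split=> [i|]; last apply/ffunP => i.
  move: (H i); rewrite tnth_mktuple; case: (s i) => /andP[H1 H2]; lra.
rewrite ffunE; move: (H i); rewrite tnth_mktuple; case: (s i) => /andP[H1 H2].
  by rewrite (le_trans _ H1)//; lra.
by apply/negbTE; rewrite -ltNge; lra.
Qed.

Lemma child_sub Q s : cset (child Q s) `<=` cset Q.
Proof. by move=> x /cset_child[]. Qed.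

Lemma card_signature : #|{: signature}| = (2 ^ n)%N.
Proof. by rewrite card_ffun card_bool card_ord. Qed.

Lemma vol_child Q s : vol (child Q s) = vol Q / #|{: signature}|%:R.
Proof. by rewrite !volE side_child expr_div_n card_signature natrX. Qed.

(** The sign of the Haar function of signature e on the half s of its cube. *)
Definition haar_sign e s : R := \prod_(i < n) (if e i then 1 else (-1) ^+ (~~ s i)).

Lemma norm_haar_sign e s : `|haar_sign e s| = 1.
Proof.
rewrite normr_prod big1// => i _; case: ifP => _; first by rewrite normr1.
by rewrite normrX normrN1 expr1n.
Qed.

Lemma sum_haar_sign e : cancellative e -> \sum_s haar_sign e s = 0.
Proof.
move=> ce; have [i /negbTE ei] : exists i, ~~ e i.
  apply/existsP; apply: contraR ce => /existsPn H.
  apply/eqP/ffunP => i.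
  by rewrite ffunE; apply/negbNE; have := H i; case: (e i).
rewrite -(bigA_distr_bigA (fun i (b : bool) => if e i then 1 else (-1) ^+ (~~ b))).
rewrite (bigD1 i)//= big_bool/= ei expr0 expr1 subrr mul0r//.
Qed.

Lemma half_sum Q (c : signature -> R) x : cset Q x ->
  \sum_s c s * \1_(cset (child Q s)) x = c (half_of Q x).
Proof.
move=> Qx; rewrite (bigD1 (half_of Q x))//= indicE mem_set ?mulr1; last first.
  by apply/cset_child.
rewrite big1 ?addr0// => s sx; rewrite indicE memNset ?mulr0//.
by move=> /cset_child[_ sx']; move: sx; rewrite sx' eqxx.
Qed.

Lemma half_sum0 Q (c : signature -> R) x : ~ cset Q x ->
  \sum_s c s * \1_(cset (child Q s)) x = 0.
Proof.
move=> Qx; rewrite big1// => s _; rewrite indicE memNset ?mulr0//.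
by move=> /child_sub.
Qed.

Lemma haarE Q e x : haar Q e x =
  (Num.sqrt (vol Q))^-1 * \sum_s haar_sign e s * \1_(cset (child Q s)) x.
Proof.
have l0 := side_gt0 Q.
have sq : Num.sqrt (vol Q) = Num.sqrt (side Q) ^+ n.
  rewrite volE; apply/eqP; rewrite -(@eqrXn2 _ 2)// ?exprn_ge0 ?sqrtr_ge0//.
  by rewrite sqr_sqrtr ?exprn_ge0 ?ltW// exprAC sqr_sqrtr// ltW.
have [Qx|Qx] := pselect (cset Q x).
  rewrite half_sum// sq -exprVn /haar /haar1 big_split/= prodr_const card_ord.
  congr (_ * _); apply: eq_bigr => i _; move: (Qx i) => /andP[Q1 Q2].
  rewrite !indicE; case: (e i); first by rewrite mem_set//= in_itv/= Q1 Q2.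
  rewrite ffunE; have [H|H] := leP (tnth Q.1 i + side Q / 2) (tnth x i).
    rewrite [_ \in _]mem_set/=; last by rewrite in_itv/= H Q2.
    by rewrite memNset/= ?subr0// in_itv/= ltNge H andbF.
  rewrite [_ \in _]memNset/=; last by rewrite in_itv/= leNgt H.
  by rewrite mem_set/= ?sub0r ?expr1// in_itv/= Q1 H.
rewrite half_sum0// mulr0.
have /existsNP[i Hi] : ~ (forall i, tnth Q.1 i <= tnth x i < tnth Q.1 i + side Q) by [].
rewrite /haar (bigD1 i)//= [X in X * _](_ : _ = 0) ?mul0r// /haar1 !indicE.
case: (e i); first by rewrite memNset ?mulr0//= in_itv/=.
rewrite !memNset ?subrr ?mulr0//= in_itv/= => /andP[H1 H2]; apply: Hi; lra.
Qed.

End halves.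

(** * Dyadic grids as trees *)

Section grid.
Context {R : realType} {n : nat}.
Local Notation cube := (Rn R n * int)%type.
Local Notation signature := {ffun 'I_n -> bool}.
Hypothesis n_gt0 : (0 < n)%N.
Variable D : set cube.
Hypothesis gD : dyadic_grid D.
Implicit Types (P Q : cube) (e s : signature) (x : Rn R n).

Lemma corner_in Q : cset Q Q.1.
Proof. by move=> i; rewrite lexx ltrDl side_gt0. Qed.

Lemma grid_cover (k : int) x : exists Q, [/\ D Q, Q.2 = k & cset Q x].
Proof.
have [/(_ k)[cov _ _] _] := gD.
by have : [set: Rn R n] x by []; rewrite -cov => -[Q [DQ Qk] Qx]; exists Q.
Qed.

Lemma grid_eq P Q x : D P -> D Q -> P.2 = Q.2 -> cset P x -> cset Q x -> P = Q.
Proof.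
move=> DP DQ PQ Px Qx; have [/(_ Q.2)[_ tr _] _] := gD.
by apply: tr => //; exists x.
Qed.

(** Moving one coordinate reduces questions on cubes to questions on intervals. *)
Definition set_coord x (i : 'I_n) (t : R) : Rn R n :=
  [tuple if j == i then t else tnth x j | j < n].

Lemma tnth_set_coord x i t j :
  tnth (set_coord x i t) j = if j == i then t else tnth x j.
Proof. by rewrite tnth_mktuple. Qed.

Lemma cset_set_coord Q x i t : cset Q x ->
  tnth Q.1 i <= t < tnth Q.1 i + side Q -> cset Q (set_coord x i t).
Proof.
by move=> Qx tQ j; rewrite tnth_set_coord; case: eqP => // ->.
Qed.

Lemma cset_subP P Q i : cset P `<=` cset Q ->
  tnth Q.1 i <= tnth P.1 i /\ tnth P.1 i + side P <= tnth Q.1 i + side Q.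
Proof.
move=> PQ; have Pc := PQ _ (corner_in P).
have /andP[H1 H2] := Pc i; split => //.
have lP := side_gt0 P.
rewrite leNgt; apply/negP => H3.
have /PQ/(_ i) : cset P (set_coord P.1 i (tnth Q.1 i + side Q)).
  by apply: cset_set_coord; [exact: corner_in|lra].
by rewrite tnth_set_coord eqxx ltxx andbF.
Qed.

Let i0 : 'I_n := Ordinal n_gt0.

Lemma cset_sub_side P Q : cset P `<=` cset Q -> side P <= side Q.
Proof. by move=> /(@cset_subP _ _ i0)[H1 H2]; lra. Qed.

Lemma side_lt P Q : (P.2 < Q.2) = (side P < side Q).
Proof. by rewrite /side ltr_eXz2l// ltr1n. Qed.

Lemma side_le P Q : (P.2 <= Q.2) = (side P <= side Q).
Proof. by rewrite /side ler_eXz2l// ltr1n. Qed.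

Lemma grid_sub P Q x : D P -> D Q -> P.2 <= Q.2 -> cset P x -> cset Q x ->
  cset P `<=` cset Q.
Proof.
move=> DP DQ; rewrite le_eqVlt => /orP[/eqP PQ Px Qx|PQ Px Qx].
  by rewrite (grid_eq DP DQ PQ Px Qx).
have [_ /(_ P Q DP DQ)[]] := gD.
- by move=> <-; exact: subIsetr.
- move=> H; have : cset Q `<=` cset P by rewrite -H; exact: subIsetl.
  by move=> /cset_sub_side; rewrite leNgt -side_lt PQ.
- by move=> H; have : (cset P `&` cset Q) x by []; rewrite H.
Qed.

(** The grid cube P of half the side that contains the corner of the half s lies
    in Q. If it were not aligned with Q in direction i, then on a line in this
    direction it would overlap the grid cube of the same size that covers the
    lower end of Q, and be equal to it. *)
Lemma grid_child Q s : D Q -> D (child Q s).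
Proof.
move=> DQ; set c := (child Q s).1.
have cc : cset (child Q s) c := corner_in _.
have cQ : cset Q c := child_sub cc.
have [P [DP P2 Pc]] := grid_cover (Q.2 - 1) c.
have sP : side P = side Q / 2 by rewrite /side P2 side_half.
have lQ := side_gt0 Q.
have PleQ : P.2 <= Q.2 by rewrite P2 lerBlDr lerDl.
have PQ : cset P `<=` cset Q := grid_sub DP DQ PleQ Pc cQ.
suff E : P = child Q s by rewrite -E.
case: P P2 @c cc cQ Pc sP PleQ PQ DP => P1 P2 /= -> cc cQ Pc sP PleQ PQ DP.
congr pair; apply: eq_from_tnth => i.
have [H1 H2] := cset_subP i PQ; have := Pc i.
rewrite /= sP tnth_mktuple in H1 H2 *; move=> /andP[H3 H4].
case si: (s i) H3 H4; last first.
  by move=> H3 H4; apply/eqP; rewrite eq_le; apply/andP; split; lra.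
move=> H3 H4; apply/eqP; rewrite eq_le; apply/andP; split; first lra.
rewrite leNgt; apply/negP => H5.
(* y lies at the lower end of Q on the line through c in direction i *)
set y := set_coord (child Q s).1 i (tnth Q.1 i).
have yQ : cset Q y by apply: cset_set_coord => //; lra.
have [P' [DP' P'2 P'y]] := grid_cover (Q.2 - 1) y.
have sP' : side P' = side Q / 2 by rewrite /side P'2 side_half.
have P'leQ : P'.2 <= Q.2 by rewrite P'2 lerBlDr lerDl.
have P'Q : cset P' `<=` cset Q := grid_sub DP' DQ P'leQ P'y yQ.
have [H1' H2'] := cset_subP i P'Q.
have := P'y i; rewrite tnth_set_coord eqxx => /andP[H3' H4'].
(* z is a point of this line that P and P' have in common *)
set z := set_coord (child Q s).1 i (tnth P1 i).
have zP : cset (P1, Q.2 - 1) z by apply: cset_set_coord => //=; rewrite sP; lra.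
have zP' : cset P' z.
  have -> : z = set_coord y i (tnth P1 i).
    by apply: eq_from_tnth => j; rewrite !tnth_set_coord; case: ifP.
  by apply: cset_set_coord => //; rewrite sP'; lra.
have := grid_eq DP DP' (esym P'2) zP zP'.
move=> E; move: H3' H4'; rewrite -E/=; lra.
Qed.

Lemma grid_sub_child P Q x : D P -> D Q -> P.2 < Q.2 -> cset P x -> cset Q x ->
  cset P `<=` cset (child Q (half_of Q x)).
Proof.
move=> DP DQ PQ Px Qx.
apply: (@grid_sub _ _ x) => //; first exact: grid_child.
  by rewrite /= lerBrDr -ltzD1 ltrD2r.
exact/cset_child.
Qed.

Lemma sum_le_treesum (phi : cube -> R) k Q (F : seq cube) :
  (forall P, 0 <= phi P) -> uniq F -> D Q ->
  (forall P, P \in F -> [/\ D P, cset P `<=` cset Q & Q.2 < P.2 + k%:Z]) ->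
  \sum_(P <- F) phi P <= treesum child phi k Q.
Proof.
move=> phi0; elim: k Q F => [|k IH] Q F uF DQ HF /=.
  rewrite big_seq big_pred0// => P; apply/negbTE/negP => /HF[DP PQ].
  by rewrite addr0 side_lt ltNge cset_sub_side.
apply: (@le_trans _ _ (\sum_(P <- F | P == Q) phi P +
   \sum_(s : signature) \sum_(P <- F | `[< P != Q /\ cset P `<=` cset (child Q s) >]) phi P)).
  rewrite (bigID (fun P => P == Q))/= lerD2l.
  under [leRHS]eq_bigr do rewrite big_mkcond.
  rewrite exchange_big/= big_mkcond/= big_seq [leRHS]big_seq.
  apply: ler_sum => P /HF[DP PQ _]; case: ifPn => [PnQ|_]; last first.
    by apply: sumr_ge0 => s _; case: ifP.
  have Pc := corner_in P; have Qc := PQ _ Pc.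
  have PltQ : P.2 < Q.2.
    rewrite lt_neqAle side_le cset_sub_side// andbT; apply: contra PnQ => /eqP E.
    by rewrite (grid_eq DP DQ E Pc Qc).
  rewrite (bigD1 (half_of Q P.1))//= asboolT; last first.
    by split; [exact/eqP|exact: grid_sub_child].
  by rewrite lerDl; apply: sumr_ge0 => s _; case: ifP.
apply: lerD.
  have [QF|QF] := boolP (Q \in F).
    rewrite -big_filter filter_pred1_uniq//.
    by rewrite big_seq1.
  rewrite big_seq_cond big_pred0// => P; apply/negP => /andP[PF /eqP PQ].
  by move: QF; rewrite -PQ PF.
apply: ler_sum => s _; rewrite -big_filter; apply: IH.
- exact: filter_uniq.
- exact: grid_child.
- move=> P; rewrite mem_filter => /andP[/asboolP[PnQ Pc] /HF[DP PQ Qk]].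
  by split => //=; lia.
Qed.

(** All cubes of F are contained in grid cubes of one large side length 2^K,
    which are disjoint, and lie at most 2 K generations below them. *)
Lemma grid_tops (F : seq cube) : uniq F -> (forall P, P \in F -> D P) ->
  exists (k : nat) (tops : seq cube), [/\ uniq tops,
    forall P, P \in tops -> D P, trivIset [set` tops] (@cset R n) &
    forall phi : cube -> R, (forall P, 0 <= phi P) ->
      \sum_(P <- F) phi P <= \sum_(Q <- tops) treesum child phi k Q].
Proof.
move=> uF DF.
have [K HK] : exists K : nat, forall P, P \in F -> (`|P.2| <= K)%N.
  exists (\max_(P <- F) `|P.2|)%N => P PF.
  by rewrite (big_rem _ PF)/= leq_maxl.
have /choice[anc Hanc] : forall P : cube, exists Q : cube,
   P \in F -> [/\ D Q, Q.2 = K%:Z & cset P `<=` cset Q].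
  move=> P; have [PF|_] := boolP (P \in F); last by exists P.
  have [Q [DQ QK Qc]] := grid_cover K%:Z P.1; exists Q => _; split => //.
  apply: grid_sub (corner_in P) Qc => //; first exact: DF.
  by rewrite QK; have := HK _ PF; lia.
exists (2 * K).+1, (undup (map anc F)); split.
- exact: undup_uniq.
- by move=> Q; rewrite mem_undup => /mapP[P PF ->]; have [] := Hanc _ PF.
- move=> Q1 Q2 /=; rewrite !mem_undup => /mapP[P1 PF1 ->] /mapP[P2 PF2 ->].
  have [D1 K1 _] := Hanc _ PF1; have [D2 K2 _] := Hanc _ PF2.
  by case=> x [x1 x2]; apply: grid_eq x1 x2 => //; rewrite K1.
move=> phi phi0.
apply: (@le_trans _ _ (\sum_(Q <- undup (map anc F)) \sum_(P <- F | anc P == Q) phi P)).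
  under [leRHS]eq_bigr do rewrite big_mkcond.
  rewrite exchange_big/= big_seq [leRHS]big_seq; apply: ler_sum => P PF.
  rewrite (bigD1_seq (anc P))//= ?eqxx ?undup_uniq ?mem_undup ?map_f//.
  by rewrite lerDl; apply: sumr_ge0 => s _; case: ifP.
rewrite big_seq [leRHS]big_seq; apply: ler_sum => Q.
rewrite mem_undup => /mapP[P0 PF0 ->]; rewrite -big_filter.
have [D0 K0 _] := Hanc _ PF0.
apply: sum_le_treesum => //; first exact: filter_uniq.
move=> P; rewrite mem_filter => /andP[/eqP PQ PF].
have [D1 K1 S1] := Hanc _ PF; split; [exact: DF|by rewrite -PQ|].
by rewrite K0; have := HK _ PF; lia.
Qed.

End grid.

(** * Integrals over cubes *)

Section integral_lemmas.
Context d (T : measurableType d) (R : realType) (m : {measure set T -> \bar R}).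
Implicit Types (A : set T) (X Y Z : T -> R).

Lemma measurable_powRf (f : T -> R) a : measurable_fun setT f ->
  measurable_fun setT (fun x => f x `^ a).
Proof. by move=> mf; exact: (measurableT_comp (measurable_powR a) mf). Qed.

Lemma measurable_normf (f : T -> R) : measurable_fun setT f ->
  measurable_fun setT (fun x => `|f x|).
Proof. by move=> mf; exact: measurableT_comp. Qed.

(** In this form Hoelder's inequality applies as it stands to the constant 1, to
    the Bloom weight, to functions of L^p(w) and to their norming functions. *)
Lemma geom_hoelder A X Y Z r s : measurable A ->
  measurable_fun setT X -> measurable_fun setT Y -> measurable_fun setT Z ->
  0 < r -> 0 < s -> r + s = 1 ->
  {ae m, forall x, `|X x| <= `|Y x| `^ r * `|Z x| `^ s} ->
  (\int[m]_(x in A) (`|X x|%:E) <=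
  (\int[m]_(x in A) (`|Y x|%:E)) `^ r * (\int[m]_(x in A) (`|Z x|%:E)) `^ s)%E.
Proof.
move=> mA mX mY mZ r0 s0 rs H.
pose f x := `|Y x| `^ r * \1_A x; pose g x := `|Z x| `^ s * \1_A x.
have mI : measurable_fun setT (\1_A : T -> R) by exact: measurable_indic.
have mf : measurable_fun setT f.
  by apply: measurable_funM => //; exact/measurable_powRf/measurable_normf.
have mg : measurable_fun setT g.
  by apply: measurable_funM => //; exact/measurable_powRf/measurable_normf.
have := @hoelder _ _ _ m f g r^-1 s^-1 mf mg.
rewrite !invr_gt0 !invrK => /(_ r0 s0 rs).
rewrite Lnorm1 unlock !invrK.
have E (W : T -> R) t : 0 < t -> (\int[m]_x (`|(EFin \o
    (fun x => (`|W x| `^ t * \1_A x)%R)) x| `^ t^-1)%E =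
    \int[m]_(x in A) `|W x|%:E)%E.
  move=> t0; rewrite [RHS]integral_mkcond; apply: eq_integral => x _ /=.
  rewrite patchE indicE normrM ger0_norm ?powR_ge0//.
  case: ifP => _ /=; last first.
    by rewrite normr0 mulr0 powR0// invr_eq0 gt_eqF.
  by rewrite normr1 mulr1 powRVM// gt_eqF.
rewrite [X in (_ <= X `^ _ * _)%E](E Y r r0).
rewrite [X in (_ <= _ * X `^ _)%E](E Z s s0); apply: le_trans.
rewrite integral_mkcond; apply: ae_ge0_le_integral => //.
- by move=> x _; rewrite patchE; case: ifP => // _; rewrite lee_fin.
- rewrite -(measurable_restrictT _ mA); apply: measurable_funTS.
  by apply/measurable_EFinP; exact: measurable_normf.
- apply: measurableT_comp => //; apply/measurable_EFinP.
  exact: measurable_funM.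
apply: filterS H => x H _; rewrite patchE /= /f /g !indicE.
case: ifP => _ /=; last by rewrite lee_fin.
by rewrite !mulr1 lee_fin [leRHS]ger0_norm// mulr_ge0// powR_ge0.
Qed.

End integral_lemmas.

Section cube_integrals.
Context {R : realType} {n : nat}.
Local Notation cube := (Rn R n * int)%type.
Local Notation signature := {ffun 'I_n -> bool}.
Local Notation L := (@leb R n).
Implicit Types (P Q : cube) (e s : signature) (f g : Rn R n -> R).

Definition integrable_on Q f := L.-integrable (cset Q) (EFin \o f).

Definition cint f Q : R := \int[L]_(x in cset Q) f x.

Let mc Q : measurable (cset Q) := measurable_cset Q.

Lemma integrable_on_sub P Q f : cset P `<=` cset Q -> integrable_on Q f ->
  integrable_on P f.
Proof. by move=> PQ; apply: integrableS. Qed.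

Lemma EFin_cint f Q : integrable_on Q f ->
  ((cint f Q)%:E = \int[L]_(x in cset Q) (f x)%:E)%E.
Proof. by move=> If; rewrite /cint /Rintegral fineK// integrable_fin_num. Qed.

Lemma cset_halves Q : cset Q = \big[setU/set0]_(s : signature) cset (child Q s).
Proof.
apply/seteqP; split => [x Qx|x].
  rewrite -bigcup_seq; exists (half_of Q x); first by rewrite /= mem_index_enum.
  exact/cset_child.
by rewrite -bigcup_seq => -[s _] /child_sub.
Qed.

Lemma cint_additive f Q : integrable_on Q f ->
  cint f Q = \sum_(s : signature) cint f (child Q s).
Proof.
move=> If; apply: EFin_inj; rewrite EFin_cint// -sumEFin.
under eq_bigr do rewrite (EFin_cint (integrable_on_sub (@child_sub _ _ _ _) If)).
rewrite [in LHS]cset_halves integral_bigsetU_EFin//.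
- exact: index_enum_uniq.
- by move=> s t _ _ [x [/cset_child[_ <-] /cset_child[_ <-]]].
- by rewrite -cset_halves; exact: measurable_int If.
Qed.

Lemma integrable_on_norm f Q : integrable_on Q f ->
  integrable_on Q (fun x => `|f x|).
Proof. exact: integrable_norm. Qed.

Lemma cint_ge0 f Q : (forall x, 0 <= f x) -> 0 <= cint f Q.
Proof. by move=> f0; apply: Rintegral_ge0. Qed.

Lemma norm_cint_le f Q : integrable_on Q f ->
  `|cint f Q| <= cint (fun x => `|f x|) Q.
Proof. by move=> If; apply: le_normr_Rintegral. Qed.

Lemma cint_norm_ae f Q : measurable_fun setT f ->
  {ae L, forall x, 0 <= f x} ->
  (\int[L]_(x in cset Q) (f x)%:E = \int[L]_(x in cset Q) `|f x|%:E)%E.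
Proof.
move=> mf f0; apply: ae_eq_integral => //.
- by apply: measurable_funTS; exact/measurable_EFinP.
- by apply: measurable_funTS; apply/measurable_EFinP; exact: measurable_normf.
by apply: filterS f0 => x f0 _; rewrite ger0_norm.
Qed.

Lemma integrable_onP f Q : measurable_fun setT f ->
  (\int[L]_(x in cset Q) `|f x|%:E < +oo)%E -> integrable_on Q f.
Proof.
move=> mf H; apply/integrableP; split => //.
by apply: measurable_funTS; exact/measurable_EFinP.
Qed.

(** Signs and the bound are assumed almost everywhere, because a weight may be
    negative on a null set. *)
Lemma cint_hoelder Q (X Y Z : Rn R n -> R) (r s : R) : measurable_fun setT X ->
  measurable_fun setT Y -> measurable_fun setT Z ->
  0 < r -> 0 < s -> r + s = 1 ->
  {ae L, forall x, 0 <= X x} -> {ae L, forall x, 0 <= Y x} ->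
  {ae L, forall x, 0 <= Z x} ->
  {ae L, forall x, X x <= Y x `^ r * Z x `^ s} ->
  integrable_on Q Y -> integrable_on Q Z ->
  integrable_on Q X /\ cint X Q <= cint Y Q `^ r * cint Z Q `^ s.
Proof.
move=> mX mY mZ r0 s0 rs X0 Y0 Z0 H IY IZ.
have H' : {ae L, forall x, `|X x| <= `|Y x| `^ r * `|Z x| `^ s}.
  apply: filterS2 H (filterI X0 (filterI Y0 Z0)) => x Hx [X0x [Y0x Z0x]].
  by rewrite !ger0_norm.
have := geom_hoelder (mc Q) mX mY mZ r0 s0 rs H'.
rewrite -!cint_norm_ae// -(EFin_cint IY) -(EFin_cint IZ) => Hi.
have IX : integrable_on Q X.
  apply: integrable_onP => //; rewrite -cint_norm_ae//.
  by apply: le_lt_trans Hi _; rewrite -EFinM ltry.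
split => //; rewrite -lee_fin EFin_cint//.
Qed.

Lemma cint_gt0 f Q : measurable_fun setT f -> {ae L, forall x, 0 < f x} ->
  integrable_on Q f -> 0 < cint f Q.
Proof.
move=> mf f0 If.
have f0' : {ae L, forall x, 0 <= f x} by apply: filterS f0 => x /ltW.
have E : ((cint f Q)%:E = \int[L]_(x in cset Q) `|(f x)%:E|)%E.
  by rewrite EFin_cint// cint_norm_ae.
rewrite lt_neqAle -!lee_fin E integral_ge0// andbT eq_sym; apply/eqP => c0.
have : (\int[L]_(x in cset Q) `|(f x)%:E| = 0)%E by rewrite -E c0.
move/(ae_eq_integral_abs L (mc Q) (measurable_int _ If)) => H.
have : L (cset Q) = 0%E.
  have N : {ae L, forall x, ~ cset Q x}.
    apply: filterS2 f0 H => x fx0 H Qx; have := H Qx => -[] fx.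
    by move: fx0; rewrite fx ltxx.
  apply/negligibleP => //; apply: negligibleS N => x Qx; exact.
by rewrite leb_cset_vol => -[] /eqP; rewrite gt_eqF// vol_gt0.
Qed.

Lemma avgE f Q : integrable_on Q f -> avg f Q = cint f Q / vol Q.
Proof.
move=> If; rewrite /avg /eavg -EFin_cint// leb_cset_vol.
by rewrite inver gt_eqF ?vol_gt0// -EFinM /= mulrC.
Qed.

Lemma cint_indic f Q : cint f Q = \int[L]_x (f x * \1_(cset Q) x).
Proof.
rewrite /cint Rintegral_mkcond; apply: eq_Rintegral => x _.
by rewrite patchE indicE; case: ifP => _; rewrite ?mulr1 ?mulr0.
Qed.

Lemma integrable_indicM f Q (c : R) : integrable_on Q f ->
  L.-integrable setT (EFin \o (fun x => f x * (c * \1_(cset Q) x))).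
Proof.
move=> If; have : L.-integrable setT ((EFin \o f) \_ (cset Q)).
  by apply/(integrable_mkcond _ (mc Q)).
move=> /(integrableZl measurableT c); apply: eq_integrable => // x _ /=.
rewrite patchE indicE; case: ifP => _; rewrite ?mulr1 ?mulr0 ?mule0// EFinM muleC.
by [].
Qed.

Lemma inner_haarE f Q e : integrable_on Q f ->
  inner f (haar Q e) =
  (Num.sqrt (vol Q))^-1 * \sum_s haar_sign e s * cint f (child Q s).
Proof.
move=> If.
have Is s : integrable_on (child Q s) f.
  by apply: integrable_on_sub If; exact: child_sub.
rewrite mulr_sumr /inner.
transitivity (\int[L]_x \sum_s
    (f x * ((Num.sqrt (vol Q))^-1 * haar_sign e s * \1_(cset (child Q s)) x))).
  apply: eq_Rintegral => x _; rewrite haarE !mulr_sumr.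
  by apply: eq_bigr => s _; ring.
rewrite /Rintegral; under eq_integral do rewrite -sumEFin.
rewrite integral_sum//=; last by move=> s; exact: integrable_indicM.
have E s c : (\int[L]_x (f x * (c * \1_(cset (child Q s)) x))%:E =
    (c * cint f (child Q s))%:E)%E.
  have := integrable_indicM 1 (Is s) => I1.
  have I1' : L.-integrable setT (EFin \o (fun x => f x * \1_(cset (child Q s)) x)).
    by apply: eq_integrable I1 => // x _ /=; rewrite mul1r.
  under eq_integral do rewrite mulrCA EFinM.
  by rewrite integralZl// cint_indic EFinM /Rintegral fineK// integrable_fin_num.
under eq_bigr do rewrite E.
by rewrite sumEFin /=; apply: eq_bigr => s _; rewrite mulrA.
Qed.

(** By cancellation the mean of f over Q can be subtracted from the integrals of
    f over the halves. *)
Lemma inner_haar_le f Q e : integrable_on Q f -> cancellative e ->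
  `|inner f (haar Q e)| <=
  (Num.sqrt (vol Q))^-1 * oscillation child (cint f) Q.
Proof.
move=> If ce; rewrite inner_haarE// normrM ger0_norm ?invr_ge0 ?sqrtr_ge0//.
rewrite ler_wpM2l ?invr_ge0 ?sqrtr_ge0//.
have -> : \sum_s haar_sign e s * cint f (child Q s) =
    \sum_s haar_sign e s * (cint f (child Q s) - cint f Q / #|{: signature}|%:R).
  under [RHS]eq_bigr do rewrite mulrBr.
  by rewrite sumrB -mulr_suml sum_haar_sign// mul0r subr0.
apply: le_trans (ler_norm_sum _ _ _) _; apply: ler_sum => s _.
by rewrite normrM norm_haar_sign mul1r.
Qed.

Lemma inner_haar_le_norm f Q e : integrable_on Q f ->
  `|inner f (haar Q e)| <=
  (Num.sqrt (vol Q))^-1 * cint (fun x => `|f x|) Q.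
Proof.
move=> If; rewrite inner_haarE// normrM ger0_norm ?invr_ge0 ?sqrtr_ge0//.
rewrite ler_wpM2l ?invr_ge0 ?sqrtr_ge0//.
rewrite cint_additive; last exact: integrable_on_norm.
apply: le_trans (ler_norm_sum _ _ _) _; apply: ler_sum => s _.
rewrite normrM norm_haar_sign mul1r; apply: norm_cint_le.
by apply: integrable_on_sub If; exact: child_sub.
Qed.

End cube_integrals.

(** * Integration against a weight *)

Section density.
Context d (T : measurableType d) (R : realType).
Variables (mu nu : {measure set T -> \bar R}) (g : T -> R).
Hypotheses (mg : measurable_fun setT g) (g0 : forall x, 0 <= g x).
Hypothesis nuE : forall A, measurable A -> nu A = (\int[mu]_(x in A) (g x)%:E)%E.

Import HBNNSimple.
Local Open Scope ereal_scope.

(** Both sides agree for simple functions and pass to increasing limits. *)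
Lemma integral_density (f : T -> \bar R) : (forall x, 0 <= f x) ->
  measurable_fun setT f ->
  \int[nu]_x f x = \int[mu]_x (f x * (g x)%:E).
Proof.
move=> f0 mf; pose h := nnsfun_approx measurableT mf.
have mgE D : measurable D -> measurable_fun D (EFin \o g).
  by move=> mD; apply: measurable_funTS; exact/measurable_EFinP.
have mhE k : measurable_fun setT (EFin \o h k) by exact/measurable_EFinP.
have fE x : f x = lim ((EFin \o h k) x @[k --> \oo]).
  by apply/esym/cvg_lim => //; exact: cvg_nnsfun_approx.
have -> : \int[nu]_x f x = lim (\int[nu]_x (EFin \o h k) x @[k --> \oo]).
  under eq_integral => x _ do rewrite fE.
  apply: monotone_convergence => //.
  - by move=> k x _ /=; rewrite lee_fin.
  - by move=> x _ a b ab; rewrite lee_fin; exact/lefP/nd_nnsfun_approx.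
have -> : \int[mu]_x (f x * (g x)%:E) =
    lim (\int[mu]_x ((EFin \o h k) x * (g x)%:E) @[k --> \oo]).
  have fg x : f x * (g x)%:E = lim ((EFin \o h k) x * (g x)%:E @[k --> \oo]).
    by apply/esym/cvg_lim => //; apply: cvgeZr => //; exact: cvg_nnsfun_approx.
  under eq_integral => x _ do rewrite fg.
  apply: monotone_convergence => //.
  - by move=> k; apply: emeasurable_funM => //; exact: mgE.
  - by move=> k x _ /=; rewrite mule_ge0 ?lee_fin.
  - move=> x _ a b ab /=; rewrite lee_wpmul2r ?lee_fin//.
    exact/lefP/nd_nnsfun_approx.
suff suf k : \int[mu]_x ((EFin \o h k) x * (g x)%:E) = \int[nu]_x (EFin \o h k) x.
  by under [in RHS]eq_fun do rewrite suf.
transitivity (\int[nu]_x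
   (\sum_(y \in range (h k)) (y * \1_(h k @^-1` [set y]) x)%:E)); last first.
  by apply: eq_integral => t tE; rewrite /= fimfunE -fsumEFin.
have indich r : measurable_fun setT (fun x => (r * \1_(h k @^-1` [set r]) x)%:E).
  by apply/measurable_EFinP; exact: measurable_funM.
rewrite ge0_integral_fsum//; last by move=> y x _; exact: nnfun_muleindic_ge0.
transitivity (\int[mu]_x (\sum_(y \in range (h k))
    (y * \1_(h k @^-1` [set y]) x)%:E * (g x)%:E)).
  under [RHS]eq_integral => x xE.
    rewrite -ge0_mule_fsuml => [|y]; last exact: nnfun_muleindic_ge0.
    rewrite fsumEFin // -(fimfunE _ x); over.
  by [].
rewrite ge0_integral_fsum//; last 2 first.
  - by move=> y; apply: emeasurable_funM => //; exact: mgE.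
  - by move=> y x _; apply: mule_ge0; [rewrite EFinM; exact: nnfun_muleindic_ge0|rewrite lee_fin].
apply: eq_fsbigr => r rhn.
under [RHS]eq_integral do rewrite EFinM.
rewrite integralZl_indic_nnsfun => //.
under eq_integral do rewrite EFinM -muleA.
rewrite ge0_integralZl//.
- congr (_ * _); under eq_integral do rewrite muleC.
  rewrite (eq_integral ((EFin \o g) \_ (h k @^-1` [set r]))); last first.
    by move=> x xE; rewrite epatch_indic.
  by rewrite -integral_mkcond -nuE// integral_indic// setIT.
- by apply: emeasurable_funM; [exact/measurable_EFinP|exact: mgE].
- by move=> t Et; rewrite mule_ge0 ?lee_fin.
- by move: rhn; rewrite inE => -[t _ <-]; rewrite lee_fin.
Qed.

End density.

Section weighted_integral.
Context {R : realType} {n : nat}.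
Local Notation L := (@leb R n).

(** With the absolute value the density is nonnegative everywhere, and not only
    almost everywhere. *)
Lemma wmeasure_normE (w : weight R n) (A : set (Rn R n)) : measurable A ->
  wmeasure w A = (\int[L]_(x in A) `|w x|%:E)%E.
Proof.
move=> mA; have [mw _] := weight_loc w; apply: ae_eq_integral => //.
- by apply: measurable_funTS; exact/measurable_EFinP.
- by apply: measurable_funTS; apply/measurable_EFinP; exact: measurable_normf.
by apply: filterS (weight_pos w) => x w0 _; rewrite ger0_norm// ltW.
Qed.

Lemma integral_wmeasure (w : weight R n) (f : Rn R n -> \bar R) :
  (forall x, (0 <= f x)%E) -> measurable_fun setT f ->
  (\int[wmeasure w]_x f x = \int[L]_x (f x * `|w x|%:E))%E.
Proof.
move=> f0 mf; have [mw _] := weight_loc w.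
rewrite (@integral_density _ _ _ L (wmeasure w) (fun x => `|w x|))//.
- exact: measurable_normf.
- exact: wmeasure_normE.
Qed.

Lemma Lnorm_wmeasure (w : weight R n) (p : R) (f : Rn R n -> R) : p != 0 ->
  measurable_fun setT f ->
  ('N[wmeasure w]_(p%:E)[EFin \o f] `^ p =
   \int[L]_x (`|f x| `^ p * `|w x|)%:E)%E.
Proof.
move=> p0 mf; rewrite poweR_Lnorm// integral_wmeasure.
- by apply: eq_integral => x _; rewrite /= EFinM.
- by move=> x; exact: poweR_ge0.
by apply/measurable_EFinP; exact/measurable_powRf/measurable_normf.
Qed.

End weighted_integral.

(** * Khintchine's inequality *)

Section khintchine.
Context {R : realType}.
Implicit Types (phi psi : R -> R) (l : seq R) (y a p : R).

(** The mean of phi (y + e_1 a_1 + ... + e_N a_N) over all signs e_i, where the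
    a_i are the entries of l. *)
Fixpoint sign_avg phi l y : R :=
  if l is a :: l' then (sign_avg phi l' (y + a) + sign_avg phi l' (y - a)) / 2
  else phi y.

Lemma sign_avg_le phi psi l y : (forall x, phi x <= psi x) ->
  sign_avg phi l y <= sign_avg psi l y.
Proof.
move=> H; elim: l y => [//|a l IH] y /=.
by rewrite ler_wpM2r ?invr_ge0// lerD.
Qed.

Lemma sign_avg_ge0 phi l y : (forall x, 0 <= phi x) -> 0 <= sign_avg phi l y.
Proof.
by move=> H; elim: l y => [//|a l IH] y /=; rewrite divr_ge0// addr_ge0.
Qed.

Lemma sign_avg_lin c1 c2 phi psi l y :
  sign_avg (fun x => c1 * phi x + c2 * psi x) l y =
  c1 * sign_avg phi l y + c2 * sign_avg psi l y.
Proof. by elim: l y => [//|a l IH] y /=; rewrite !IH; field. Qed.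

Lemma sign_avg_sqr l y :
  sign_avg (fun x => x ^+ 2) l y = y ^+ 2 + \sum_(a <- l) a ^+ 2.
Proof.
elim: l y => [|a l IH] y /=; first by rewrite big_nil addr0.
by rewrite !IH big_cons; field.
Qed.

Lemma sign_avg_fourth l y : let S := \sum_(a <- l) a ^+ 2 in
  sign_avg (fun x => x ^+ 4) l y <= y ^+ 4 + 6 * y ^+ 2 * S + 3 * S ^+ 2.
Proof.
elim: l y => [|a l IH] y /=; first by rewrite big_nil expr0n !mulr0 !addr0.
rewrite big_cons; set S := \sum_(_ <- _) _ in IH *.
rewrite ler_pdivrMr//; apply: le_trans (lerD (IH _) (IH _)) _.
have : 0 <= a ^+ 4 by rewrite exprn_even_ge0.
by rewrite -subr_ge0 => H; rewrite -subr_ge0; nra.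
Qed.

(** The first moment is bounded from below through the second and the fourth:
    |t| >= t^2 - (4/27) t^4 for t = x / q with q^2 = S, with equality at
    |t| = 3/2; the means of t^2 and t^4 are 1 and at most 3. *)
Lemma khintchine1 l :
  5 / 9 * Num.sqrt (\sum_(a <- l) a ^+ 2) <= sign_avg (fun x => `|x|) l 0.
Proof.
set S := \sum_(a <- l) a ^+ 2.
have S0 : 0 <= S by apply: sumr_ge0 => a _; exact: sqr_ge0.
have [->|Sn0] := eqVneq S 0.
  by rewrite sqrtr0 mulr0 sign_avg_ge0.
set q := Num.sqrt S; have q0 : 0 < q by rewrite sqrtr_gt0 lt_neqAle eq_sym Sn0.
have qS : q ^+ 2 = S by rewrite sqr_sqrtr.
have pt x : q^-1 * x ^+ 2 + (- (4 / 27) / q ^+ 3) * x ^+ 4 <= `|x|.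
  have [t [t0 E]] : exists t, 0 <= t /\ `|x| = q * t.
    by exists (`|x| / q); rewrite divr_ge0// ?ltW//; split => //; rewrite mulrC divfK ?gt_eqF.
  have -> : x ^+ 4 = (x ^+ 2) ^+ 2 by rewrite -exprM.
  rewrite -[x ^+ 2]real_normK ?num_real// E -subr_ge0.
  have -> : q * t - (q^-1 * (q * t) ^+ 2 + - (4 / 27) / q ^+ 3 * ((q * t) ^+ 2) ^+ 2) =
      q * t * (4 / 27) * (t - 3 / 2) ^+ 2 * (t + 3).
    by field; rewrite gt_eqF.
  apply: mulr_ge0; last lra.
  apply: mulr_ge0; last exact: sqr_ge0.
  by apply: mulr_ge0; [apply: mulr_ge0 => //; exact: ltW|lra].
apply: le_trans (sign_avg_le _ _ pt); rewrite sign_avg_lin sign_avg_sqr.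
have H4 : sign_avg (fun x => x ^+ 4) l 0 <= 3 * (q ^+ 2) ^+ 2.
  apply: (le_trans (sign_avg_fourth l 0)); rewrite -/S qS.
  by rewrite !expr0n/= mulr0 mul0r !add0r.
rewrite expr0n add0r -/S -qS.
suff H A4 : A4 <= 3 * (q ^+ 2) ^+ 2 ->
    5 / 9 * q <= q^-1 * q ^+ 2 + - (4 / 27) / q ^+ 3 * A4 by exact: H.
move=> {}H4.
have -> : q^-1 * q ^+ 2 + - (4 / 27) / q ^+ 3 * A4 =
    q - 4 / 27 * A4 / q ^+ 3 by field; rewrite gt_eqF.
suff : 4 / 27 * A4 / q ^+ 3 <= 4 / 9 * q by lra.
rewrite ler_pdivrMr ?exprn_gt0//.
have -> : 4 / 9 * q * q ^+ 3 = 4 / 27 * (3 * (q ^+ 2) ^+ 2) by field.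
by rewrite ler_pM2l.
Qed.

Lemma powR_mean p (u v : R) : 1 <= p -> 0 <= u -> 0 <= v ->
  ((u + v) / 2) `^ p <= (u `^ p + v `^ p) / 2.
Proof.
rewrite le_eqVlt => /predU1P[<-|p1] u0 v0; first by rewrite !powRr1// divr_ge0// addr_ge0.
have p0 : 0 < p by lra.
have ip : 0 < p^-1 by rewrite invr_gt0.
have ip1 : 0 < 1 - p^-1 by rewrite subr_gt0 invf_lt1.
have [w w1] : exists w : R, w = 1 by exists 1.
have w0 : 0 <= w by rewrite w1.
have := @hoelder_add R p^-1 (1 - p^-1) (u `^ p) (v `^ p) w w ip ip1.
rewrite addrC subrK => /(_ erefl (powR_ge0 _ _) (powR_ge0 _ _) w0 w0).
have -> : w `^ (1 - p^-1) = 1 by rewrite w1 powR1.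
have -> : (u `^ p) `^ p^-1 = u by rewrite powRVM ?gt_eqF.
have -> : (v `^ p) `^ p^-1 = v by rewrite powRVM ?gt_eqF.
rewrite !mulr1 (_ : w + w = 2) ?w1// => H.
rewrite powRM ?addr_ge0//.
apply: (@le_trans _ _ (((u `^ p + v `^ p) `^ p^-1 * 2 `^ (1 - p^-1)) `^ p * 2^-1 `^ p)).
  by rewrite ler_wpM2r ?powR_ge0//; apply: le_powR2; rewrite ?addr_ge0// ltW.
rewrite powRM ?powR_ge0// -!powRrM mulVf ?gt_eqF// powRr1 ?addr_ge0 ?powR_ge0//.
rewrite mulrBl mul1r mulVf ?gt_eqF// -mulrA ler_wpM2l ?addr_ge0 ?powR_ge0//.
rewrite powRB; last by apply/implyP.
rewrite powRr1// mulrAC -powRM// divff// powR1 mul1r//.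
Qed.

Lemma sign_avg_powR p l y : 1 <= p ->
  sign_avg (fun x => `|x|) l y `^ p <= sign_avg (fun x => `|x| `^ p) l y.
Proof.
move=> p1; elim: l y => [//|a l IH] y /=.
apply: le_trans (powR_mean p1 _ _) _; rewrite ?sign_avg_ge0//.
by rewrite ler_wpM2r ?invr_ge0// lerD.
Qed.

Lemma khintchine p l : 1 <= p ->
  (5 / 9) `^ p * (\sum_(a <- l) a ^+ 2) `^ (p / 2) <=
  sign_avg (fun x => `|x| `^ p) l 0.
Proof.
move=> p1; apply: le_trans (sign_avg_powR l 0 p1).
have p0 : 0 <= p by lra.
have S0 : 0 <= \sum_(a <- l) a ^+ 2 by apply: sumr_ge0 => a _; exact: sqr_ge0.
have -> : (\sum_(a <- l) a ^+ 2) `^ (p / 2) = Num.sqrt (\sum_(a <- l) a ^+ 2) `^ p.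
  by rewrite -powR12_sqrt// -powRrM mulrC.
rewrite -powRM ?sqrtr_ge0//.
by apply: le_powR2 => //; exact: khintchine1.
Qed.

Lemma sum_powR_le t l : 1 <= t -> (forall a, a \in l -> 0 <= a) ->
  \sum_(a <- l) a `^ t <= (\sum_(a <- l) a) `^ t.
Proof.
move=> t1; elim: l => [|a l IH] H; first by rewrite !big_nil powR0// gt_eqF//; lra.
rewrite !big_cons.
have a0 : 0 <= a by apply: H; rewrite mem_head.
have H' b : b \in l -> 0 <= b by move=> bl; apply: H; rewrite in_cons bl orbT.
have S0 : 0 <= \sum_(a <- l) a by rewrite big_seq; exact: sumr_ge0.
apply: (@le_trans _ _ (a `^ t + (\sum_(a <- l) a) `^ t)); first by rewrite lerD2l IH.
move: (\sum_(a <- l) a) S0 => b b0 {IH H H'}.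
have t0 : 0 < t by lra.
have E x : 0 <= x -> x `^ t = x * x `^ (t - 1).
  by move=> x0; rewrite mulr_powRB1.
rewrite [leRHS]E ?addr_ge0// mulrDl !E//.
by apply: lerD; rewrite ler_wpM2l//; apply: le_powR2; rewrite ?lerDl ?lerDr//; lra.
Qed.

(** Khintchine's inequality yields an l^2 sum, while norms in L^p add up to an
    l^p sum. The power of the number N of terms on the left is a gain over the
    trivial factor N: for p >= 2 the l^p norm is at most the l^2 norm, and for
    p < 2 Hoelder costs N^(1 - p/2). *)
Lemma sum_norm_powR_le p l : 1 <= p ->
  (size l)%:R `^ (Num.min 1 (p / 2)) * \sum_(a <- l) `|a| `^ p <=
  (size l)%:R * (\sum_(a <- l) a ^+ 2) `^ (p / 2).
Proof.
move=> p1.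
have E a : `|a| `^ p = (a ^+ 2) `^ (p / 2).
  rewrite -real_normK ?num_real// -powR_mulrn// -powRrM; congr (_ `^ _); by field.
under eq_bigr do rewrite E.
have [p2|p2] := leP 1 (p / 2).
  rewrite powRr1// ler_wpM2l//.
  have := @sum_powR_le (p / 2) [seq a ^+ 2 | a <- l] p2.
  by rewrite !big_map; apply => _ /mapP[a _ ->]; exact: sqr_ge0.
have [/size0nil ->|l0] := posnP (size l).
  by rewrite !big_nil mulr0 mul0r.
have := @hoelder_sum R R l xpredT (p / 2) (1 - p / 2) (fun a => a ^+ 2) (fun=> 1)
  ltac:(lra) ltac:(lra) ltac:(lra) (fun a => sqr_ge0 a) (fun=> ler01).
rewrite powR1 big_const_seq count_predT.
rewrite iter_addr_0.
rewrite -mulr_suml mulr1.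
have N0 : 0 < (size l)%:R :> R by rewrite ltr0n.
move=> H; apply: le_trans (ler_wpM2l (powR_ge0 _ _) H) _.
rewrite mulrCA -powRD; last by apply/implyP => _; rewrite gt_eqF.
by rewrite addrC subrK powRr1// mulrC.
Qed.

End khintchine.

(** * Unconditional convergence in L^p *)

Section unconditional.
Context d (T : measurableType d) (R : realType) (m : {measure set T -> \bar R}).
Variable p : R.
Hypothesis p1 : 1 <= p.
Context (I : choiceType) (D : set I) (u : I -> T -> R).
Hypothesis mu : forall i, D i -> measurable_fun setT (u i).
Implicit Types (F : seq I) (c : I -> R) (x : T).

Let p0 : 0 < p. Proof. exact: lt_le_trans p1. Qed.

Definition psum c F x := \sum_(i <- F) c i * u i x.

Definition pnorm (f : T -> R) := (\int[m]_x (`|f x| `^ p)%:E)%E.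

Lemma measurable_psum c F : (forall i, i \in F -> D i) ->
  measurable_fun setT (psum c F).
Proof.
elim: F => [|i F IH] H.
  rewrite (_ : psum c [::] = cst 0); first exact: measurable_cst.
  by apply/funext => x; rewrite /psum big_nil.
rewrite (_ : psum c (i :: F) = fun x => c i * u i x + psum c F x); last first.
  by apply/funext => x; rewrite /psum big_cons.
apply: measurable_funD; last by apply: IH => j jF; apply: H; rewrite in_cons jF orbT.
by apply: measurable_funM => //; apply: mu; apply: H; rewrite mem_head.
Qed.

Lemma measurable_pnorm (f : T -> R) : measurable_fun setT f ->
  measurable_fun setT (fun x => (`|f x| `^ p)%:E).
Proof. by move=> mf; apply/measurable_EFinP/measurable_powRf/measurable_normf. Qed.

Variable K : R.
Hypothesis HK : forall F c, uniq F -> (forall i, i \in F -> D i) ->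
  (forall i, `|c i| <= 1) -> (pnorm (psum c F) <= K%:E)%E.

Let one : I -> R := fun=> 1.

Lemma measurable_sign_avg (l : seq (seq I)) (y : T -> R) :
  (forall F, F \in l -> forall i, i \in F -> D i) -> measurable_fun setT y ->
  measurable_fun setT (fun x => (sign_avg (fun z => `|z| `^ p)
    [seq psum one F x | F <- l] (y x))%:E).
Proof.
elim: l y => [|F l IH] y H my /=; first exact: measurable_pnorm.
have mF : measurable_fun setT (psum one F).
  by apply: measurable_psum; apply: H; rewrite mem_head.
have H' G : G \in l -> forall i, i \in G -> D i.
  by move=> Gl; apply: H; rewrite in_cons Gl orbT.
apply/measurable_EFinP/measurable_funM => //.
by apply: measurable_funD; apply/measurable_EFinP; apply: IH => //;
  [exact: measurable_funD|exact: measurable_funB].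
Qed.

(** Each choice of signs of the blocks gives a sum with coefficients in [-1, 1];
    the block F, whose coefficients are arbitrary, collects the blocks whose
    signs have been chosen. *)
Lemma integral_sign_avg (l : seq (seq I)) F c :
  uniq (F ++ flatten l) -> (forall i, i \in F ++ flatten l -> D i) ->
  (forall i, `|c i| <= 1) ->
  (\int[m]_x (sign_avg (fun z => `|z| `^ p) [seq psum one G x | G <- l]
     (psum c F x))%:E <= K%:E)%E.
Proof.
elim: l F c => [|G l IH] F c /= uF DF c1.
  by rewrite cats0 in uF DF; exact: HK.
have uFG : uniq ((F ++ G) ++ flatten l) by rewrite -catA.
have DFG i : i \in (F ++ G) ++ flatten l -> D i by rewrite -catA; exact: DF.
have FG i : i \in G -> i \in F = false.
  move=> iG; apply/negbTE/negP => iF; move: uF.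
  rewrite cat_uniq => /and3P[_ /hasPn/(_ i)]; rewrite mem_cat iG /= => /(_ isT).
  by rewrite /= iF.
have E e x : psum (fun i => if i \in F then c i else e) (F ++ G) x =
    psum c F x + e * psum one G x.
  rewrite /psum big_cat/=; congr (_ + _).
    by rewrite big_seq [RHS]big_seq; apply: eq_bigr => i ->.
  rewrite mulr_sumr big_seq [RHS]big_seq; apply: eq_bigr => i iG.
  by rewrite FG// mul1r.
have c1' e : `|e| <= 1 -> forall i, `|if i \in F then c i else e| <= 1.
  by move=> e1 i; case: ifP.
have n1 : `|1 : R| <= 1 by rewrite normr1.
have n2 : `|-1 : R| <= 1 by rewrite normrN1.
have := IH (F ++ G) _ uFG DFG (c1' _ n1).
under eq_integral do rewrite E mul1r.
move=> H1; have := IH (F ++ G) _ uFG DFG (c1' _ n2).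
under eq_integral do rewrite E mulN1r.
move=> H2.
have DF' i : i \in F -> D i by move=> iF; apply: DF; rewrite mem_cat iF.
have DG i : i \in G -> D i by move=> iG; apply: DF; rewrite !mem_cat iG orbT.
have Dl H : H \in l -> forall i, i \in H -> D i.
  move=> Hl i iH; apply: DF; rewrite !mem_cat; apply/orP; right; apply/orP; right.
  by apply/flattenP; exists H.
have mF := measurable_psum c DF'; have mG := measurable_psum one DG.
under eq_integral do rewrite mulrC EFinM EFinD.
have s0 l' (y : R) : 0 <= sign_avg (fun z => `|z| `^ p) l' y.
  by apply: sign_avg_ge0 => z; exact: powR_ge0.
rewrite ge0_integralZl_EFin//; last 2 first.
- by move=> x _; rewrite -EFinD lee_fin addr_ge0.
- apply: emeasurable_funD; apply: measurable_sign_avg => //;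
    [exact: measurable_funD|exact: measurable_funB].
rewrite ge0_integralD//; last 4 first.
- by move=> x _; rewrite lee_fin.
- by apply: measurable_sign_avg => //; exact: measurable_funD.
- by move=> x _; rewrite lee_fin.
- by apply: measurable_sign_avg => //; exact: measurable_funB.
apply: (@le_trans _ _ (2^-1%:E * (K%:E + K%:E))%E).
  by rewrite lee_wpmul2l// ?lee_fin// leeD.
by rewrite -EFinD -EFinM lee_fin; lra.
Qed.

(** Khintchine's inequality bounds the average over signs from below by the sum
    of the |psum one F|^p times a power of their number with exponent in ]-1, 0];
    the integral of this sum is at least delta times their number. *)
Lemma block_count (l : seq (seq I)) (delta : R) : 0 < delta ->
  uniq (flatten l) -> (forall i, i \in flatten l -> D i) ->
  (forall F, F \in l -> (delta%:E <= pnorm (psum one F))%E) ->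
  (5 / 9) `^ p * delta * (size l)%:R `^ (Num.min 1 (p / 2)) <= K.
Proof.
move=> d0 ul Dl Hl.
have Dl' F : F \in l -> forall i, i \in F -> D i.
  by move=> Fl i iF; apply: Dl; apply/flattenP; exists F.
have mF F : F \in l -> measurable_fun setT (psum one F).
  by move=> Fl; apply: measurable_psum; exact: Dl'.
have K0 : 0 <= K.
  have := HK (F := [::]) isT (fun i => _) (fun i => _); rewrite -lee_fin.
  move=> /(_ one) H; apply: le_trans (H _ _) => //; last first.
    by move=> i; rewrite normr1.
  by apply: integral_ge0 => x _; rewrite lee_fin powR_ge0.
have [l0|l0] := posnP (size l).
  rewrite l0 powR0 ?mulr0// gt_eqF// lt_min ltr01 divr_gt0//.
set N : R := (size l)%:R in l0 *.
have N0 : 0 < N by rewrite ltr0n.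
set gam := Num.min _ _; set k9 := (5 / 9) `^ p.
have k90 : 0 <= k9 := powR_ge0 _ _.
have n1 : forall i, `|one i| <= 1 by move=> i; rewrite normr1.
have H := @integral_sign_avg l [::] one ul Dl n1.
have low x : k9 * N `^ gam / N * \sum_(F <- l) `|psum one F x| `^ p <=
    sign_avg (fun z => `|z| `^ p) [seq psum one F x | F <- l] (psum one [::] x).
  have -> : psum one [::] x = 0 by rewrite /psum big_nil.
  apply: le_trans (khintchine _ p1); rewrite -/k9 -!mulrA ler_wpM2l//.
  have := @sum_norm_powR_le R p [seq psum one F x | F <- l] p1.
  rewrite size_map -/N -/gam !big_map => H1.
  by rewrite mulrCA ler_pdivrMl.
have mS : measurable_fun setT
    (fun x => (\sum_(F <- l) `|psum one F x| `^ p)%:E).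
  apply/measurable_EFinP; rewrite (_ : (fun x => _) = (fun x =>
      \sum_(F <- l) (if F \in l then `|psum one F x| `^ p else 0))); last first.
    by apply/funext => x; rewrite big_seq [RHS]big_seq; apply: eq_bigr => F ->.
  apply: measurable_sum => F; case: (boolP (F \in l)) => [Fl|_] //.
  by apply: measurable_powRf; apply: measurable_normf; exact: mF.
have c0 : 0 <= k9 * N `^ gam / N by rewrite divr_ge0 ?mulr_ge0 ?powR_ge0// ltW.
have : (\int[m]_x (k9 * N `^ gam / N * \sum_(F <- l) `|psum one F x| `^ p)%:E
    <= K%:E)%E.
  apply: le_trans H; apply: ge0_le_integral => //.
  - move=> x _; rewrite lee_fin mulr_ge0//; apply: sumr_ge0 => F _.
    exact: powR_ge0.
  - apply/measurable_EFinP/measurable_funM => //.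
    exact/measurable_EFinP.
  - apply: (@measurable_sign_avg l (psum one [::])) => //.
    by apply: measurable_psum => i.
  - by move=> x _; rewrite lee_fin.
under eq_integral do rewrite EFinM.
rewrite ge0_integralZl_EFin//; last first.
  by move=> x _; rewrite lee_fin; apply: sumr_ge0 => F _; exact: powR_ge0.
have -> : (\int[m]_x (\sum_(F <- l) `|psum one F x| `^ p)%:E =
    \sum_(F <- l) pnorm (psum one F))%E.
  rewrite (eq_integral (fun x => (\sum_(F <- l)
      (if F \in l then `|psum one F x| `^ p else 0)%:E)%E)); last first.
    move=> x _; rewrite sumEFin; congr EFin.
    by rewrite big_seq [RHS]big_seq; apply: eq_bigr => F ->.
  rewrite ge0_integral_sum//.
  - by rewrite big_seq [RHS]big_seq; apply: eq_bigr => F ->.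
  - move=> F; case: (boolP (F \in l)) => [Fl|_] //.
    by apply: measurable_pnorm; exact: mF.
  - by move=> F x _; case: ifP => _; rewrite lee_fin// powR_ge0.
have : ((N * delta)%:E <= \sum_(F <- l) pnorm (psum one F))%E.
  rewrite /N mulr_natl -(count_predT l) -iter_addr_0 -big_const_seq -sumEFin.
  by rewrite big_seq [X in (_ <= X)%E]big_seq; apply: lee_sum.
move=> H1 H2; rewrite -lee_fin; apply: le_trans H2.
apply: (@le_trans _ _ ((k9 * N `^ gam / N)%:E * (N * delta)%:E)%E).
  rewrite -EFinM lee_fin le_eqVlt; apply/orP; left; apply/eqP.
  by field; rewrite gt_eqF.
by apply: lee_wpmul2l => //; rewrite lee_fin.
Qed.

(** The Cauchy criterion for unconditional convergence: if it failed, disjoint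
    blocks of size delta could be chosen one after the other, against
    block_count. *)
Lemma small_tails (delta : R) : 0 < delta -> exists F0 : seq I,
  (forall i, i \in F0 -> D i) /\
  forall F, uniq F -> (forall i, i \in F -> D i) ->
    (forall i, i \in F -> i \notin F0) -> (pnorm (psum one F) <= delta%:E)%E.
Proof.
move=> d0; apply: contrapT => nH.
have H (F0 : seq I) : (forall i, i \in F0 -> D i) ->
    exists F, [/\ uniq F, (forall i, i \in F -> D i),
      (forall i, i \in F -> i \notin F0) & (delta%:E <= pnorm (psum one F))%E].
  move=> DF0; apply: contrapT => nF; apply: nH; exists F0; split => // F uF DF FF0.
  by rewrite leNgt; apply/negP => /ltW dF; apply: nF; exists F.
have {nH}{}H N : exists l : seq (seq I), [/\ size l = N, uniq (flatten l),
    (forall i, i \in flatten l -> D i) &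
    (forall F, F \in l -> (delta%:E <= pnorm (psum one F))%E)].
  elim: N => [|N [l [<- ul Dl Hl]]]; first by exists [::].
  have [F [uF DF Fl dF]] := H _ Dl.
  exists (F :: l); split; first by [].
  - rewrite /= cat_uniq uF ul andbT; apply/hasPn => i il; apply/negP => iF.
    by have := Fl _ iF; rewrite il.
  - by move=> i; rewrite /= mem_cat => /orP[/DF|/Dl].
  - by move=> G; rewrite in_cons => /orP[/eqP ->|/Hl].
set gam := Num.min 1 (p / 2); set k9 := (5 / 9) `^ p.
have g0 : 0 < gam by rewrite lt_min ltr01 divr_gt0.
have k90 : 0 < k9 by apply: powR_gt0; lra.
(* block_count fails for this number of blocks *)
pose C := (`|K| / (k9 * delta) + 1) `^ gam^-1.
have [l [sl ul Dl Hl]] := H (Num.bound C).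
have := block_count d0 ul Dl Hl; rewrite sl -/gam -/k9.
apply/negP; rewrite -ltNge.
have CN : C <= (Num.bound C)%:R by rewrite ltW// archi_boundP// powR_ge0.
have : C `^ gam <= (Num.bound C)%:R `^ gam.
  by apply: le_powR2 => //; [exact: ltW|exact: powR_ge0].
rewrite /C -/C powRMV ?gt_eqF//; last first.
  by rewrite addr_ge0// divr_ge0// mulr_ge0// ltW.
move=> H1; apply: le_lt_trans (ler_norm K) _.
have H2 : `|K| / (k9 * delta) < (Num.bound C)%:R `^ gam by lra.
by rewrite mulrC; rewrite ltr_pdivrMr ?mulr_gt0 in H2.
Qed.

Lemma psumB F G x : uniq F -> uniq G -> {subset G <= F} ->
  psum one F x - psum one G x = psum one [seq i <- F | i \notin G] x.
Proof.
move=> uF uG GF; rewrite /psum big_filter (bigID (mem G))/=.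
have -> : \sum_(i <- F | i \in G) one i * u i x = \sum_(i <- G) one i * u i x.
  rewrite -big_filter; apply: perm_big.
  apply: uniq_perm => [||i]; rewrite ?filter_uniq//.
  by rewrite mem_filter; case: (boolP (i \in G)) => // /GF.
by rewrite addrAC subrr add0r.
Qed.

End unconditional.

Section complete.
Context d (T : measurableType d) (R : realType) (m : {measure set T -> \bar R}).
Variable p : R.
Hypothesis p1 : 1 <= p.
Local Notation pnorm := (pnorm m p).

Let p0 : 0 < p. Proof. exact: lt_le_trans p1. Qed.

(** Riesz-Fischer: the sum of (2^k |h (k+1) - h k|)^p is integrable, hence finite
    almost everywhere, where |h (k+1) - h k| is then dominated by a geometric
    sequence; Fatou's lemma transfers the rate to the limit. *)
Lemma Lp_limit (h : nat -> T -> R) : (forall k, measurable_fun setT (h k)) ->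
  (forall k j, (k <= j)%N ->
    (pnorm (fun x => h j x - h k x)%R <= ((4^-1 ^+ k) `^ p)%:E)%E) ->
  exists2 g : T -> R, measurable_fun setT g &
    forall k, (pnorm (fun x => g x - h k x)%R <= ((4^-1 ^+ k) `^ p)%:E)%E.
Proof.
move=> mh Hh.
pose t k x := ((2 ^+ k * `|h k.+1 x - h k x|) `^ p)%:E.
have t0 k x : (0 <= t k x)%E by rewrite lee_fin powR_ge0.
have mt k : measurable_fun setT (t k).
  apply/measurable_EFinP/measurable_powRf/measurable_funM => //.
  by apply: measurable_normf; exact: measurable_funB.
pose S x := (\sum_(k <oo) t k x)%E.
have mS : measurable_fun setT S.
  by apply: ge0_emeasurable_sum => // k x _.
have S0 x : (0 <= S x)%E by apply: nneseries_ge0 => k _ _.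
have intS : (\int[m]_x S x < +oo)%E.
  rewrite integral_nneseries//.
  apply: (@le_lt_trans _ _ (\sum_(k <oo) (2 / (2 ^ (k + 1))%:R)%:E)%E).
    apply: lee_nneseries => [k _ _|k _]; first exact: integral_ge0.
    have -> : (\int[m]_x t k x = ((2 ^+ k) `^ p)%:E * pnorm (fun x => h k.+1 x - h k x)%R)%E.
      rewrite /pnorm -ge0_integralZl_EFin ?powR_ge0//.
      - by apply: eq_integral => x _; rewrite -EFinM -powRM ?exprn_ge0.
      - by apply: measurable_pnorm; exact: measurable_funB.
    apply: (le_trans (lee_wpmul2l _ (Hh _ _ (leqnSn k)))).
      by rewrite lee_fin powR_ge0.
    rewrite -EFinM lee_fin -powRM ?exprn_ge0 ?invr_ge0//.
    have -> : (2 : R) ^+ k * 4^-1 ^+ k = 2 / (2 ^ (k + 1))%:R.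
      rewrite -exprMn natrX exprD expr1 invfM mulrCA divff ?mulr1 -?exprVn//.
      by congr (_ ^+ _); field.
    have c1 : 2 / (2 ^ (k + 1))%:R <= 1 :> R.
      by rewrite ler_pdivrMr ?ltr0n ?expn_gt0// mul1r ler_nat addn1 expnS leq_pmulr// expn_gt0.
    apply: ge1r_powR => //; rewrite c1 andbT divr_gt0// ltr0n expn_gt0//.
  have := @cvg_geometric_eseries_half R 2 0.
  by move=> /cvg_lim => -> //; rewrite ltry.
have aeS : {ae m, forall x, (S x < +oo)%E}.
  have : m.-integrable setT S.
    by apply/integrableP; split => //; under eq_integral do rewrite gee0_abs//.
  move=> /(integrable_ae measurableT); apply: filterS => x /(_ I).
  by rewrite ge0_fin_numE.
have cvgh x : (S x < +oo)%E -> cvgn (h ^~ x).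
  move=> Sx; pose C := fine (S x) `^ p^-1.
  have tS k : `|h k.+1 x - h k x| <= geometric C 2^-1 k.
    have tS : (t k x <= S x)%E.
      have /(@nneseries_lim_ge R _ xpredT 0 k.+1) : forall i, (0 <= i)%N -> true ->
        (0 <= t i x)%E by [].
      apply: le_trans; rewrite big_nat_recr//= leeDr//.
      by apply: sume_ge0 => i _.
    have Sfin : S x = (fine (S x))%:E by rewrite fineK// ge0_fin_numE.
    rewrite Sfin lee_fin in tS.
    have := @le_powR2 _ p^-1 _ _ _ (powR_ge0 _ _) tS.
    rewrite powRVM ?gt_eqF ?mulr_ge0 ?exprn_ge0// => /(_ _) H.
    rewrite /geometric /= -/C exprVn ler_pdivlMr ?exprn_gt0// mulrC.
    by apply: H; rewrite invr_ge0 ltW.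
  have : cvgn (series (telescope (h ^~ x))).
    apply: normed_cvg; apply: (@series_le_cvg _ _ (geometric C 2^-1)) => [k|k|k|].
    - exact: normr_ge0.
    - by apply: geometric_ge0; rewrite ?powR_ge0 ?invr_ge0.
    - exact: tS.
    apply: is_cvg_geometric_series.
    by rewrite ger0_norm ?invr_ge0// invf_lt1// ltr1n.
  move=> cs; rewrite (_ : h ^~ x = (fun n => h 0%N x + series (telescope (h ^~ x)) n)).
    by apply: is_cvgD => //; exact: is_cvg_cst.
  by apply/funext => j; rewrite -eq_sum_telescope.
pose g x := fine (limn_esup (fun k => (h k x)%:E)).
have mg : measurable_fun setT g.
  apply: measurableT_comp; first exact: fine_measurable.
  by apply: measurable_fun_limn_esup => k; exact/measurable_EFinP.
exists g => // k.
have gE x : cvgn (h ^~ x) -> h ^~ x @ \oo --> g x.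
  move=> cx; have ce : (fun k => (h k x)%:E) @ \oo --> (limn (h ^~ x))%:E.
    by apply: cvg_EFin => //; exact: nearW.
  by rewrite /g; have [_ ->] := cvg_limn_einf_sup ce.
pose f j x := (`|h (k + j)%N x - h k x| `^ p)%:E.
have mf j : measurable_fun setT (f j).
  by apply: measurable_pnorm; exact: measurable_funB.
have einf0 x : (0 <= limn_einf (f ^~ x))%E.
  rewrite limn_einf_lim; apply: lime_ge; first exact: is_cvg_einfs.
  apply: nearW => j; apply: le_ereal_inf_tmp => _ [i _ <-].
  by rewrite lee_fin powR_ge0.
apply: (@le_trans _ _ (\int[m]_x limn_einf (f ^~ x))%E).
  apply: ae_ge0_le_integral => //.
  - by apply: measurable_pnorm; exact: measurable_funB.
  - rewrite (_ : (fun x => _) = fun x => limn (einfs (f ^~ x))); last first.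
      by apply/funext => x; rewrite limn_einf_lim.
    apply: (emeasurable_fun_cvg (fun j x => einfs (f ^~ x) j)) => [j|x _].
      exact: measurable_fun_einfs.
    exact: is_cvg_einfs.
  apply: filterS aeS => x Sx _.
  have [->|gn] := eqVneq (g x) (h k x).
    by rewrite subrr normr0 powR0 ?gt_eqF// einf0.
  have cf : (f ^~ x) @ \oo --> (`|g x - h k x| `^ p)%:E.
    apply: cvg_EFin; first exact: nearW.
    have /derivable1_diffP/differentiable_continuous cp :
        derivable (powR (R := R) ^~ p) `|g x - h k x| 1.
      by apply: derivable_powR; rewrite in_itv/= andbT normr_gt0 subr_eq0.
    have d1 : (fun j => `|h (k + j)%N x - h k x|) @ \oo --> `|g x - h k x|.
      apply: cvg_norm; apply: cvgB; last exact: cvg_cst.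
      have := gE x (cvgh x Sx); rewrite -(cvg_shiftn k).
      by under eq_fun do rewrite addnC.
    exact: (cvg_comp _ _ d1 cp).
  by have [-> _] := cvg_limn_einf_sup cf.
apply: le_trans (fatou _ _ _ _) _ => //.
  by move=> j x _; rewrite lee_fin powR_ge0.
rewrite limn_einf_lim; apply: lime_le; first exact: is_cvg_einfs.
apply: nearW => j; apply: le_trans (ereal_inf_lbound _) (Hh k (k + j)%N (leq_addr _ _)).
by exists j => //=.
Qed.

Lemma le_poweR (a : R) (x y : \bar R) : 0 <= a -> (0 <= x)%E -> (x <= y)%E ->
  (x `^ a <= y `^ a)%E.
Proof.
move=> a0 x0 xy; rewrite gt0_ler_poweR// in_itv/= leey andbT//.
exact: le_trans xy.
Qed.

Lemma Lnorm_le (f : T -> R) (a : R) : 0 <= a ->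
  ('N[m]_(p%:E)[EFin \o f] <= a%:E)%E = (pnorm f <= (a `^ p)%:E)%E.
Proof.
move=> a0; have pf0 : (0 <= pnorm f)%E.
  by apply: integral_ge0 => x _; rewrite lee_fin powR_ge0.
have NE : ('N[m]_(p%:E)[EFin \o f] = pnorm f `^ p^-1)%E.
  by rewrite unlock; congr poweR.
apply/idP/idP => H.
  have : ('N[m]_(p%:E)[EFin \o f] `^ p <= a%:E `^ p)%E.
    by apply: le_poweR H; [exact: ltW|exact: Lnorm_ge0].
  by rewrite NE -poweRrM mulVf ?gt_eqF// poweRe1.
have : (pnorm f `^ p^-1 <= (a `^ p)%:E `^ p^-1)%E.
  by apply: le_poweR => //; rewrite invr_ge0 ltW.
by rewrite -NE poweR_EFin powRVM ?gt_eqF.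
Qed.

(** By small_tails there are increasing finite sets F k such that the sum over
    any larger set differs from the sum over F k by at most 4^-k in norm;
    Lp_limit provides the limit of the sums over F k. *)
Theorem unconditional_sum (I : choiceType) (D : set I) (u : I -> T -> R) (K : R) :
  0 <= K -> (forall i, D i -> measurable_fun setT (u i)) ->
  (forall (F : seq I) (c : I -> R), uniq F -> (forall i, i \in F -> D i) ->
    (forall i, `|c i| <= 1) ->
    ('N[m]_(p%:E)[EFin \o (fun x => (\sum_(i <- F) c i * u i x)%R)] <= K%:E)%E) ->
  exists g : T -> R, [/\ measurable_fun setT g,
    ('N[m]_(p%:E)[EFin \o g] <= K%:E)%E &
    forall e : R, 0 < e -> exists F0 : seq I, (forall i, i \in F0 -> D i) /\
      forall F, uniq F -> (forall i, i \in F -> D i) -> {subset F0 <= F} ->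
      ('N[m]_(p%:E)[EFin \o (fun x => (g x - \sum_(i <- F) u i x)%R)] <= e%:E)%E].
Proof.
move=> K0 mu HK.
pose one : I -> R := fun=> 1.
have HK' F c : uniq F -> (forall i, i \in F -> D i) -> (forall i, `|c i| <= 1) ->
    (pnorm (psum u c F) <= (K `^ p)%:E)%E.
  by move=> uF DF c1; rewrite -Lnorm_le//; exact: HK.
have q0 k : 0 <= (4^-1 : R) ^+ k by rewrite exprn_ge0 ?invr_ge0.
have dk k : 0 < (4^-1 ^+ k : R) `^ p by rewrite powR_gt0 ?exprn_gt0 ?invr_gt0.
have /choice[G HG] : forall k, exists F0 : seq I, (forall i, i \in F0 -> D i) /\
  forall F, uniq F -> (forall i, i \in F -> D i) ->
    (forall i, i \in F -> i \notin F0) ->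
    (pnorm (psum u one F) <= ((4^-1 ^+ k) `^ p)%:E)%E.
  by move=> k; exact: (small_tails p1 mu HK' (dk k)).
pose F k := undup (flatten [seq G i | i <- iota 0 k.+1]).
have uF k : uniq (F k) by exact: undup_uniq.
have GF k : {subset G k <= F k}.
  move=> i iG; rewrite mem_undup; apply/flattenP; exists (G k) => //.
  by apply: map_f; rewrite mem_iota add0n leq0n ltnSn.
have DF k i : i \in F k -> D i.
  rewrite mem_undup => /flattenP[_ /mapP[j _ ->]] iG.
  by have [H _] := HG j; exact: H.
have FF k j : (k <= j)%N -> {subset F k <= F j}.
  move=> kj i; rewrite !mem_undup => /flattenP[_ /mapP[l + ->]] iG.
  rewrite mem_iota add0n => /andP[_ lk]; apply/flattenP; exists (G l) => //.
  by apply: map_f; rewrite mem_iota add0n leq0n/= (leq_trans lk).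
have tail k (H : seq I) : uniq H -> (forall i, i \in H -> D i) ->
    {subset F k <= H} ->
    (pnorm (fun x => psum u one H x - psum u one (F k) x)%R
      <= ((4^-1 ^+ k) `^ p)%:E)%E.
  move=> uH DH FH; have [_ HGk] := HG k.
  rewrite (_ : (fun x => _) = psum u one [seq i <- H | i \notin F k]); last first.
    by apply/funext => x; rewrite psumB.
  apply: HGk; first exact: filter_uniq.
  - by move=> i; rewrite mem_filter => /andP[_ /DH].
  - by move=> i; rewrite mem_filter => /andP[+ _]; apply: contra => /GF.
have mpsum H : (forall i, i \in H -> D i) -> measurable_fun setT (psum u one H).
  exact: measurable_psum.
have [||g mg Hg] := @Lp_limit (fun k => psum u one (F k)).
- by move=> k; apply: mpsum; exact: DF.
- by move=> k j kj; apply: tail => //; [exact: DF|exact: FF].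
have q_small (e : R) : 0 < e -> exists k, (4^-1 : R) ^+ k <= e.
  move=> e0; exists (Num.bound e^-1).
  have b0 : e^-1 < (Num.bound e^-1)%:R by rewrite archi_boundP// invr_ge0 ltW.
  rewrite exprVn -[leRHS]invrK lef_pV2 ?posrE ?exprn_gt0 ?invr_gt0//.
  apply: le_trans (ltW b0) _; rewrite -natrX ler_nat.
  by rewrite ltnW// ltn_expl.
have sumE F' x : \sum_(i <- F') u i x = psum u one F' x.
  by apply: eq_bigr => i _; rewrite mul1r.
exists g; split => //.
  apply/lee_addgt0Pr => e e0; have [k ke] := q_small _ e0.
  have mF := mpsum _ (DF k).
  have := @minkowski_EFin _ _ _ m (fun x => g x - psum u one (F k) x)
    (psum u one (F k)) p (measurable_funB mg mF) mF p1.
  rewrite (_ : _ \+ _ = g)%R; last by apply/funext => x /=; rewrite subrK.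
  move=> /le_trans; apply; rewrite addeC; apply: leeD.
    by rewrite Lnorm_le//; apply: HK' => // [i|i]; [exact: DF|rewrite normr1].
  apply: (@le_trans _ _ (4^-1 ^+ k)%:E); last by rewrite lee_fin.
  by rewrite Lnorm_le.
move=> e e0; have e2 : 0 < e / 2 by rewrite divr_gt0.
have [k ke] := q_small _ e2.
exists (F k); split => [i|H uH DH FH]; first exact: DF.
have mF := mpsum _ (DF k); have mH := mpsum _ DH.
have := @minkowski_EFin _ _ _ m (fun x => g x - psum u one (F k) x)
    (fun x => psum u one (F k) x - psum u one H x) p
    (measurable_funB mg mF) _ p1.
have mN : measurable_fun setT (fun x => psum u one (F k) x - psum u one H x).
  exact: measurable_funB.
move=> /(_ mN).
rewrite (_ : _ \+ _ = (fun x => g x - \sum_(i <- H) u i x))%R; last first.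
  by apply/funext => x /=; rewrite sumE; ring.
move=> /le_trans; apply.
have -> : e = e / 2 + e / 2 by field.
rewrite EFinD; apply: leeD.
  apply: (@le_trans _ _ (4^-1 ^+ k)%:E); last by rewrite lee_fin.
  by rewrite Lnorm_le.
apply: (@le_trans _ _ (4^-1 ^+ k)%:E); last by rewrite lee_fin.
rewrite Lnorm_le//.
have -> : pnorm (fun x => psum u one (F k) x - psum u one H x) =
    pnorm (fun x => psum u one H x - psum u one (F k) x).
  by apply: eq_integral => x _; rewrite distrC.
exact: tail.
Qed.

End complete.

(** * A_p weights and norming functions *)

Section weights.
Context {R : realType} {n : nat}.
Local Notation cube := (Rn R n * int)%type.
Local Notation signature := {ffun 'I_n -> bool}.
Local Notation L := (@leb R n).
Implicit Types (P Q : cube) (e : signature) (w : weight R n).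

Lemma locally_integrable_on (f : Rn R n -> R) Q :
  locally_integrableRn f -> integrable_on Q f.
Proof.
move=> [mf If]; pose M := \sum_i `|tnth Q.1 i| + side Q.
pose E := [set x : Rn R n | forall i, `|tnth x i| <= M].
have mE : measurable E.
  have -> : E = \bigcap_(i in [set: 'I_n])
      ((fun x : Rn R n => tnth x i) @^-1` `[- M, M]).
    apply/seteqP; split => x H i; first by move=> _ /=; rewrite in_itv/= -ler_norml.
    by have := H i I; rewrite /= in_itv/= -ler_norml.
  apply: fin_bigcap_measurable => // i _; rewrite -[X in measurable X]setTI.
  by apply: measurable_tnth => //; exact: measurable_itv.
apply: (integrableS mE (measurable_cset Q) _ (If M)) => x Qx i.
have l0 := side_gt0 Q; have /andP[Q1 Q2] := Qx i.
have : `|tnth Q.1 i| <= \sum_i `|tnth Q.1 i|.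
  by rewrite (bigD1 i)//= lerDl sumr_ge0.
rewrite /M; move: (\sum_i _) => S; rewrite !ler_norml => /andP[H1 H2].
by apply/andP; split; lra.
Qed.

Lemma weight_measurable w : measurable_fun setT w.
Proof. by have [] := weight_loc w. Qed.

Lemma weight_integrable_on w Q : integrable_on Q w.
Proof. exact: locally_integrable_on (weight_loc w). Qed.

Lemma weight_ge0 w : {ae L, forall x, 0 <= w x}.
Proof. by apply: filterS (weight_pos w) => x /ltW. Qed.

Section dual.
Variables (p : R) (w : weight R n).
Hypothesis p1 : 1 < p.
Let r := p^-1.
Let s := 1 - p^-1.
Let p0 : 0 < p. Proof. exact: lt_trans p1. Qed.
Let r0 : 0 < r. Proof. by rewrite invr_gt0. Qed.
Let s0 : 0 < s. Proof. by rewrite subr_gt0 invf_lt1. Qed.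
Let rs1 : r + s = 1. Proof. by rewrite addrC subrK. Qed.

Lemma conj_exponent : 1 - conj_exp p = - (r / s).
Proof.
have rE : r = 1 - s by rewrite -rs1 addrK.
rewrite /conj_exp -/s rE; move: s s0 => z z0.
by field; rewrite gt_eqF.
Qed.

Lemma measurable_dual : measurable_fun setT (dual_weight p w).
Proof. exact: measurable_powRf (weight_measurable w). Qed.

Lemma dual_ge0 x : 0 <= dual_weight p w x.
Proof. exact: powR_ge0. Qed.

Lemma dual_gt0 : {ae L, forall x, 0 < dual_weight p w x}.
Proof. by apply: filterS (weight_pos w) => x; exact: powR_gt0. Qed.

(** The defining duality of w and w' = w^(1-p'). *)
Lemma weight_dualE x : 0 < w x -> w x `^ r * dual_weight p w x `^ s = 1.
Proof.
move=> w0; rewrite /dual_weight conj_exponent -powRrM mulNr divfK ?gt_eqF//.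
by rewrite powRN mulfV// gt_eqF// powR_gt0.
Qed.

Variable D : set cube.
Hypothesis ApD : Ap D p w.
Variable Q : cube.
Hypothesis DQ : D Q.

Let M := fine (Ap_char D p w).

Let wQ : 0 < cint w Q.
Proof.
by apply: cint_gt0; [exact: weight_measurable|exact: weight_pos|exact: weight_integrable_on].
Qed.

Lemma eavg_cint (f : Rn R n -> R) : integrable_on Q f ->
  eavg f Q = (cint f Q / vol Q)%:E.
Proof.
move=> If; rewrite /eavg -EFin_cint// leb_cset_vol.
by rewrite inver gt_eqF ?vol_gt0// -EFinM mulrC.
Qed.

Let Ap_ineq : (eavg w Q * (eavg (dual_weight p w) Q) `^ (p - 1)%R <= Ap_char D p w)%E.
Proof. by apply: ereal_sup_ubound; exists Q. Qed.

(** An infinite integral of the dual weight would make the characteristic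
    infinite. *)
Lemma dual_integrable_on : integrable_on Q (dual_weight p w).
Proof.
apply: integrable_onP; first exact: measurable_dual.
have -> : (\int[L]_(x in cset Q) `|dual_weight p w x|%:E =
    \int[L]_(x in cset Q) (dual_weight p w x)%:E)%E.
  by apply: eq_integral => x _; rewrite ger0_norm ?dual_ge0.
rewrite ltNge leye_eq; apply/negP => /eqP H.
have := le_lt_trans Ap_ineq ApD; rewrite eavg_cint; last exact: weight_integrable_on.
rewrite /eavg H leb_cset_vol inver gt_eqF ?vol_gt0//.
have vi : 0 < (vol Q)^-1 by rewrite invr_gt0 vol_gt0.
rewrite gt0_muley ?lte_fin// poweRyr; last by rewrite gt_eqF// subr_gt0.
by rewrite gt0_muley ?lte_fin ?divr_gt0 ?vol_gt0// ltxx.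
Qed.

Lemma Ap_char_fin : (Ap_char D p w) = M%:E.
Proof.
rewrite fineK// ge0_fin_numE//; apply: le_trans Ap_ineq.
rewrite eavg_cint; last exact: weight_integrable_on.
by rewrite mule_ge0 ?poweR_ge0// lee_fin divr_ge0// ?ltW ?vol_gt0.
Qed.

(** The p-th root of the A_p condition is symmetric in w and its dual weight. *)
Lemma Ap_cint : cint w Q `^ r * cint (dual_weight p w) Q `^ s <= M `^ r * vol Q.
Proof.
have vQ := vol_gt0 Q.
have dQ : 0 <= cint (dual_weight p w) Q by apply: cint_ge0; exact: dual_ge0.
have := Ap_ineq; rewrite Ap_char_fin !eavg_cint; last 2 first.
- exact: dual_integrable_on.
- exact: weight_integrable_on.
rewrite poweR_EFin -EFinM lee_fin => H.
have := @le_powR2 _ r _ _ (ltW r0) _ H.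
rewrite mulr_ge0 ?divr_ge0 ?powR_ge0 ?(ltW wQ) ?(ltW vQ)// => /(_ isT).
have sE : (p - 1) * r = s by rewrite /r /s; field; rewrite gt_eqF.
rewrite (@powRM _ (cint w Q / vol Q)) ?powR_ge0 ?divr_ge0 ?(ltW wQ) ?(ltW vQ)//.
rewrite -powRrM sE.
rewrite !powRM ?invr_ge0 ?(ltW wQ) ?(ltW vQ)// mulrACA -powRD; last first.
  by rewrite rs1 oner_eq0.
rewrite rs1 powRr1 ?invr_ge0 ?(ltW vQ)//.
by rewrite ler_pdivrMr.
Qed.

(** Hoelder's inequality for the function 1, by weight_dualE. *)
Lemma vol_le_weights :
  vol Q <= cint w Q `^ r * cint (dual_weight p w) Q `^ s.
Proof.
have -> : vol Q = cint (fun=> 1) Q.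
  by rewrite /cint Rintegral_cst ?mul1r//; exact: measurable_cset.
apply: (cint_hoelder (X := fun=> 1) _ _ _ r0 s0 rs1 _ _ _ _ _ _).2 => //.
- exact: weight_measurable.
- exact: measurable_dual.
- by apply: aeW => x; exact: ler01.
- exact: weight_ge0.
- by apply: aeW => x; exact: dual_ge0.
- by apply: filterS (weight_pos w) => x w0; rewrite weight_dualE.
- exact: weight_integrable_on.
- exact: dual_integrable_on.
Qed.

Lemma dual_cint_gt0 : 0 < cint (dual_weight p w) Q.
Proof.
by apply: cint_gt0; [exact: measurable_dual|exact: dual_gt0|exact: dual_integrable_on].
Qed.

Lemma weight_cint_gt0 : 0 < cint w Q.
Proof. exact: wQ. Qed.

Lemma Ap_gt0 : 0 < M.
Proof.
have H : 0 < M `^ r * vol Q.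
  apply: lt_le_trans Ap_cint; rewrite mulr_gt0 ?powR_gt0//.
  exact: dual_cint_gt0.
rewrite pmulr_lgt0 ?vol_gt0// in H.
have M0 : 0 <= M.
  rewrite -lee_fin -Ap_char_fin; apply: le_trans Ap_ineq.
  by rewrite mule_ge0 ?poweR_ge0// eavg_cint ?lee_fin ?divr_ge0 ?ltW ?vol_gt0//;
    exact: weight_integrable_on.
rewrite lt_neqAle M0 andbT eq_sym; apply/eqP => M00.
by move: H; rewrite M00 powR0 ?ltxx// gt_eqF.
Qed.

(** Hoelder's inequality for |f| = (|f|^p w)^(1/p) w'^(1/p'). *)
Lemma Lp_cint (f : Rn R n -> R) : measurable_fun setT f ->
  integrable_on Q (fun x => `|f x| `^ p * `|w x|) ->
  integrable_on Q (fun x => `|f x|) /\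
  cint (fun x => `|f x|) Q <=
    cint (fun x => `|f x| `^ p * `|w x|) Q `^ r * cint (dual_weight p w) Q `^ s.
Proof.
move=> mf If; apply: (cint_hoelder _ _ _ r0 s0 rs1) => //.
- exact: measurable_normf.
- apply: measurable_funM; first exact/measurable_powRf/measurable_normf.
  exact: measurable_normf (weight_measurable w).
- exact: measurable_dual.
- by apply: aeW => x; exact: normr_ge0.
- by apply: aeW => x; rewrite mulr_ge0 ?powR_ge0.
- by apply: aeW => x; exact: dual_ge0.
- apply: filterS (weight_pos w) => x w0.
  rewrite powRM ?powR_ge0// -powRrM mulfV ?gt_eqF// powRr1//.
  by rewrite (ger0_norm (ltW w0)) -mulrA weight_dualE// mulr1.
- exact: dual_integrable_on.
Qed.

End dual.

Section testing_function.
Variables (p : R) (w : weight R n).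
Hypothesis p1 : 1 < p.
Let r := p^-1.
Let s := 1 - p^-1.
Let p0 : 0 < p. Proof. exact: lt_trans p1. Qed.
Let r0 : 0 < r. Proof. by rewrite invr_gt0. Qed.
Let s0 : 0 < s. Proof. by rewrite subr_gt0 invf_lt1. Qed.
Let rs1 : r + s = 1. Proof. by rewrite addrC subrK. Qed.

(** The function that norms h in the duality of L^p(w): its pairing with h is
    the p-th power of the norm of h, by normingM. *)
Definition norming (h : Rn R n -> R) (x : Rn R n) : R :=
  h x * `|h x| `^ (p - 2) * w x.

Lemma norming_norm h x : `|norming h x| = `|h x| `^ (p - 1) * `|w x|.
Proof.
rewrite /norming !normrM (ger0_norm (powR_ge0 _ _)); congr (_ * _).
have [->|h0] := eqVneq (h x) 0.
  by rewrite normr0 mul0r powR0// gt_eqF// subr_gt0.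
rewrite -{1}(powRr1 (normr_ge0 (h x))) -powRD; last first.
  by apply/implyP => _; rewrite normr_eq0.
by congr (_ `^ _); ring.
Qed.

Lemma normingM h x : h x * norming h x = `|h x| `^ p * w x.
Proof.
rewrite /norming !mulrA; congr (_ * _).
have [->|h0] := eqVneq (h x) 0.
  by rewrite normr0 !mul0r powR0// gt_eqF.
rewrite -expr2 -real_normK ?num_real// -powR_mulrn// -powRD; last first.
  by apply/implyP => _; rewrite normr_eq0.
by congr (_ `^ _); ring.
Qed.

Lemma measurable_norming (h : Rn R n -> R) : measurable_fun setT h ->
  measurable_fun setT (norming h).
Proof.
move=> mh; apply: measurable_funM; last exact: weight_measurable.
by apply: measurable_funM => //; exact/measurable_powRf/measurable_normf.
Qed.

Lemma norming_cint Q (h : Rn R n -> R) : measurable_fun setT h ->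
  integrable_on Q (fun x => `|h x| `^ p * `|w x|) ->
  integrable_on Q (fun x => `|norming h x|) /\
  cint (fun x => `|norming h x|) Q <=
    cint (fun x => `|h x| `^ p * `|w x|) Q `^ s * cint w Q `^ r.
Proof.
move=> mh Ih; have sr1 : s + r = 1 by rewrite addrC.
apply: (cint_hoelder _ _ _ s0 r0 sr1) => //.
- by apply: measurable_normf; exact: measurable_norming.
- apply: measurable_funM; first exact/measurable_powRf/measurable_normf.
  exact: measurable_normf (weight_measurable w).
- exact: weight_measurable.
- by apply: aeW => x; exact: normr_ge0.
- by apply: aeW => x; rewrite mulr_ge0 ?powR_ge0.
- exact: weight_ge0.
- apply: filterS (weight_pos w) => x w0.
  rewrite norming_norm powRM ?powR_ge0// -powRrM.
  have -> : p * s = p - 1 by rewrite /s; field; rewrite gt_eqF.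
  rewrite (ger0_norm (ltW w0)) -mulrA -powRD ?sr1 ?powRr1 ?(ltW w0)//.
  by rewrite oner_eq0.
- exact: weight_integrable_on.
Qed.

End testing_function.
End weights.

(** * The two-weight estimate on a grid *)

Section bloom.
Context {R : realType} {n : nat}.
Local Notation cube := (Rn R n * int)%type.
Local Notation signature := {ffun 'I_n -> bool}.
Local Notation L := (@leb R n).
Implicit Types (P Q : cube) (e : signature) (f g h : Rn R n -> R).

Definition haar_form b f g : cube -> R :=
  bloom_form child (@vol R n) (cint f) (cint (fun x => `|f x|))
    (cint g) (cint (fun x => `|g x|)) (cint b).

Lemma haar_form_ge0 b f g Q : 0 <= haar_form b f g Q.
Proof.
rewrite /haar_form /bloom_form divr_ge0 ?sqr_ge0// mulr_ge0//.
  exact: oscillation_ge0.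
by rewrite addr_ge0// mulr_ge0 ?oscillation_ge0// cint_ge0.
Qed.

Lemma integrable_on_abs f Q : measurable_fun setT f ->
  integrable_on Q (fun x => `|f x|) -> integrable_on Q f.
Proof.
move=> mf /integrableP[_ H]; apply: integrable_onP => //.
congr (_ < _)%E: H; apply: eq_integral => x _ /=.
by rewrite normr_id.
Qed.

Lemma integrable_on_cst Q (c : R) : integrable_on Q (fun=> c).
Proof.
apply: integrable_onP; first exact: measurable_cst.
have -> : (\int[L]_(x in cset Q) `|c|%:E = `|c|%:E * L (cset Q))%E.
  exact: integral_cst (measurable_cset Q) _.
by rewrite leb_cset_vol -EFinM ltry.
Qed.

Variable p : R.
Hypothesis p1 : 1 < p.
Hypothesis n_gt0 : (0 < n)%N.
Variable D : set cube.
Hypothesis gD : dyadic_grid D.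
Variables mu lam : weight R n.
Hypotheses (Apmu : Ap D p mu) (Aplam : Ap D p lam).
Variable b : Rn R n -> R.
Local Notation nu := (bloom_weight p mu lam).
Hypothesis bD : BMO D nu b.

Let r := p^-1.
Let s := 1 - p^-1.
Let p0 : 0 < p. Proof. exact: lt_trans p1. Qed.
Let r0 : 0 < r. Proof. by rewrite invr_gt0. Qed.
Let s0 : 0 < s. Proof. by rewrite subr_gt0 invf_lt1. Qed.
Let rs1 : r + s = 1. Proof. by rewrite addrC subrK. Qed.
Let M := fine (Ap_char D p mu).
Let N := fine (Ap_char D p lam).
Let B := fine (bmo_norm D nu b).

Lemma measurable_bloom_weight : measurable_fun setT nu.
Proof.
by apply: measurable_funM; apply: measurable_powRf; exact: weight_measurable.
Qed.

Lemma bloom_weight_cint Q : D Q -> integrable_on Q nu /\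
  cint nu Q <= cint mu Q `^ r * cint (dual_weight p lam) Q `^ s.
Proof.
move=> DQ; apply: (cint_hoelder _ _ _ r0 s0 rs1).
- exact: measurable_bloom_weight.
- exact: weight_measurable.
- exact: measurable_dual.
- by apply: aeW => x; rewrite mulr_ge0 ?powR_ge0.
- exact: weight_ge0.
- by apply: aeW => x; exact: dual_ge0.
- apply: aeW => x; rewrite /bloom_weight /dual_weight conj_exponent//.
  by rewrite -powRrM mulNr divfK// gt_eqF.
- exact: weight_integrable_on.
- exact: (dual_integrable_on p1 Aplam DQ).
Qed.

Lemma bloom_weight_gt0 Q : D Q -> 0 < cint nu Q.
Proof.
move=> DQ; have [In _] := bloom_weight_cint DQ.
apply: cint_gt0 => //; first exact: measurable_bloom_weight.
apply: filterS2 (weight_pos mu) (weight_pos lam) => x m0 l0.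
by rewrite mulr_gt0 ?powR_gt0.
Qed.

Lemma bmo_integrable Q : integrable_on Q b.
Proof. by have [+ _] := bD; exact: locally_integrable_on. Qed.

Let bmo_ub Q : D Q ->
  ((\int[L]_(x in cset Q) (nu x)%:E)^-1 *
    \int[L]_(x in cset Q) (`|b x - avg b Q|)%R%:E <= bmo_norm D nu b)%E.
Proof. by move=> DQ; apply: ereal_sup_ubound; exists Q. Qed.

Lemma bmo_norm_ge0 : (0 <= bmo_norm D nu b)%E.
Proof.
have [Q [DQ _ _]] := grid_cover gD 0 [tuple 0 | i < n].
apply: le_trans (bmo_ub DQ); rewrite mule_ge0//.
  have [In _] := bloom_weight_cint DQ.
  rewrite -EFin_cint// inver gt_eqF ?bloom_weight_gt0// lee_fin invr_ge0.
  exact/ltW/bloom_weight_gt0.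
by apply: integral_ge0 => x _; rewrite lee_fin.
Qed.

Lemma bmo_normE : bmo_norm D nu b = B%:E.
Proof.
by rewrite fineK// ge0_fin_numE ?bmo_norm_ge0//; have [] := bD.
Qed.

Lemma fine_bmo_norm_ge0 : 0 <= B.
Proof. by rewrite fine_ge0// bmo_norm_ge0. Qed.

Definition deviation P : Rn R n -> R := fun x => b x - cint b P / vol P.

Lemma deviation_integrable P Q : integrable_on Q (deviation P).
Proof.
have := integrableB (measurable_cset Q) (bmo_integrable Q)
  (integrable_on_cst Q (cint b P / vol P)).
by apply: eq_integrable => //; exact: measurable_cset.
Qed.

Lemma bmo_cint Q : D Q ->
  cint (fun x => `|deviation Q x|) Q <= B * cint nu Q.
Proof.
move=> DQ; have := bmo_ub DQ; rewrite bmo_normE.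
have [In _] := bloom_weight_cint DQ; have n0 := bloom_weight_gt0 DQ.
rewrite -EFin_cint// inver gt_eqF//.
have -> : (\int[L]_(x in cset Q) `|b x - avg b Q|%:E =
    (cint (fun x => `|deviation Q x|) Q)%:E)%E.
  rewrite EFin_cint; last exact/integrable_on_norm/deviation_integrable.
  by rewrite avgE//; exact: bmo_integrable.
by rewrite -EFinM lee_fin mulrC ler_pdivrMr.
Qed.

(** The nodes of the tree are restricted to the grid, since the A_p and BMO
    conditions concern its cubes only. *)
Definition grid_cube := {Q : cube | D Q}.

Definition grid_half (Q : grid_cube) (s : signature) : grid_cube :=
  exist _ (child (sval Q) s) (grid_child n_gt0 gD s (svalP Q)).

Lemma treesum_grid (phi : cube -> R) k (Q : grid_cube) :
  treesum grid_half (fun P : grid_cube => phi (sval P)) k Q = treesum child phi k (sval Q).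
Proof.
elim: k Q => [//|k IH] Q /=; congr (_ + _).
by apply: eq_bigr => i _; rewrite IH.
Qed.

Lemma additive_grid f : (forall Q, D Q -> integrable_on Q f) ->
  tree_additive grid_half (fun Q : grid_cube => cint f (sval Q)).
Proof. by move=> If Q; exact: cint_additive (If _ (svalP Q)). Qed.

(** The hypotheses of treesum_bloom hold on the grid by Ap_cint, vol_le_weights,
    bloom_weight_cint and bmo_cint for the weights and b, and by Lp_cint and
    norming_cint for the two functions. *)
Lemma treesum_haar_form f h tau k Q : measurable_fun setT f ->
  measurable_fun setT h ->
  (forall P, D P -> integrable_on P (fun x => `|f x| `^ p * `|mu x|)) ->
  (forall P, D P -> integrable_on P (fun x => `|h x| `^ p * `|lam x|)) ->
  D Q -> 0 < tau ->
  treesum child (haar_form b f (norming p lam h)) k Q <=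
  144 * #|{: signature}|%:R * (B * M `^ r * N `^ r) *
  (tau * (2 `^ (s / r) / (s / r * (kappa_const (M `^ r) s / 2))) *
     cint (fun x => `|f x| `^ p * `|mu x|) Q +
   tau `^ (- (r / s)) * (2 `^ (r / s) / (r / s * (kappa_const (N `^ r) r / 2))) *
     cint (fun x => `|h x| `^ p * `|lam x|) Q).
Proof.
move=> mf mh If Ih DQ tau0; set g := norming p lam h.
have mg : measurable_fun setT g by exact: measurable_norming.
have Lf P : D P -> _ := fun DP => Lp_cint p1 Apmu DP mf (If _ DP).
have Lg P : D P -> _ := fun DP => norming_cint p1 mh (Ih _ DP).
have If1 P : D P -> integrable_on P f.
  by move=> DP; apply: integrable_on_abs => //; have [] := Lf _ DP.
have Ig1 P : D P -> integrable_on P g.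
  by move=> DP; apply: integrable_on_abs => //; have [] := Lg _ DP.
rewrite -(treesum_grid (haar_form b f g) k (exist _ Q DQ)).
pose S := fun (X : cube -> R) (P : grid_cube) => X (sval P).
have c0 : (0 < #|{: signature}|)%N by rewrite card_signature expn_gt0.
have key : treesum grid_half (bloom_form grid_half (S (@vol R n)) (S (cint f))
    (S (cint (fun x => `|f x|))) (S (cint g)) (S (cint (fun x => `|g x|)))
    (S (cint b))) k (exist _ Q DQ) <=
  144 * #|{: signature}|%:R * (B * M `^ r * N `^ r) *
  (tau * (2 `^ (s / r) / (s / r * (kappa_const (M `^ r) s / 2))) *
     S (cint (fun x => `|f x| `^ p * `|mu x|)) (exist _ Q DQ) +
   tau `^ (- (r / s)) * (2 `^ (r / s) / (r / s * (kappa_const (N `^ r) r / 2))) *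
     S (cint (fun x => `|h x| `^ p * `|lam x|)) (exist _ Q DQ)); last exact: key.
apply: (@treesum_bloom R grid_cube signature grid_half (S (@vol R n)) _ _ c0
  r s r0 s0 rs1 (S (cint mu)) (S (cint (dual_weight p mu))) (S (cint lam))
  (S (cint (dual_weight p lam))) (S (cint nu))
  (S (cint (fun x => `|f x| `^ p * `|mu x|)))
  (S (cint (fun x => `|h x| `^ p * `|lam x|))) (M `^ r) (N `^ r) B
  _ _ _ _ _ _ _ _ _ _ _ _ _ _ _ _ _
  (S (cint f)) (S (cint (fun x => `|f x|))) (S (cint g))
  (S (cint (fun x => `|g x|))) (S (cint b))
  (fun P0 : grid_cube => S (cint (fun x => `|deviation (sval P0) x|)))
  _ _ _ _ _ _ _ _ _ _ _ _ _ tau k (exist _ Q DQ) tau0).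
- by move=> P; exact: vol_gt0.
- by move=> P e; exact: vol_child.
- by apply: additive_grid => P _; exact: weight_integrable_on.
- by apply: additive_grid => P DP; exact: (dual_integrable_on p1 Apmu DP).
- by apply: additive_grid => P _; exact: weight_integrable_on.
- by apply: additive_grid => P DP; exact: (dual_integrable_on p1 Aplam DP).
- by move=> P; exact: weight_cint_gt0.
- by move=> [P DP]; exact: (dual_cint_gt0 p1 Apmu DP).
- by move=> P; exact: weight_cint_gt0.
- by move=> [P DP]; exact: (dual_cint_gt0 p1 Aplam DP).
- by move=> [P DP]; exact: (vol_le_weights p1 Apmu DP).
- by move=> [P DP]; exact: (Ap_cint p1 Apmu DP).
- by move=> [P DP]; rewrite mulrC; exact: (vol_le_weights p1 Aplam DP).
- by move=> [P DP]; rewrite mulrC; exact: (Ap_cint p1 Aplam DP).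
- by move=> [P DP]; have [] := bloom_weight_cint DP.
- exact: additive_grid.
- exact: additive_grid.
- by move=> P; apply: cint_ge0 => x; rewrite mulr_ge0 ?powR_ge0.
- by move=> P; apply: cint_ge0 => x; rewrite mulr_ge0 ?powR_ge0.
- exact: additive_grid.
- by apply: additive_grid => P DP; have [] := Lf _ DP.
- exact: additive_grid.
- by apply: additive_grid => P DP; have [] := Lg _ DP.
- by apply: additive_grid => P _; exact: bmo_integrable.
- by move=> [P DP]; apply: norm_cint_le; exact: If1.
- by move=> [P DP]; apply: norm_cint_le; exact: Ig1.
- move=> P0; apply: additive_grid => P _.
  exact/integrable_on_norm/deviation_integrable.
- move=> [P0 DP0] [P DP].
  apply: le_trans (norm_cint_le (deviation_integrable P0 P)).
  rewrite /S/= /deviation /cint RintegralB//.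
  + by rewrite Rintegral_cst//; exact: measurable_cset.
  + exact: measurable_cset.
  + exact: bmo_integrable.
  + exact: integrable_on_cst.
- exact: fine_bmo_norm_ge0.
- by move=> [P DP]; exact: bmo_cint.
- by move=> [P DP]; have [] := Lf _ DP.
- by move=> [P DP]; have [] := Lg _ DP.
Qed.

End bloom.

(** * Pairings of the paraproducts *)

Section atoms.
Context {R : realType} {n : nat}.
Local Notation cube := (Rn R n * int)%type.
Local Notation signature := {ffun 'I_n -> bool}.
Local Notation L := (@leb R n).
Implicit Types (P Q : cube) (e : signature) (f g h k : Rn R n -> R).

(** Haar functions and the terms of the paraproducts are of this kind; their
    products with functions integrable on Q are integrable. *)
Definition atom Q k := measurable_fun setT k /\
  exists2 K, 0 <= K & forall x, `|k x| <= K * \1_(cset Q) x.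

Lemma atomZ Q (c : R) k : atom Q k -> atom Q (fun x => c * k x).
Proof.
move=> [mk [K K0 HK]]; split; first exact: measurable_funM.
exists (`|c| * K) => [|x]; first by rewrite mulr_ge0.
by rewrite normrM -mulrA ler_wpM2l.
Qed.

Lemma atomD Q k1 k2 : atom Q k1 -> atom Q k2 -> atom Q (fun x => k1 x + k2 x).
Proof.
move=> [mk1 [K1 K10 HK1]] [mk2 [K2 K20 HK2]]; split; first exact: measurable_funD.
exists (K1 + K2) => [|x]; first by rewrite addr_ge0.
by rewrite mulrDl; apply: le_trans (ler_normD _ _) _; exact: lerD.
Qed.

Lemma atom0 Q : atom Q (fun=> 0).
Proof.
split; first exact: measurable_cst.
by exists 0 => // x; rewrite normr0 mul0r.
Qed.

Lemma atom_sum Q (J : Type) (l : seq J) (A : pred J) (k : J -> Rn R n -> R) :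
  (forall j, A j -> atom Q (k j)) -> atom Q (fun x => \sum_(j <- l | A j) k j x).
Proof.
move=> H; elim: l => [|j l IH].
  rewrite (_ : (fun x => _) = (fun=> 0)); first exact: atom0.
  by apply/funext => x; rewrite big_nil.
rewrite (_ : (fun x => _) = (fun x => if A j then k j x +
    \sum_(j <- l | A j) k j x else \sum_(j <- l | A j) k j x)); last first.
  by apply/funext => x; rewrite big_cons.
by case Aj: (A j) => //; apply: atomD => //; exact: H.
Qed.

Lemma atom_indic Q : atom Q (\1_(cset Q)).
Proof.
split; first by apply: measurable_indic; exact: measurable_cset.
by exists 1 => // x; rewrite mul1r ger0_norm.
Qed.

Lemma atom_haar Q e : atom Q (haar Q e).
Proof.
rewrite (_ : haar Q e = (fun x => \sum_(s : signature)
    (Num.sqrt (vol Q))^-1 * haar_sign e s * \1_(cset (child Q s)) x)); last first.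
  apply/funext => x; rewrite haarE mulr_sumr; apply: eq_bigr => s _.
  by rewrite mulrA.
apply: atom_sum => s _; apply: atomZ; split.
  by apply: measurable_indic; exact: measurable_cset.
exists 1 => // x; rewrite mul1r !indicE.
have [xs|xs] := boolP (x \in cset (child Q s)); last by rewrite normr0.
rewrite mem_set ?normr1//.
by apply: (@child_sub _ _ _ s); rewrite inE in xs.
Qed.

Lemma integrable_atomM Q g k : measurable_fun setT g -> integrable_on Q g ->
  atom Q k -> L.-integrable setT (EFin \o (fun x => k x * g x)).
Proof.
move=> mg Ig [mk [K K0 HK]].
have := integrable_indicM K (integrable_on_norm Ig).
apply: le_integrable => //.
  by apply/measurable_EFinP; exact: measurable_funM.
move=> x _; rewrite lee_fin normrM normrM (ger0_norm (normr_ge0 _)) mulrC.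
rewrite ler_wpM2l//; apply: le_trans (HK x) _.
exact: ler_norm.
Qed.

Lemma Rintegral_comb (J : Type) (l : seq J) (A : pred J) Q (c : J -> R)
    (k : J -> Rn R n -> R) g :
  measurable_fun setT g -> integrable_on Q g -> (forall j, A j -> atom Q (k j)) ->
  \int[L]_x ((\sum_(j <- l | A j) c j * k j x) * g x) =
  \sum_(j <- l | A j) c j * inner g (k j).
Proof.
move=> mg Ig Hk; elim: l => [|j l IH].
  rewrite big_nil; under eq_Rintegral do rewrite big_nil mul0r.
  by rewrite Rintegral_cst// mul0r.
rewrite big_cons; under eq_Rintegral do rewrite big_cons.
case: ifPn => Aj //; under eq_Rintegral do rewrite mulrDl.
have Icl : L.-integrable setT (EFin \o (fun x => (c j * k j x) * g x)).
  by apply: integrable_atomM (atomZ _ (Hk _ Aj)).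
rewrite RintegralD//; last first.
  apply: (integrable_atomM mg Ig); apply: atom_sum => i Ai.
  exact/atomZ/Hk.
rewrite IH; congr (_ + _); rewrite /inner -RintegralZl//.
  by apply: eq_Rintegral => x _; ring.
have := integrable_atomM mg Ig (Hk _ Aj); apply: eq_integrable => // x _ /=.
by rewrite mulrC.
Qed.

Section terms.
Variables (b f g : Rn R n -> R) (Q : cube).
Hypotheses (Ib : integrable_on Q b) (If : integrable_on Q f).
Hypotheses (mg : measurable_fun setT g) (Ig : integrable_on Q g).
Let m : R := #|{: signature}|%:R.
Let v := vol Q.
Let q := (Num.sqrt v)^-1.
Let ob := oscillation child (cint b) Q.
Let osf := oscillation child (cint f) Q.
Let og := oscillation child (cint g) Q.
Let F := cint (fun x => `|f x|) Q.
Let G := cint (fun x => `|g x|) Q.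

Let q0 : 0 <= q. Proof. by rewrite invr_ge0 sqrtr_ge0. Qed.
Let v0 : 0 < v. Proof. exact: vol_gt0. Qed.
Let ob0 : 0 <= ob. Proof. exact: oscillation_ge0. Qed.
Let osf0 : 0 <= osf. Proof. exact: oscillation_ge0. Qed.
Let og0 : 0 <= og. Proof. exact: oscillation_ge0. Qed.
Let F0 : 0 <= F. Proof. exact: cint_ge0. Qed.
Let G0 : 0 <= G. Proof. exact: cint_ge0. Qed.
Let q2 : q * q = v^-1.
Proof. by rewrite /q -invfM -expr2 sqr_sqrtr// ltW. Qed.

Let formE : haar_form b f g Q = ob * (osf * G + og * F) / v ^+ 2.
Proof. by []. Qed.

Let m1 : 1 <= m.
Proof. by rewrite ler1n card_signature expn_gt0. Qed.

Let sum_bound (A : pred signature) (c : signature -> R) (X : R) : 0 <= X ->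
  (forall e, A e -> `|c e| <= X) -> `|\sum_(e | A e) c e| <= m * X.
Proof.
move=> X0 H; apply: le_trans (ler_norm_sum _ _ _) _.
rewrite /m mulr_natl -sumr_const [leLHS]big_mkcond/=.
by apply: ler_sum => e _; case: ifPn => [/H|].
Qed.

(** Each paraproduct needs one of the two summands of haar_form. *)
Let half_form (x : R) : 0 <= x -> x <= osf * G + og * F ->
  m * (ob * x / v ^+ 2) <= m ^+ 2 * haar_form b f g Q.
Proof.
move=> x0 xle; apply: ler_pM; rewrite ?divr_ge0 ?sqr_ge0 ?mulr_ge0//.
- by rewrite ler_eXnr.
- by rewrite formE ler_wpM2r ?invr_ge0 ?sqr_ge0// ler_wpM2l.
Qed.

(** The coefficients of b and g are bounded by oscillations, and <f>_Q by F / v. *)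
Lemma pair_Pi : `|\int[L]_x (Pi_term b f Q x * g x)| <=
  m ^+ 2 * haar_form b f g Q.
Proof.
rewrite /Pi_term (@Rintegral_comb _ _ _ Q) => [|//|//|e _]; last exact: atom_haar.
apply: (@le_trans _ _ (m * (q * ob * (F / v) * (q * og)))).
  apply: sum_bound => [|e ce]; first by rewrite !mulr_ge0 ?invr_ge0// ltW.
  rewrite !normrM; apply: ler_pM; rewrite ?mulr_ge0//.
    apply: ler_pM => //; first exact: inner_haar_le.
    rewrite avgE// normrM (ger0_norm (_ : 0 <= v^-1)) ?invr_ge0 ?(ltW v0)//.
    by rewrite ler_wpM2r ?invr_ge0 ?(ltW v0)//; exact: norm_cint_le.
  exact: inner_haar_le.
have -> : m * (q * ob * (F / v) * (q * og)) = m * (ob * (og * F) / v ^+ 2).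
  rewrite -[in RHS]exprVn [_ ^+ 2]expr2 -{2}q2.
  by ring.
apply: half_form; first by rewrite mulr_ge0.
by rewrite lerDr mulr_ge0.
Qed.

(** The coefficients of b and f are bounded by oscillations, and the pairing of g
    with the indicator of Q by G. *)
Lemma pair_Pi_star : `|\int[L]_x (Pi_star_term b f Q x * g x)| <=
  m ^+ 2 * haar_form b f g Q.
Proof.
rewrite /Pi_star_term.
have -> : (fun x => (\sum_(e | cancellative e) inner b (haar Q e) *
    inner f (haar Q e) * (\1_(cset Q) x / vol Q)) * g x) = (fun x =>
   (\sum_(e | cancellative e) (inner b (haar Q e) *
    inner f (haar Q e) / v) * \1_(cset Q) x) * g x).
  apply/funext => x; congr (_ * _); apply: eq_bigr => e _.
  by rewrite -mulrA mulrCA [in RHS]mulrC -/v; ring.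
rewrite (@Rintegral_comb _ _ _ Q) => [|//|//|e _]; last exact: atom_indic.
apply: (@le_trans _ _ (m * (q * ob * (q * osf) / v * G))).
  apply: sum_bound => [|e ce]; first by rewrite !mulr_ge0 ?invr_ge0// ltW.
  rewrite normrM; apply: ler_pM => //.
    rewrite !normrM (ger0_norm (_ : 0 <= v^-1)) ?invr_ge0 ?(ltW v0)//.
    rewrite ler_wpM2r ?invr_ge0 ?(ltW v0)//.
    by apply: ler_pM => //; exact: inner_haar_le.
  by rewrite /inner -cint_indic; exact: norm_cint_le.
have -> : m * (q * ob * (q * osf) / v * G) = m * (ob * (osf * G) / v ^+ 2).
  rewrite -[in RHS]exprVn [_ ^+ 2]expr2 -{2}q2.
  by ring.
apply: half_form; first by rewrite mulr_ge0.
by rewrite lerDl mulr_ge0.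
Qed.

Lemma sig_add_cancellative (e h : signature) : e != h -> cancellative (sig_add e h).
Proof.
apply: contra => /eqP H; apply/eqP/ffunP => i.
by have := congr1 (fun k : signature => k i) H; rewrite !ffunE => /eqP.
Qed.

(** For e != h the function haar Q (sig_add e h) is cancellative: the
    coefficients of b and g are bounded by oscillations, and that of f by q F. *)
Lemma pair_Gamma : `|\int[L]_x (Gamma_term b f Q x * g x)| <=
  m ^+ 2 * haar_form b f g Q.
Proof.
rewrite /Gamma_term.
have -> : (fun x => (\sum_(e | cancellative e)
   \sum_(h : signature | cancellative h && (e != h))
    inner b (haar Q e) * inner f (haar Q h) * (Num.sqrt (vol Q))^-1 *
      haar Q (sig_add e h) x) * g x) = (fun x => (\sum_(e | cancellative e)
   1 * (fun y => \sum_(h : signature | cancellative h && (e != h))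
    inner b (haar Q e) * inner f (haar Q h) * (Num.sqrt (vol Q))^-1 *
      haar Q (sig_add e h) y) x) * g x).
  by apply/funext => x; congr (_ * _); apply: eq_bigr => e _; rewrite mul1r.
rewrite (@Rintegral_comb _ _ _ Q) => [|//|//|e _]; last first.
  by apply: atom_sum => h _; apply: atomZ; exact: atom_haar.
have S0 : 0 <= q * ob * (q * F) * q * (q * og) by rewrite !mulr_ge0.
apply: (@le_trans _ _ (m * (m * (q * ob * (q * F) * q * (q * og))))).
  apply: sum_bound => [|e ce]; first by rewrite mulr_ge0 ?ler0n.
  rewrite mul1r /inner.
  under eq_Rintegral do rewrite mulrC.
  rewrite (@Rintegral_comb _ _ _ Q) => [|//|//|h _]; last exact: atom_haar.
  apply: sum_bound => // h /andP[ch eh].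
  rewrite !normrM; apply: ler_pM; rewrite ?mulr_ge0//.
    rewrite (ger0_norm q0) ler_wpM2r//.
    apply: ler_pM => //; first exact: inner_haar_le.
    exact: inner_haar_le_norm.
  by apply: inner_haar_le => //; exact: sig_add_cancellative.
have -> : m * (m * (q * ob * (q * F) * q * (q * og))) =
    m ^+ 2 * (ob * (og * F) * (q * q) ^+ 2) by ring.
rewrite q2 exprVn formE ler_wpM2l ?sqr_ge0//.
rewrite ler_wpM2r ?invr_ge0 ?exprn_ge0 ?(ltW v0)// ler_wpM2l//.
by rewrite lerDr mulr_ge0.
Qed.

Lemma atom_Pi : atom Q (Pi_term b f Q).
Proof. by apply: atom_sum => e _; apply: atomZ; exact: atom_haar. Qed.

Lemma atom_Pi_star : atom Q (Pi_star_term b f Q).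
Proof.
apply: atom_sum => e _; apply: atomZ.
rewrite (_ : (fun x => _) = (fun x => (vol Q)^-1 * \1_(cset Q) x)).
  by apply: atomZ; exact: atom_indic.
by apply/funext => x; rewrite mulrC.
Qed.

Lemma atom_Gamma : atom Q (Gamma_term b f Q).
Proof.
apply: atom_sum => e _; apply: atom_sum => h _.
by apply: atomZ; exact: atom_haar.
Qed.

End terms.
End atoms.

(** * From pairings to operator norms *)

Section absorption.
Context {R : realType}.
Variables (r s : R).
Hypotheses (r0 : 0 < r) (s0 : 0 < s) (rs1 : r + s = 1).

(** For tau = (2 kap a2)^(s/r) the second term on the right of the hypothesis is
    X / 2. *)
Lemma absorb (kap a1 a2 X : R) : 0 <= kap -> 0 <= a1 -> 0 < a2 -> 0 <= X ->
  (forall tau, 0 < tau ->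
    X <= kap * (tau * a1 + tau `^ (- (r / s)) * a2 * X)) ->
  X `^ r <= 2 * kap * a2 `^ s * a1 `^ r.
Proof.
rewrite le_eqVlt => /predU1P[<-|k0] a10 a20 X0 H.
  have := H 1 ltr01; rewrite mul0r => X0'.
  have -> : X = 0 by apply/le_anti; rewrite X0 X0'.
  by rewrite powR0 ?gt_eqF// mulr0 !mul0r.
have ka : 0 < 2 * kap * a2 by rewrite !mulr_gt0.
have := H ((2 * kap * a2) `^ (s / r)) (powR_gt0 _ ka).
rewrite -powRrM (_ : s / r * - (r / s) = -1); last first.
  by field; rewrite !gt_eqF.
rewrite powR_inv1 ?(ltW ka)//.
have -> : kap * ((2 * kap * a2) `^ (s / r) * a1 + (2 * kap * a2)^-1 * a2 * X) =
    kap * (2 * kap * a2) `^ (s / r) * a1 + X / 2.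
  by field; rewrite !gt_eqF.
move=> X1; have {}X1 : X <= 2 * kap * (2 * kap * a2) `^ (s / r) * a1 by lra.
have := le_powR2 (ltW r0) X0 X1; move=> /le_trans; apply.
have k20 : 0 <= 2 * kap by rewrite mulr_ge0// ltW.
rewrite !powRM ?mulr_ge0 ?powR_ge0 ?(ltW a20) ?(ltW k0)//.
rewrite -!powRrM (_ : s / r * r = s); last by field; rewrite gt_eqF.
have E (c : R) : 0 <= c -> c `^ r * c `^ s = c.
  by move=> c0; rewrite -powRD rs1 ?powRr1// oner_eq0.
have -> : 2 `^ r * kap `^ r * (2 `^ s * kap `^ s * a2 `^ s) * a1 `^ r =
  (2 `^ r * 2 `^ s) * (kap `^ r * kap `^ s) * a2 `^ s * a1 `^ r by ring.
by rewrite !E// ltW.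
Qed.

(** The inverse of the Carleson gain, with its dependence on the A_p
    characteristic made explicit. *)
Lemma carleson_constE (M c e a t : R) : 0 < M ->
  2 `^ a / (t * (kappa_const (M `^ c) e / 2)) =
  2 `^ a / t * 2 * 2 `^ e^-1 * M `^ (c / e).
Proof.
move=> M0; rewrite /kappa_const powRN !invfM !invrK powRM ?powR_ge0//.
by rewrite -powRrM; ring.
Qed.

(** The constant C(n, p), for r = 1/p, s = 1/p' and m = 2^n. *)
Definition bloom_const (m : R) := 2 * (m ^+ 2 * (144 * m)) *
  (2 `^ (r / s) / (r / s) * 2 * 2 `^ r^-1) `^ s *
  (2 `^ (s / r) / (s / r) * 2 * 2 `^ s^-1) `^ r.

Lemma bloom_const_ge0 m : 0 <= m -> 0 <= bloom_const m.
Proof. by move=> m0; rewrite !mulr_ge0 ?powR_ge0 ?sqr_ge0. Qed.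

Lemma bloom_constE (m B M N Y : R) : 0 < M -> 0 < N -> 0 <= Y ->
  2 * (m ^+ 2 * (144 * m * (B * M `^ r * N `^ r))) *
   (2 `^ (r / s) / (r / s * (kappa_const (N `^ r) r / 2))) `^ s *
   (2 `^ (s / r) / (s / r * (kappa_const (M `^ r) s / 2)) * Y) `^ r =
  bloom_const m * B * M `^ (r / s) * N * Y `^ r.
Proof.
move=> M0 N0 Y0; rewrite !carleson_constE// divff ?gt_eqF// powRr1 ?(ltW N0)//.
set c1 := 2 `^ (s / r) / (s / r) * 2 * 2 `^ s^-1.
set c2 := 2 `^ (r / s) / (r / s) * 2 * 2 `^ r^-1.
have c10 : 0 <= c1 by rewrite !mulr_ge0 ?invr_ge0 ?powR_ge0// ltW// divr_gt0.
have c20 : 0 <= c2 by rewrite !mulr_ge0 ?invr_ge0 ?powR_ge0// ltW// divr_gt0.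
rewrite !(powRM _ (mulr_ge0 c10 (powR_ge0 M _))) ?(powRM _ c10) ?(powRM _ c20) ?powR_ge0 ?(ltW N0)//.
rewrite -powRrM /bloom_const -/c1 -/c2.
have -> : M `^ (r / s) = M `^ r * M `^ (r / s * r).
  rewrite -powRD; last by rewrite (gt_eqF M0) implybT.
  congr (_ `^ _); have -> : r + r / s * r = r / s * (r + s).
    by field; rewrite gt_eqF.
  by rewrite rs1 mulr1.
have NE : N `^ r * N `^ s = N by rewrite -powRD rs1 ?powRr1 ?(ltW N0)// oner_eq0.
rewrite -[in RHS]NE; move: (c2 `^ s) (c1 `^ r) (M `^ r) (M `^ (r / s * r)).
by move: (N `^ r) (N `^ s) (Y `^ r) => N1 N2 Y1 C1 C2 M1 M2; ring.
Qed.

End absorption.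

Section operator.
Context {R : realType} {n : nat}.
Local Notation cube := (Rn R n * int)%type.
Local Notation signature := {ffun 'I_n -> bool}.
Local Notation L := (@leb R n).
Implicit Types (P Q : cube) (e : signature) (f g h : Rn R n -> R).

Lemma sum_cint_le (w : Rn R n -> R) (tops : seq cube) : (forall x, 0 <= w x) ->
  L.-integrable setT (EFin \o w) -> uniq tops -> trivIset [set` tops] (@cset R n) ->
  \sum_(Q <- tops) cint w Q <= \int[L]_x w x.
Proof.
move=> w0 Iw ut tt; rewrite -lee_fin -sumEFin.
have IwQ Q : integrable_on Q w by apply: integrableS Iw => //; exact: measurable_cset.
under eq_bigr do rewrite EFin_cint//.
rewrite /Rintegral fineK; last exact: integrable_fin_num.
have mw : measurable_fun setT (EFin \o w) by exact: measurable_int Iw.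
rewrite -integral_bigsetU_EFin//; last 2 first.
- by move=> Q; exact: measurable_cset.
- exact: measurable_funTS.
apply: ge0_subset_integral => //.
- by apply: bigsetU_measurable => Q _; exact: measurable_cset.
- by move=> x _; rewrite lee_fin.
Qed.

Variable p : R.
Hypothesis p1 : 1 < p.
Hypothesis n_gt0 : (0 < n)%N.
Variable D : set cube.
Hypothesis gD : dyadic_grid D.
Variables mu lam : weight R n.
Hypotheses (Apmu : Ap D p mu) (Aplam : Ap D p lam).
Variable b : Rn R n -> R.
Local Notation nu := (bloom_weight p mu lam).
Hypothesis bD : BMO D nu b.

Let r := p^-1.
Let s := 1 - p^-1.
Let p0 : 0 < p. Proof. exact: lt_trans p1. Qed.
Let r0 : 0 < r. Proof. by rewrite invr_gt0. Qed.
Let s0 : 0 < s. Proof. by rewrite subr_gt0 invf_lt1. Qed.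
Let rs1 : r + s = 1. Proof. by rewrite addrC subrK. Qed.
Let M := fine (Ap_char D p mu).
Let N := fine (Ap_char D p lam).
Let B := fine (bmo_norm D nu b).
Let m : R := #|{: signature}|%:R.

Lemma atom_Lfun (w : weight R n) Q k : atom Q k -> k \in Lfun (wmeasure w) p%:E.
Proof.
move=> [mk [K K0 HK]]; rewrite inE; apply/andP; split; rewrite inE//=.
have H : ('N[wmeasure w]_(p%:E)[EFin \o k] `^ p < +oo)%E.
  rewrite Lnorm_wmeasure ?gt_eqF//.
  have Iw := integrable_indicM (K `^ p) (integrable_on_norm (weight_integrable_on w Q)).
  have := integrable_fin_num measurableT Iw; rewrite ge0_fin_numE; last first.
    by apply: integral_ge0 => x _ /=; rewrite lee_fin !mulr_ge0// powR_ge0.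
  apply: le_lt_trans; apply: ge0_le_integral => //.
  - apply/measurable_EFinP; apply: measurable_funM.
      by apply: measurable_powRf; exact: measurable_normf.
    by apply: measurable_normf; exact: weight_measurable.
  - exact: measurable_int Iw.
  - move=> x _ /=; rewrite lee_fin mulrC ler_wpM2l//.
    have := le_powR2 (ltW p0) (normr_ge0 _) (HK x).
    rewrite powRM// indicE; case: (x \in _); rewrite ?powR1 ?powR0 ?gt_eqF//.
rewrite /finite_norm ltNge leye_eq; apply/negP => /eqP E.
by move: H; rewrite E poweRyr ?gt_eqF// ltxx.
Qed.

Variable term : (Rn R n -> R) -> cube -> Rn R n -> R.
Hypothesis term_atom : forall f Q, atom Q (term f Q).
Hypothesis term_pair : forall f g Q, integrable_on Q b -> integrable_on Q f ->
  measurable_fun setT g -> integrable_on Q g ->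
  `|\int[L]_x (term f Q x * g x)| <= m ^+ 2 * haar_form b f g Q.

Section partial_sums.
Variables (f : Rn R n -> R) (F : seq cube) (c : cube -> R).
Hypotheses (fp : f \in Lfun (wmeasure mu) p%:E).
Hypotheses (uF : uniq F) (DF : forall Q, Q \in F -> D Q).
Hypothesis c1 : forall Q, `|c Q| <= 1.
Let h x := \sum_(Q <- F) c Q * term f Q x.
Let g := norming p lam h.
Let Nf := \int[L]_x (`|f x| `^ p * `|mu x|).
Let X := \int[L]_x (`|h x| `^ p * `|lam x|).

Lemma Lfun_measurable (w : weight R n) k : k \in Lfun (wmeasure w) p%:E ->
  measurable_fun setT k.
Proof. by rewrite inE => /andP[]; rewrite inE. Qed.

Lemma Lfun_integrable_pow (w : weight R n) k : k \in Lfun (wmeasure w) p%:E ->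
  L.-integrable setT (EFin \o (fun x => `|k x| `^ p * `|w x|)).
Proof.
move=> kp; have mk := Lfun_measurable kp.
have : ('N[wmeasure w]_(p%:E)[EFin \o k] < +oo)%E.
  by move: kp; rewrite inE => /andP[_]; rewrite inE.
move=> kf; apply/integrableP; split.
  apply/measurable_EFinP; apply: measurable_funM.
    by apply: measurable_powRf; exact: measurable_normf.
  by apply: measurable_normf; exact: weight_measurable.
under eq_integral do rewrite /= ger0_norm ?mulr_ge0 ?powR_ge0//.
by rewrite -Lnorm_wmeasure ?gt_eqF// poweR_lty.
Qed.

Let p1e : (1 <= p%:E)%E. Proof. by rewrite lee_fin ltW. Qed.

Let hp : h \in Lfun (wmeasure lam) p%:E.
Proof.
rewrite /h; elim: (F) => [|Q l IH].
  rewrite (_ : (fun x => _) = cst 0); last by apply/funext => x; rewrite big_nil.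
  exact: (Lfun_addr_closed _ p1e).1.
rewrite (_ : (fun x => _) = (fun x => c Q * term f Q x) \+
    (fun x => \sum_(P <- l) c P * term f P x)); last first.
  by apply/funext => x; rewrite big_cons.
apply: (Lfun_addr_closed _ p1e).2 IH.
by apply: (@atom_Lfun lam Q); exact: atomZ.
Qed.

Let mf : measurable_fun setT f. Proof. exact: Lfun_measurable fp. Qed.
Let mh : measurable_fun setT h. Proof. exact: Lfun_measurable hp. Qed.
Let mg : measurable_fun setT g. Proof. exact: measurable_norming. Qed.
Let ifp : L.-integrable setT (EFin \o (fun x => `|f x| `^ p * `|mu x|)).
Proof. exact: Lfun_integrable_pow. Qed.
Let ihp : L.-integrable setT (EFin \o (fun x => `|h x| `^ p * `|lam x|)).
Proof. exact: Lfun_integrable_pow. Qed.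

Let on_cube k Q : L.-integrable setT (EFin \o k) -> integrable_on Q k.
Proof. by apply: integrableS => //; exact: measurable_cset. Qed.

Let If Q : D Q -> integrable_on Q f.
Proof.
move=> DQ; apply: integrable_on_abs => //.
by have [] := Lp_cint p1 Apmu DQ mf (on_cube _ ifp).
Qed.

Let Ig Q : integrable_on Q g.
Proof.
apply: integrable_on_abs => //.
by have [] := norming_cint p1 mh (on_cube Q ihp).
Qed.

Let X_pairing : X = \sum_(Q <- F) c Q * \int[L]_x (term f Q x * g x).
Proof.
transitivity (\int[L]_x (h x * g x)).
  rewrite /X /Rintegral; congr fine; apply: ae_eq_integral => //.
  - exact: measurable_int ihp.
  - by apply/measurable_EFinP; exact: measurable_funM.
  apply: filterS (weight_pos lam) => x l0 _ /=.
  by rewrite /g normingM// (ger0_norm (ltW l0)).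
have It Q : L.-integrable setT (EFin \o (fun x => term f Q x * g x)).
  exact: (integrable_atomM mg (Ig Q) (term_atom f Q)).
have H (l : seq cube) :
  L.-integrable setT (EFin \o (fun x => (\sum_(Q <- l) c Q * term f Q x) * g x)) /\
  \int[L]_x ((\sum_(Q <- l) c Q * term f Q x) * g x) =
  \sum_(Q <- l) c Q * \int[L]_x (term f Q x * g x).
  elim: l => [|Q l [IHi IH]].
    rewrite big_nil; under eq_fun do rewrite big_nil mul0r.
    split; last by rewrite Rintegral_cst// mul0r.
    exact: integrable0.
  have E : (fun x => (\sum_(P <- Q :: l) c P * term f P x) * g x) =
    (fun x => c Q * (term f Q x * g x) + (\sum_(P <- l) c P * term f P x) * g x).
    by apply/funext => x; rewrite big_cons mulrDl mulrA.
  have Ic : L.-integrable setT (EFin \o (fun x => c Q * (term f Q x * g x))).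
    exact: (integrableZl measurableT (c Q) (It Q)).
  rewrite E; split; first exact: (integrableD measurableT Ic IHi).
  by rewrite RintegralD// IH big_cons RintegralZl.
exact: (H F).2.
Qed.

(** X is the pairing of h with its norming function g, so that it is bounded by
    sums of haar_form, where X itself comes back as the norm of g. *)
Lemma partial_sum_absorb tau : 0 < tau ->
  X <= m ^+ 2 * (144 * m * (B * M `^ r * N `^ r)) *
   (tau * (2 `^ (s / r) / (s / r * (kappa_const (M `^ r) s / 2)) * Nf) +
    tau `^ (- (r / s)) * (2 `^ (r / s) / (r / s * (kappa_const (N `^ r) r / 2))) * X).
Proof.
move=> t0.
set A1 := 2 `^ (s / r) / _; set A2 := 2 `^ (r / s) / _.
apply: (@le_trans _ _ (m ^+ 2 * \sum_(Q <- F) haar_form b f g Q)).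
  rewrite X_pairing mulr_sumr; apply: le_trans (ler_norm _) _.
  apply: le_trans (ler_norm_sum _ _ _) _; rewrite big_seq [leRHS]big_seq.
  apply: ler_sum => Q QF; rewrite normrM -[leRHS]mul1r; apply: ler_pM => //.
  by apply: term_pair => //; [exact: (bmo_integrable bD)|exact/If/DF].
rewrite -mulrA ler_wpM2l ?sqr_ge0//.
have [k [tops [ut Dt tt H]]] := grid_tops n_gt0 gD uF DF.
apply: le_trans (H _ (haar_form_ge0 b f g)) _.
set K := 144 * m * _.
apply: (@le_trans _ _ (\sum_(Q <- tops) K *
   (tau * A1 * cint (fun x => `|f x| `^ p * `|mu x|) Q +
    tau `^ (- (r / s)) * A2 * cint (fun x => `|h x| `^ p * `|lam x|) Q))).
  rewrite big_seq [leRHS]big_seq; apply: ler_sum => Q Qt.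
  apply: (treesum_haar_form p1 n_gt0 gD Apmu Aplam bD k mf mh) => //.
  - by move=> P _; exact: on_cube.
  - by move=> P _; exact: on_cube.
  - exact: Dt.
have K0 : 0 <= K.
  by rewrite !mulr_ge0 ?powR_ge0// (fine_bmo_norm_ge0 p1 gD mu Aplam b).
have kc (x e : R) : 0 <= kappa_const x e by exact: powR_ge0.
have A10 : 0 <= A1.
  by rewrite divr_ge0 ?powR_ge0// mulr_ge0 ?divr_ge0// ltW.
have A20 : 0 <= A2.
  by rewrite divr_ge0 ?powR_ge0// mulr_ge0 ?divr_ge0// ltW.
rewrite -mulr_sumr ler_wpM2l// big_split/= -!mulr_sumr (mulrA tau A1 Nf).
have pos (k1 w : Rn R n -> R) x : 0 <= `|k1 x| `^ p * `|w x|.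
  by rewrite mulr_ge0 ?powR_ge0.
apply: lerD.
  apply: (ler_wpM2l (mulr_ge0 (ltW t0) A10)).
  exact: (sum_cint_le (pos f mu) ifp ut tt).
apply: (ler_wpM2l (mulr_ge0 (powR_ge0 _ _) A20)).
exact: (sum_cint_le (pos h lam) ihp ut tt).
Qed.

Lemma partial_sum_bound : (exists Q, D Q) ->
  ('N[wmeasure lam]_(p%:E)[EFin \o h] <=
    (bloom_const r s m * B * M `^ (r / s) * N)%:E *
    'N[wmeasure mu]_(p%:E)[EFin \o f])%E.
Proof.
move=> [Q0 DQ0].
have M0 : 0 < M := Ap_gt0 p1 Apmu DQ0.
have N0 : 0 < N := Ap_gt0 p1 Aplam DQ0.
have B0 : 0 <= B := fine_bmo_norm_ge0 p1 gD mu Aplam b.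
have Nf0 : 0 <= Nf by apply: Rintegral_ge0 => x _; rewrite mulr_ge0 ?powR_ge0.
have X0 : 0 <= X by apply: Rintegral_ge0 => x _; rewrite mulr_ge0 ?powR_ge0.
have m0 : 0 <= m by [].
have normE (w : weight R n) k : k \in Lfun (wmeasure w) p%:E ->
    ('N[wmeasure w]_(p%:E)[EFin \o k] =
     ((\int[L]_x (`|k x| `^ p * `|w x|)) `^ r)%:E)%E.
  move=> kp; have mk := Lfun_measurable kp.
  have := Lnorm_wmeasure w (lt0r_neq0 p0) mk.
  rewrite -[RHS]fineK; last exact: integrable_fin_num (Lfun_integrable_pow kp).
  move=> E; rewrite -poweR_EFin -E -poweRrM mulfV ?gt_eqF// poweRe1//.
  exact: Lnorm_ge0.
rewrite !normE// -EFinM lee_fin -/X -/Nf.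
have kc (x e : R) : 0 < x -> 0 < kappa_const x e.
  by move=> x0; rewrite powR_gt0// mulr_gt0.
have := absorb r0 s0 rs1 _ _ _ X0 partial_sum_absorb.
rewrite bloom_constE//; apply.
- by rewrite !mulr_ge0 ?sqr_ge0 ?powR_ge0.
- by rewrite mulr_ge0// divr_ge0 ?powR_ge0// mulr_ge0 ?divr_ge0 ?(ltW (kc _ _ _)) ?powR_gt0// ltW.
- by rewrite divr_gt0 ?powR_gt0// mulr_gt0 ?divr_gt0 ?kc// powR_gt0.
Qed.

End partial_sums.

(** The bound of partial_sum_bound holds for all coefficients in [-1, 1], which is
    what unconditional_sum requires. *)
Theorem opnorm_le : (opnorm (wmeasure mu) (wmeasure lam) p D term <=
  (bloom_const r s m * B * M `^ (r / s) * N)%:E)%E.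
Proof.
have [Q0 [DQ0 _ _]] := grid_cover gD 0 [tuple 0 | i < n].
set K := _ * N.
have K0 : 0 <= K.
  rewrite !mulr_ge0 ?powR_ge0 ?bloom_const_ge0//.
    exact: (fine_bmo_norm_ge0 p1 gD mu Aplam b).
  exact: ltW (Ap_gt0 p1 Aplam DQ0).
apply: ereal_inf_lbound; exists K => //; split => // f fp.
have Nf0 : (0 <= 'N[wmeasure mu]_(p%:E)[EFin \o f])%E by exact: Lnorm_ge0.
have Nf : ('N[wmeasure mu]_(p%:E)[EFin \o f] \is a fin_num)%E.
  by rewrite ge0_fin_numE//; move: fp; rewrite inE => /andP[_]; rewrite inE.
have [||F c uF DF c1|g [mg gK Hg]] := @unconditional_sum _ _ R (wmeasure lam) p (ltW p1)
   (cube : choiceType) D (term f) (K * fine 'N[wmeasure mu]_(p%:E)[EFin \o f]).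
- by rewrite mulr_ge0// fine_ge0.
- by move=> Q _; have [] := term_atom f Q.
- rewrite EFinM fineK//; apply: partial_sum_bound => //.
  by exists Q0.
exists g; split.
- rewrite inE; apply/andP; split; rewrite inE//=.
  by apply: le_lt_trans gK _; rewrite ltry.
- move=> e e0; have [F0 [DF0 HF0]] := Hg e e0.
  exists [set` F0]; split; [exact: finite_seq|by move=> Q /= /DF0|].
  move=> F finF F0F FD.
  under eq_fun do rewrite fsbig_finite//.
  apply: HF0; first exact: finmap.fset_uniq.
  + by move=> Q; rewrite in_fset_set// inE => /FD.
  + by move=> Q /F0F QF; rewrite in_fset_set// inE.
- by rewrite EFinM fineK in gK.
Qed.

End operator.

Theorem theorem3p3 (R : realType) (n : nat) (p : R) (hn : (0 < n)%N)
    (hp : 1 < p) :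
  exists C : R,
  forall D : set (Rn R n * int), dyadic_grid D ->
  forall mu lambda : weight R n, Ap D p mu -> Ap D p lambda ->
  let nu := bloom_weight p mu lambda in
  forall b : Rn R n -> R, BMO D nu b ->
  let bound := (C%:E * bmo_norm D nu b *
    (Ap_char D p mu) `^ (p - 1)^-1%R * Ap_char D p lambda)%E in
  [/\ (opnorm (wmeasure mu) (wmeasure lambda) p D (Pi_term b) <= bound)%E,
      (opnorm (wmeasure mu) (wmeasure lambda) p D (Pi_star_term b) <= bound)%E &
      (opnorm (wmeasure mu) (wmeasure lambda) p D (Gamma_term b) <= bound)%E].
Proof.
exists (bloom_const p^-1 (1 - p^-1) #|{: {ffun 'I_n -> bool}}|%:R).
move=> D gD mu lam Amu Alam nu b bD bound.
have [Q0 [DQ0 _ _]] := grid_cover gD 0 [tuple 0 | i < n].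
have -> : bound = (bloom_const p^-1 (1 - p^-1) #|{: {ffun 'I_n -> bool}}|%:R *
    fine (bmo_norm D nu b) * fine (Ap_char D p mu) `^ (p^-1 / (1 - p^-1)) *
    fine (Ap_char D p lam))%:E.
  rewrite /bound (bmo_normE hp gD Alam bD) (Ap_char_fin Amu DQ0).
  rewrite (Ap_char_fin Alam DQ0) poweR_EFin -!EFinM.
  have p0 : p != 0 by rewrite gt_eqF// (lt_trans ltr01).
  have pE : p^-1 / (1 - p^-1) = (p - 1)^-1.
    by field; rewrite p0 subr_eq0 gt_eqF.
  by rewrite pE.
split; apply: opnorm_le => //.
- by move=> f Q; exact: atom_Pi.
- by move=> f g Q Ib If mg Ig; exact: pair_Pi.
- by move=> f Q; exact: atom_Pi_star.
- by move=> f g Q Ib If mg Ig; exact: pair_Pi_star.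
- by move=> f Q; exact: atom_Gamma.
- by move=> f g Q Ib If mg Ig; exact: pair_Gamma.
Qed.
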